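(* Let $\mathcal{H}$ be a finite dimensional complex Hilbert space, $H\subset\mathcal{H}$ a standard subspace, and $T\in\mathcal{T}_{>}(H)$ a compatible, braided and crossing symmetric twist with $\|T\|<1$. For all $n\ge1$ and all $\xi_1,\dots,\xi_n\in\mathcal{H}$, $$\varPhi(\xi_1\otimes\cdots\otimes\xi_n)=X\bigg(\sum_{\pi\in\mathcal{P}_{1,2}(n)}(-1)^{|p(\pi)|}W^T_\pi(\xi_1\otimes\cdots\otimes\xi_n)\bigg),$$ where $X$ is the linear map with $X(\eta_1\otimes\cdots\otimes\eta_k)=X_T(\eta_1)X_T(\eta_2)\cdots X_T(\eta_k)\in\mathcal{L}_T(H)$ for all $\eta_i\in\mathcal{H}$, and $X(\Omega)=1$.
   Context: Inner products are linear in the second variable. A standard subspace $H$ of a complex Hilbert space $\mathcal{H}$ is a closed real linear subspace with $H\cap iH=\{0\}$ and $H+iH$ dense in $\mathcal{H}$. $S_H$ is the closed antilinear operator with domain $H+iH$, $S_H(h+ih')=h-ih'$ ($h,h'\in H$), with polar decomposition $S_H=J_H\Delta_H^{1/2}$. (If $\dim\mathcal{H}<\infty$, $S_H$ is bounded and defined on all of $\mathcal{H}$.) Twists. Let $T\in B(\mathcal{H}\otimes\mathcal{H})$ be self-adjoint with $\|T\|\le1$. On $\mathcal{H}^{\otimes n}$ put $T_k=1^{\otimes(k-1)}\otimes T\otimes1^{\otimes(n-k-1)}$, $R_{T,n}=1+T_1+T_1T_2+\cdots+T_1\cdots T_{n-1}$, $P_{T,1}=1$, $P_{T,n}=(1\otimes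 P_{T,n-1})R_{T,n}$. $T$ is a twist if $P_{T,n}\ge0$ for all $n\geq 1$, and a strict twist if all $P_{T,n}$ are strictly positive. $T$ is compatible with $H$ if $[\Delta_H^{it}\otimes\Delta_H^{it},T]=0$ for all $t\in\mathbb{R}$; $\mathcal{T}_{>}(H)$ is the set of compatible strict twists. $T$ is braided if $T_1T_2T_1=T_2T_1T_2$ on $\mathcal{H}^{\otimes3}$. $T$ is crossing symmetric (with respect to $H$) if for all $\psi_1,\dots,\psi_4\in\mathcal{H}$ the function $t\mapsto\langle\psi_2\otimes\psi_1,(\Delta_H^{it}\otimes1)T(1\otimes\Delta_H^{-it})(\psi_3\otimes\psi_4)\rangle$, $t\in\mathbb{R}$, extends to a bounded continuous function on $\{0\le\mathrm{Im}\,z\le1/2\}$, analytic in the interior, whose value at $t+\frac i2$ ($t\in\mathbb{R}$) is $\langle\psi_1\otimes J_H\psi_4,(1\otimes\Delta_H^{it})T(\Delta_H^{-it}\otimes1)(J_H\psi_2\otimes\psi_3)\rangle$. Twisted Fock space and algebra. For a strict twist, $\mathcal{F}_T(\mathcal{H})=\bigoplus_{n\ge0}\mathcal{H}_{T,n}$, where $\mathcal{H}_{T,0}=\mathbb{C}\Omega$ ($\Omega$ the unit vacuum vector) and $\mathcal{H}_{T,n}$ is the completion of $\mathcal{H}^{\otimes n}$ for $\langle f,g\rangle_T=\langle f,P_{T,n}g\rangle$; elements of $\mathcal{H}^{\otimes n}$ are regarded as vectors of $\mathcal{F}_T(\mathcal{H})$, and $\mathcal{H}^{\otimes 0}=\mathbb{C}\Omega$.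 For $h\in\mathcal{H}$, $a_T^*(h)$ is the left creation operator $\Phi\mapsto h\otimes\Phi$ on $\mathcal{F}_T(\mathcal{H})$ and $a_T(h)$ is its adjoint (both bounded when $\|T\|<1$). For $\xi\in H+iH$, $X_T(\xi)=a_T^*(\xi)+a_T(S_H\xi)$. $\mathcal{L}_T(H)$ is the von Neumann algebra on $\mathcal{F}_T(\mathcal{H})$ generated by $\{X_T(\xi):\xi\in H\}$. For $T$ as in the claim, $\Omega$ is cyclic and separating for $\mathcal{L}_T(H)$. The $T$-Wick product $\varPhi(\xi_1\otimes\cdots\otimes\xi_n)$ is the unique operator in $\mathcal{L}_T(H)$ with $\varPhi(\xi_1\otimes\cdots\otimes\xi_n)\Omega=\xi_1\otimes\cdots\otimes\xi_n$. Incomplete matchings and $W^T_\pi$. $[n]=\{1,\dots,n\}$. $\mathcal{P}_{1,2}(n)$ is the set of partitions of $[n]$ with all blocks of size 1 (singletons) or 2 (pairings); $p(\pi)$ is the set of pairings, $s(\pi)$ the set of singletons of $\pi$. For pairings $V=\{i,j\}$, $U=\{k,l\}$, write $V<U$ if $i<k<l<j$. An admissible order on $p(\pi)$ is a strict linear order extending $<$. The contraction $C_i:\mathcal{H}^{\otimes k}\to\mathcal{H}^{\otimes(k-2)}$ is $C_i(\xi_1\otimes\cdots\otimes\xi_k)=\langle S_H\xi_i,\xi_{i+1}\rangle\,\xi_1\otimes\cdots\otimes\xi_{i-1}\otimes\xi_{i+2}\otimes\cdots\otimes\xi_k$ ($1\le i<k$). Put $T_{i,j}=T_iT_{i+1}\cdots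 T_{j-1}$ for $j\ge i+1$ and $T_{i,i}=\mathrm{id}$. If $\{i_1,j_1\}<_\varphi\cdots<_\varphi\{i_s,j_s\}$ ($i_m<j_m$) are the pairings of $\pi$ listed in an admissible order $\varphi$, let $r_k(m)$ be the number of elements of $\{i_t,j_t:t<k\}$ that are less than $m$. Then $W^T_\pi:\mathcal{H}^{\otimes n}\to\mathcal{H}^{\otimes|s(\pi)|}$ is $$W^T_\pi=C_{i_s-r_s(i_s)}T_{i_s-r_s(i_s)+1,\,j_s-r_s(j_s)}\cdots C_{i_1-r_1(i_1)}T_{i_1-r_1(i_1)+1,\,j_1-r_1(j_1)}$$ (and $W^T_\pi=\mathrm{id}$ if $p(\pi)=\varnothing$); for $T$ as in the claim this does not depend on the choice of admissible order $\varphi$. *)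

(* Defs.v *)
From HB Require Import structures.
From mathcomp Require Import all_boot all_order all_algebra.
From mathcomp Require Import complex.
From mathcomp Require Import all_classical all_reals all_analysis.

Set Implicit Arguments.
Unset Strict Implicit.
Unset Printing Implicit Defensive.

Import Order.TTheory GRing.Theory Num.Theory numFieldNormedType.Exports.

Local Open Scope classical_set_scope.
Local Open Scope ring_scope.

(* R[i] repackaged so that it carries the topology of a numClosedFieldType. *)
Definition Cx (R : realType) : numClosedFieldType := R[i].

Section FiniteDimHilbert.
Variables (R : realType) (V : vectType (Cx R)).
Variable form : {dot V for Num.conj}.
Local Notation C := (Cx R).

(* MathComp forms are linear on the left, [ip] is linear on the right. *)
Definition ip (u v : V) : C := form v u.

Definition hnorm (v : V) : R := Num.sqrt (complex.Re (ip v v)).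

Lemma dot_extend (s : seq V) : orthonormal form s ->
  (size s < \dim {:V})%N -> exists x : V, orthonormal form (x :: s).
Proof.
move=> os szs.
have /subvPn[v _ vNs] : ~~ ({:V} <= span s)%VS.
  by apply/negP => /dimvS; rewrite leqNgt (leq_ltn_trans (dim_span s) szs).
case/orthonormalP: (os) => us oss.
pose y := v - \sum_(u <- s) form v u *: u.
have y0 : y != 0.
  apply: contra vNs; rewrite subr_eq0 => /eqP ->.
  by rewrite big_seq memv_suml // => u us'; rewrite memvZ // memv_span.
have yo u : u \in s -> form y u = 0.
  move=> uins; rewrite linearBl /= linear_sumlz /=.
  rewrite (bigD1_seq u) //= linearZl_LR /= (oss u u) // eqxx mulr1.
  rewrite big_seq_cond big1 ?addr0 ?subrr // => w /andP[ws wu].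
  by rewrite linearZl_LR /= (oss w u) // (negPf wu) mulr0.
have ny : 0 < form y y by rewrite dnorm_gt0.
pose c := (sqrtC (form y y))^-1.
exists (c *: y); rewrite -cat1s orthonormal_cat os /= andbT.
apply/andP; split.
  rewrite /orthonormal /= !andbT linearZl_LR linearZr_LR /= mulrA.
  have cr : Num.conj c = c by apply: geC0_conj; rewrite invr_ge0 sqrtC_ge0 ltW.
  rewrite cr -expr2 exprVn sqrtCK mulVf //; exact: lt0r_neq0.
rewrite /orthogonal /=.
by apply/allP => u /yo yu0; rewrite /= linearZl_LR /= yu0 mulr0.
Qed.

Lemma orthonormal_basis_exists :
  exists b : (\dim {:V}).-tuple V, basis_of {:V} b && orthonormal form b.
Proof.
have H k : (k <= \dim {:V})%N ->
    exists2 s : seq V, size s = k & orthonormal form s.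
  elim: k => [|k IH] lek; first by exists [::].
  have [s ss os] := IH (ltnW lek).
  have [|x ox] := dot_extend os; first by rewrite ss.
  by exists (x :: s); rewrite //= ss.
have [s ss os] := H _ (leqnn _).
have ss' : size s == \dim {:V} by rewrite ss.
exists (Tuple ss'); rewrite os andbT.
by rewrite basisEfree /= ss leqnn subvf andbT (orthonormal_free os).
Qed.

(* A chosen orthonormal basis, used to write tensors in coordinates. *)
Definition onb : (\dim {:V}).-tuple V :=
  xchoose orthonormal_basis_exists.

Local Notation d := (\dim {:V}).
Local Notation e := (tnth onb).

Definition coord (i : 'I_d) (v : V) : C := ip (e i) v.

Record standard_subspace (H : set V) : Prop := StandardSubspace {
  std_zero : H 0;
  std_add : forall h h', H h -> H h' -> H (h + h');
  std_scale : forall (r : R) h, H h -> H ((r%:C)%C *: h);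
  std_closed : forall v,
    (forall eps : R, 0 < eps -> exists2 h, H h & hnorm (v - h) < eps) -> H v;
  std_separating : forall h h', H h -> H h' -> h = 'i *: h' -> h = 0;
  std_cyclic : forall v (eps : R), 0 < eps ->
    exists h h', [/\ H h, H h' & hnorm (v - (h + 'i *: h')) < eps] }.

Definition tomita (H : set V) (v : V) : V :=
  let p := xget (0, 0)
    [set p : V * V | [/\ H p.1, H p.2 & v = p.1 + 'i *: p.2]] in
  p.1 - 'i *: p.2.

(* The adjoint of an antilinear A, i.e. <v, A^* w> = <w, A v>. *)
Definition antiadjoint (A : V -> V) (w : V) : V :=
  \sum_(i < d) ip w (A (e i)) *: e i.

Definition modular (H : set V) : V -> V :=
  antiadjoint (tomita H) \o tomita H.

(* g(A) for a self-adjoint A, through the spectral theorem for the matrix of A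
   in the orthonormal basis; the eigenvalues are real. *)
Definition funcalc (g : R -> C) (A : V -> V) (v : V) : V :=
  let M : 'M[C]_d := \matrix_(i, j) coord i (A (e j)) in
  let P := spectralmx M in
  let gM := invmx P
    *m diag_mx (map_mx (fun z : C => g (complex.Re z)) (spectral_diag M))
    *m P in
  \sum_(i < d) (\sum_(j < d) gM i j * coord j v) *: e i.

Definition modular_it (H : set V) (t : R) : V -> V :=
  funcalc (fun x => (cos (t * ln x) +i* sin (t * ln x))%C) (modular H).

(* S = J Delta^(1/2), with Delta^(1/2) invertible. *)
Definition modular_conj (H : set V) : V -> V :=
  tomita H \o funcalc (fun x => (((Num.sqrt x)^-1)%:C)%C) (modular H).

(* The vector sum_w f(w) e_{w_1} (x) ... (x) e_{w_n}; a tensor of degree n is a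
   function of the words of length n. A function on all words is a family of
   tensors, one for each degree. *)
Definition word := seq 'I_d.
Definition tens := word -> C.

Fixpoint tensor (xs : seq V) (w : word) : C :=
  match xs, w with
  | [::], [::] => 1
  | x :: xs', i :: w' => coord i x * tensor xs' w'
  | _, _ => 0
  end.

Definition vacuum : tens := tensor [::].

Definition tip (n : nat) (f g : tens) : C :=
  \sum_(w : n.-tuple 'I_d) Num.conj (f w) * g w.

Definition tnorm (n : nat) (f : tens) : R := Num.sqrt (complex.Re (tip n f f)).

(* A linear operator on the tensor square, by its matrix
   T (i, j) (k, l) = <e_i (x) e_j, T (e_k (x) e_l)>. *)
Definition square_op := 'I_d * 'I_d -> 'I_d * 'I_d -> C.

(* A (x) B on the tensor square. *)
Definition otimes2 (A B : V -> V) (f : tens) : tens := fun w =>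
  if w is [:: x; y] then
    \sum_(p : 'I_d * 'I_d)
      coord x (A (e p.1)) * coord y (B (e p.2)) * f [:: p.1; p.2]
  else 0.

Section Twist.
Variable T : square_op.

(* Positions are counted from 0: this is T_{k+1}. *)
Definition opT (k : nat) (f : tens) : tens := fun w =>
  if drop k w is x :: y :: v then
    \sum_(p : 'I_d * 'I_d) T (x, y) p * f (take k w ++ p.1 :: p.2 :: v)
  else 0.

(* opT i \o opT i.+1 \o ... \o opT j.-1 *)
Definition opTseg (i j : nat) (f : tens) : tens :=
  foldr opT f (iota i (j - i)).

Definition RT (n : nat) (f : tens) : tens := fun w =>
  \sum_(k < n) opTseg 0 k f w.

(* 1 (x) A *)
Definition id_otimes (A : tens -> tens) (f : tens) : tens := fun w =>
  if w is x :: v then A (fun u => f (x :: u)) v else 0.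

Fixpoint PT (n : nat) (f : tens) : tens :=
  match n with
  | 0 | 1 => f
  | m.+1 => id_otimes (PT m) (RT n f)
  end.

Definition square_op_norm : R :=
  sup [set x | exists2 f : tens, tnorm 2 f <= 1 & x = tnorm 2 (opT 0 f)].

Definition selfadjoint : Prop :=
  forall f g : tens, tip 2 (opT 0 f) g = tip 2 f (opT 0 g).

Definition tipT (n : nat) (f g : tens) : C := tip n f (PT n g).

Definition strict_twist : Prop :=
  [/\ selfadjoint, square_op_norm <= 1 &
    forall n (f : tens), (1 <= n)%N ->
      (exists2 w : word, size w = n & f w != 0) -> 0 < tipT n f f].

Definition compatible (H : set V) : Prop :=
  forall (t : R) (f : tens) (w : word), size w = 2 ->
    let D2 := otimes2 (modular_it H t) (modular_it H t) in
    D2 (opT 0 f) w = opT 0 (D2 f) w.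

Definition braided : Prop :=
  forall (f : tens) (w : word), size w = 3 ->
    opT 0 (opT 1 (opT 0 f)) w = opT 1 (opT 0 (opT 1 f)) w.

Definition analytic_at (F : C -> C) (z0 : C) : Prop :=
  exists (r : R) (a : nat -> C), 0 < r /\
    forall z : C, `|z - z0| < (r%:C)%C ->
      series (fun k => a k * (z - z0) ^+ k) @ \oo --> F z.

Definition strip : set C :=
  [set z | 0 <= complex.Im z /\ complex.Im z <= 2^-1].

Definition crossing_symmetric (H : set V) : Prop :=
  let D := modular_it H in let J := modular_conj H in
  forall psi1 psi2 psi3 psi4 : V, exists F : C -> C,
    [/\ {within strip, continuous F},
        exists M : R, forall z, strip z -> `|F z| <= (M%:C)%C,
        forall z : C, 0 < complex.Im z -> complex.Im z < 2^-1 ->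
          analytic_at F z,
        forall t : R, F (t%:C)%C =
          tip 2 (tensor [:: psi2; psi1])
            (otimes2 (D t) id (opT 0 (otimes2 id (D (- t))
              (tensor [:: psi3; psi4])))) &
        forall t : R, F (t +i* 2^-1)%C =
          tip 2 (tensor [:: psi1; J psi4])
            (otimes2 id (D t) (opT 0 (otimes2 (D (- t)) id
              (tensor [:: J psi2; psi3]))))].

(* For a strict twist, <., P_{T,n} .> is an inner product on the
   finite-dimensional n-fold tensor power, which is hence already complete.
   The Fock space consists of the f with sum_n <f_n, P_{T,n} f_n> finite. *)
Definition fock : set tens :=
  [set f | cvgn (series (fun n => complex.Re (tipT n f f)))].

Definition fip (f g : tens) : C :=
  (limn (series (fun n => complex.Re (tipT n f g)))
   +i* limn (series (fun n => complex.Im (tipT n f g))))%C.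

Definition fnorm (f : tens) : R := Num.sqrt (complex.Re (fip f f)).

(* Operators on the Fock space; only their values on [fock] matter. *)
Definition fop := tens -> tens.

Definition bounded_op (A : fop) : Prop :=
  [/\ forall f, fock f -> fock (A f),
      forall (a : C) f g, fock f -> fock g ->
        A (fun w => a * f w + g w) = (fun w => a * A f w + A g w) &
      exists M : R, forall f, fock f -> fnorm (A f) <= M * fnorm f].

(* B is the adjoint of A. *)
Definition adjoint_op (A B : fop) : Prop :=
  forall f g, fock f -> fock g -> fip (B f) g = fip f (A g).

Definition commutant (M : set fop) : set fop :=
  [set B | bounded_op B /\
    forall A, M A -> forall f, fock f -> A (B f) = B (A f)].

Definition von_neumann (M : set fop) : Prop :=
  [/\ M `<=` bounded_op,
      forall A B, M A -> bounded_op B -> adjoint_op A B -> M B &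
      commutant (commutant M) = M].

Definition von_neumann_generated (G : set fop) : set fop :=
  [set A | forall M, von_neumann M -> G `<=` M -> M A].

Definition creation (h : V) : fop := fun f w =>
  if w is i :: v then coord i h * f v else 0.

Definition annihilation (h : V) : fop :=
  @xget {classic fop} (fun _ _ => 0)
    [set B | bounded_op B /\ adjoint_op (creation h) B].

Section Algebra.
Variable H : set V.

Definition field_op (xi : V) : fop := fun f w =>
  creation xi f w + annihilation (tomita H xi) f w.

Definition left_algebra : set fop :=
  von_neumann_generated [set field_op h | h in H].

(* The T-Wick product of a tensor. *)
Definition wick (t : tens) : fop :=
  @xget {classic fop} (fun _ _ => 0)
    [set A | left_algebra A /\ A vacuum = t].

(* X_T(e_{w_1}) ... X_T(e_{w_n}) *)
Definition field_word (w : word) : fop :=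
  foldr (fun i (A : fop) => field_op (e i) \o A) id w.

(* The map X on finite sums of tensors. As X_T(xi) is complex linear in xi,
   X(eta_1 (x) ... (x) eta_k) = X_T(eta_1) ... X_T(eta_k). *)
Definition field_map (t : tens) : fop := fun f v =>
  \sum_(w \in [set: word]) t w * field_word w f v.

(* Positions are counted from 0: this is C_{i+1}. *)
Definition contraction (i : nat) (f : tens) : tens := fun w =>
  \sum_(p : 'I_d * 'I_d)
    ip (tomita H (e p.1)) (e p.2) * f (take i w ++ p.1 :: p.2 :: drop i w).

(* [ps] lists the pairings not yet contracted; [used] contains the endpoints of
   those already contracted, so that [r] is the function r_k. *)
Fixpoint contract_pairs (used : seq nat) (ps : seq (nat * nat)) (f : tens) :
    tens :=
  if ps is (i, j) :: ps' then
    let r m := count (fun x => x < m)%N used in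
    contract_pairs [:: i, j & used] ps'
      (contraction (i - r i) (opTseg (i - r i).+1 (j - r j) f))
  else f.

Definition WT (ps : seq (nat * nat)) : tens -> tens := contract_pairs [::] ps.

End Algebra.
End Twist.
End FiniteDimHilbert.

Local Close Scope classical_set_scope.

Definition partitions12 (n : nat) : {set {set {set 'I_n}}} :=
  [set P : {set {set 'I_n}} | finset.partition P [set: 'I_n] &&
    [forall B in P, (#|B| == 1%N) || (#|B| == 2%N)]].

Definition pairings n (P : {set {set 'I_n}}) : {set {set 'I_n}} :=
  [set B in P | #|B| == 2%N].

(* The pairs (i, j) with i < j and {i, j} in P. *)
Definition ordered_pairings n (P : {set {set 'I_n}}) : {set 'I_n * 'I_n} :=
  [set p : 'I_n * 'I_n | (p.1 < p.2)%N & ([set p.1; p.2] \in P)].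

(* An admissible order is given as the increasing enumeration of the pairings:
   {i, j} comes before {k, l} whenever i < k < l < j. *)
Definition admissible n (P : {set {set 'I_n}}) (s : seq ('I_n * 'I_n)) : Prop :=
  [/\ uniq s, s =i ordered_pairings P &
    forall p q, p \in s -> q \in s ->
      (p.1 < q.1)%N -> (q.2 < p.2)%N -> (index p s < index q s)%N].

Definition val_pairs n (s : seq ('I_n * 'I_n)) : seq (nat * nat) :=
  [seq (val p.1, val p.2) | p <- s].

(* Main.v *)
Require Import Defs.
From HB Require Import structures.
From mathcomp Require Import all_boot all_order all_algebra.
From mathcomp Require Import complex ring lra zify.
From mathcomp Require Import all_classical all_reals all_analysis.
Import Order.TTheory GRing.Theory Num.Theory numFieldNormedType.Exports.
Local Open Scope classical_set_scope.
Local Open Scope ring_scope.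

Set Implicit Arguments.
Unset Strict Implicit.
Unset Printing Implicit Defensive.

(** The Wick product of a tensor [t] is the operator of the left algebra that maps
the vacuum to [t].  The proof writes down a polynomial in the field operators
that maps the vacuum to [t], and shows that the vacuum separates the left
algebra, so that this polynomial is the Wick product ([wick_Qop]).

A field operator creates a first tensor factor, and contracts its argument with
every factor that is already there, after the twist has brought that factor to
the front ([sum_annL]).  To obtain [t] from the vacuum one subtracts these
contractions recursively; the coefficients [Qop] of the resulting polynomial
satisfy [Gf_Qop].  Unfolding the recursion, the first point stays alone or is
matched with a later one, and each matched pair gives a sign: [Qop] is the signed
sum over incomplete matchings, contracted by increasing left ends
([matchings_Qop]).  Every other admissible order gives the same contraction
([cpairs_sorted]), as two consecutive pairs of which neither encloses the other
may be exchanged: disjoint pairs because the operators act on different factors,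
crossing pairs by the braid relation and the relation [C_1 T_2 = C_2 T_1]
([swap_crossing]).  In this way [Qop] becomes the sum over partitions ([WT_sum]).

For the separation property there are right field operators, which create the
last tensor factor.  The kernel of the twisted inner product can be built from
the right as well, by the braid relation ([PTSr]), so that right creation has a
well behaved adjoint; creation is bounded by an argument of Lax ([lax_bound]).
Left and right fields commute ([fieldL_fieldR]): here [C_1 T_2 = C_2 T_1] is used
to carry a vector through a whole tensor ([contraction_sweep]).  The commutant of
the right fields is thus a von Neumann algebra that contains the left algebra,
and its elements are determined by their value on the vacuum, from which the
right fields create everything ([commutant_separating]).

The relation [C_1 T_2 = C_2 T_1] is crossing symmetry in algebraic form
([crossing_kernel]).  In finite dimension the crossing function is explicit, a
sum of exponentials, and a continuous function on the strip that is analytic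
inside is determined by its values on the lower edge.  It is enough to compare
at the point [i / 2] ([strip_unique]), where the boundary condition becomes a
statement about [T] and the Tomita operator. *)

(** * Orthonormal coordinates and antilinear maps *)

Section OrthonormalBasis.
Variables (R : realType) (V : vectType (Cx R)) (form : {dot V for Num.conj}).
Local Notation C := (Cx R).
Local Notation d := (\dim {:V}).
Local Notation e := (tnth (onb form)).
Local Notation coord := (Defs.coord form).

Lemma ip_linear u (a : C) v w : ip form u (a *: v + w) = a * ip form u v + ip form u w.
Proof. by rewrite /ip linearPl. Qed.

Lemma ip_conj u v : ip form v u = Num.conj (ip form u v).
Proof. by rewrite /ip hermC /= expr0 mul1r. Qed.

Lemma ipDr u v w : ip form u (v + w) = ip form u v + ip form u w.
Proof. by rewrite /ip linearDl. Qed.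

Lemma ipZr u (a : C) v : ip form u (a *: v) = a * ip form u v.
Proof. by rewrite /ip linearZl_LR. Qed.

Lemma ip_sumr (I : Type) (r : seq I) (P : pred I) (F : I -> V) u :
  ip form u (\sum_(i <- r | P i) F i) = \sum_(i <- r | P i) ip form u (F i).
Proof. by rewrite /ip linear_sumlz. Qed.

Lemma ipZl (a : C) u v : ip form (a *: u) v = Num.conj a * ip form u v.
Proof. by rewrite ip_conj ipZr rmorphM /= -ip_conj. Qed.

Lemma ipDl u v w : ip form (v + w) u = ip form v u + ip form w u.
Proof. by rewrite ip_conj ipDr rmorphD /= -!ip_conj. Qed.

Lemma ip_suml (I : Type) (r : seq I) (P : pred I) (F : I -> V) u :
  ip form (\sum_(i <- r | P i) F i) u = \sum_(i <- r | P i) ip form (F i) u.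
Proof. by rewrite ip_conj ip_sumr rmorph_sum; apply: eq_bigr => i _ /=; rewrite -ip_conj. Qed.

Lemma ip_ge0 v : 0 <= ip form v v.
Proof. exact: dnorm_ge0. Qed.

Lemma ip_gt0 v : v != 0 -> 0 < ip form v v.
Proof. by move=> v0; rewrite /ip dnorm_gt0. Qed.

Lemma onbP : basis_of {:V} (onb form) && orthonormal form (onb form).
Proof. exact: xchooseP (orthonormal_basis_exists form). Qed.

Lemma ip_onb i j : ip form (e i) (e j) = (i == j)%:R.
Proof.
have /andP[_ /orthonormalP[uo oo]] := onbP.
rewrite /ip oo ?mem_tnth // eq_sym; congr (nat_of_bool _)%:R.
by rewrite !(tnth_nth 0) nth_uniq // size_tuple.
Qed.

Lemma onb_expand v : v = \sum_i coord i v *: e i.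
Proof.
have /andP[bo _] := onbP.
have E := coord_basis bo (memvf v).
rewrite {1}E; apply: eq_bigr => i _; rewrite -tnth_nth; congr (_ *: _).
rewrite /Defs.coord {2}E ip_sumr (bigD1 i) //= big1 => [|j ji].
  by rewrite ipZr -tnth_nth ip_onb eqxx mulr1 addr0.
by rewrite ipZr -tnth_nth ip_onb eq_sym (negPf ji) mulr0.
Qed.

Lemma coordP u v : (forall i, coord i u = coord i v) -> u = v.
Proof.
by move=> uv; rewrite (onb_expand u) (onb_expand v); apply: eq_bigr => i _; rewrite uv.
Qed.

Lemma coord_sum (x : 'I_d -> C) i : coord i (\sum_j x j *: e j) = x i.
Proof.
rewrite /Defs.coord ip_sumr (bigD1 i) //= ipZr ip_onb eqxx mulr1.
by rewrite big1 ?addr0 // => j ji; rewrite ipZr ip_onb eq_sym (negPf ji) mulr0.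
Qed.

Lemma ip_coord u v : ip form u v = \sum_i Num.conj (coord i u) * coord i v.
Proof.
rewrite {1}(onb_expand u) ip_suml; apply: eq_bigr => i _.
by rewrite ipZl.
Qed.

Definition antilinear (A : V -> V) : Prop :=
  forall (a : C) u v, A (a *: u + v) = Num.conj a *: A u + A v.

Section Antilinear.
Variables (A : V -> V) (lA : antilinear A).

Lemma antilinear0 : A 0 = 0.
Proof.
have := lA (-1) 0 0; rewrite scaler0 addr0 rmorphN1 scaleN1r => E.
by rewrite {1}E addNr.
Qed.

Lemma antilinearZ (a : C) v : A (a *: v) = Num.conj a *: A v.
Proof. by have := lA a v 0; rewrite antilinear0 !addr0. Qed.

Lemma antilinearD u v : A (u + v) = A u + A v.
Proof. by have := lA 1 u v; rewrite rmorph1 !scale1r. Qed.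

Lemma antilinear_sum (I : Type) (r : seq I) (P : pred I) (F : I -> V) :
  A (\sum_(i <- r | P i) F i) = \sum_(i <- r | P i) A (F i).
Proof.
elim/big_rec2: _ => [|i u v _ <-]; first exact: antilinear0.
exact: antilinearD.
Qed.

Lemma antilinear_expand v : A v = \sum_i Num.conj (coord i v) *: A (e i).
Proof.
rewrite {1}(onb_expand v) antilinear_sum; apply: eq_bigr => i _.
exact: antilinearZ.
Qed.

Lemma ip_antiadjoint v w : ip form v (antiadjoint form A w) = ip form w (A v).
Proof.
rewrite /antiadjoint ip_sumr [in RHS]antilinear_expand ip_sumr.
by apply: eq_bigr => i _; rewrite !ipZr mulrC -ip_conj.
Qed.

Lemma antiadjoint_antilinear : antilinear (antiadjoint form A).
Proof.
move=> a u v; apply: coordP => i.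
by rewrite /Defs.coord ip_linear !ip_antiadjoint ipDl ipZl.
Qed.

Lemma antiadjoint_involutive :
  involutive A -> involutive (antiadjoint form A).
Proof.
move=> iA v; apply: coordP => i; rewrite /Defs.coord ip_antiadjoint.
by rewrite ip_conj ip_antiadjoint iA -ip_conj.
Qed.

End Antilinear.
End OrthonormalBasis.

(** * The twist acting on neighbouring tensor factors *)

Section TensorOps.
Variables (R : realType) (V : vectType (Cx R)).
Local Notation C := (Cx R).
Local Notation tens := (tens V).
Local Notation word := (word V).

Definition linop (A : tens -> tens) : Prop := forall (a : C) f g,
  A (fun w => a * f w + g w) = (fun w => a * A f w + A g w).

Lemma linop0 A : linop A -> A (fun=> 0) = (fun=> 0).
Proof.
move=> /(_ (-1) (fun=> 0) (fun=> 0)); rewrite mulr0 addr0 => ->.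
by apply: funext => w; rewrite mulN1r addNr.
Qed.

Lemma linopZ A a f : linop A -> A (fun w => a * f w) = (fun w => a * A f w).
Proof.
move=> lA; have := lA a f (fun=> 0); rewrite linop0 // => E.
have -> : (fun w => a * f w) = (fun w => a * f w + 0).
  by apply: funext => w; rewrite addr0.
by rewrite E; apply: funext => w; rewrite addr0.
Qed.

Lemma linopD A f g : linop A ->
  A (fun w => f w + g w) = (fun w => A f w + A g w).
Proof.
move=> lA; have := lA 1 f g.
have -> : (fun w => 1 * f w + g w) = (fun w => f w + g w).
  by apply: funext => w; rewrite mul1r.
by move=> ->; apply: funext => w; rewrite mul1r.
Qed.

Lemma linop_sum A (I : Type) (r : seq I) (P : pred I) (F : I -> tens) :
  linop A ->
  A (fun w => \sum_(i <- r | P i) F i w) = (fun w => \sum_(i <- r | P i) A (F i) w).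
Proof.
move=> lA; elim: r => [|i r IH].
  have -> : (fun w => \sum_(i <- [::] | P i) F i w) = (fun=> 0).
    by apply: funext => w; rewrite big_nil.
  by rewrite linop0 //; apply: funext => w; rewrite big_nil.
have -> : (fun w => \sum_(j <- i :: r | P j) F j w) =
   if P i then (fun w => F i w + \sum_(j <- r | P j) F j w)
   else (fun w => \sum_(j <- r | P j) F j w).
  by case: ifP => Pi; apply: funext => w; rewrite big_cons Pi.
case: ifP => Pi.
  by rewrite linopD // IH; apply: funext => w; rewrite big_cons Pi.
by rewrite IH; apply: funext => w; rewrite big_cons Pi.
Qed.

Lemma linop_comp A B : linop A -> linop B -> linop (A \o B).
Proof. by move=> lA lB a f g /=; rewrite lB lA. Qed.

Lemma linop_bigsum (I : Type) (r : seq I) (P : pred I) (F : I -> tens -> tens) :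
  (forall i, linop (F i)) -> linop (fun f w => \sum_(i <- r | P i) F i f w).
Proof.
move=> lF a f g; apply: funext => w.
rewrite mulr_sumr -big_split /=; apply: eq_bigr => i _.
by rewrite lF.
Qed.

Lemma linop_id_otimes A : linop A -> linop (id_otimes A).
Proof.
move=> lA a f g; apply: funext => -[|x v] /=; first by rewrite mulr0 addr0.
by rewrite lA.
Qed.

Definition homog (n : nat) (f : tens) := forall w : word, size w != n -> f w = 0.

Variable T : square_op V.
Local Notation opT := (opT T).

Lemma linop_opT k : linop (opT k).
Proof.
move=> a f g; apply: funext => w; rewrite /Defs.opT.
case: (drop k w) => [|x [|y v]]; rewrite ?mulr0 ?addr0 //.
rewrite mulr_sumr -big_split /=; apply: eq_bigr => p _.
by rewrite mulrDr mulrCA.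
Qed.

Definition opTs (s : seq nat) (f : tens) : tens := foldr opT f s.

Lemma opTs_cat s1 s2 f : opTs (s1 ++ s2) f = opTs s1 (opTs s2 f).
Proof. exact: foldr_cat. Qed.

Lemma linop_opTs s : linop (opTs s).
Proof.
elim: s => [|k s IH] a f g //=.
by rewrite /opTs /= -![foldr _ _ s]/(opTs s _) IH linop_opT.
Qed.

Lemma opT_short k f (w : word) : (size w < k.+2)%N -> opT k f w = 0.
Proof.
move=> sw; rewrite /Defs.opT.
by have := size_drop k w; case: (drop k w) => [|x [|y v]] //= E; exfalso; lia.
Qed.

Lemma opT_head u k f (w : word) :
  opT (size u + k) f (u ++ w) = opT k (fun v => f (u ++ v)) w.
Proof.
rewrite /Defs.opT drop_cat.
rewrite ltnNge leq_addr /= addKn; case: (drop k w) => [|x [|y v]] //.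
apply: eq_bigr => p _; congr (_ * f _).
by rewrite take_cat ltnNge leq_addr /= addKn catA.
Qed.

Lemma opT_cons k f i (w : word) :
  opT k.+1 f (i :: w) = opT k (fun v => f (i :: v)) w.
Proof. exact: (opT_head [:: i]). Qed.

Lemma opT_tail k f (u v : word) : (k.+2 <= size u)%N ->
  opT k f (u ++ v) = opT k (fun w => f (w ++ v)) u.
Proof.
move=> su; rewrite /Defs.opT drop_cat.
have -> : (k < size u)%N by lia.
have := size_drop k u; case: (drop k u) => [|x [|y v']] /= E; try by exfalso; lia.
apply: eq_bigr => p _; congr (_ * f _).
rewrite take_cat; have -> : (k < size u)%N by lia.
by rewrite -catA.
Qed.

Lemma opT_rcons k f i (w : word) : (k.+2 <= size w)%N ->
  opT k f (rcons w i) = opT k (fun v => f (rcons v i)) w.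
Proof.
move=> sw; rewrite -cats1 opT_tail //; congr opT; apply: funext => v.
by rewrite cats1.
Qed.

Lemma opT_homog n k f : homog n f -> homog n (opT k f).
Proof.
move=> hf w sw; rewrite /Defs.opT; have := cat_take_drop k w.
case: (drop k w) => [|x [|y v]] // E.
rewrite big1 // => p _; rewrite hf ?mulr0 //.
by move: sw; rewrite -[in size w]E !size_cat.
Qed.

Lemma opTs_homog n s f : homog n f -> homog n (opTs s f).
Proof. by elim: s => //= k s IH hf; apply: opT_homog; apply: IH. Qed.

Lemma opT_ext k f g (w : word) :
  (forall w' : word, size w' = size w -> f w' = g w') -> opT k f w = opT k g w.
Proof.
move=> fg; rewrite /Defs.opT; have := cat_take_drop k w.
case: (drop k w) => [|x [|y v]] // E; apply: eq_bigr => p _.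
by rewrite fg // -[in RHS]E !size_cat.
Qed.

Lemma opT_comm i j f : (i.+2 <= j)%N -> opT i (opT j f) = opT j (opT i f).
Proof.
move=> ij; apply: funext => w.
have [sw|sw] := ltnP (size w) j.+2.
  rewrite (opT_short _ sw) (@opT_ext _ _ (fun=> 0)).
    by rewrite (linop0 (linop_opT i)).
  by move=> w' sw'; rewrite opT_short ?sw'.
rewrite -(cat_take_drop i.+2 w).
set u := take _ _; set v := drop _ _.
have su : size u = i.+2 by rewrite size_take; case: ltnP => //; lia.
rewrite (opT_tail _ _ (u := u)) ?su //.
have [k jE] : exists k, j = (i.+2 + k)%N by exists (j - i.+2)%N; lia.
have -> : j = (size u + k)%N by lia.
rewrite opT_head.
rewrite (@opT_ext i _ (fun u' => opT k (fun v' => f (u' ++ v')) v)); last first.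
  by move=> w' sw'; rewrite -opT_head sw'.
rewrite (@opT_ext k _ (fun v' => opT i (fun u' => f (u' ++ v')) u)); last first.
  by move=> w' _; rewrite opT_tail ?su.
rewrite {2 3}/Defs.opT; case: (drop k v) => [|x [|y v']].
- by rewrite (linop0 (linop_opT i)).
- by rewrite (linop0 (linop_opT i)).
rewrite (linop_sum _ _ _ (linop_opT i)); apply: eq_bigr => p _.
by rewrite (linopZ _ _ (linop_opT i)).
Qed.

Lemma opT_braid k f : braided T ->
  opT k (opT k.+1 (opT k f)) = opT k.+1 (opT k (opT k.+1 f)).
Proof.
move=> br; apply: funext => w.
have [sw|sw] := ltnP (size w) k.+3.
  rewrite (opT_short _ sw) (@opT_ext _ _ (fun=> 0)).
    by rewrite (linop0 (linop_opT k)).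
  by move=> w' sw'; rewrite opT_short ?sw'.
rewrite -(cat_take_drop k.+3 w); set u := take _ _; set v := drop _ _.
have su : size u = k.+3 by rewrite size_take; case: ltnP => //; lia.
have tl j g : (j.+2 <= k.+3)%N -> (fun u' : word => if size u' == k.+3 then
    opT j g (u' ++ v) else 0) = (fun u' => if size u' == k.+3 then
     opT j (fun u' => if size u' == k.+3 then g (u' ++ v) else 0) u' else 0).
  move=> jk; apply: funext => u'; case: eqP => // su'.
  rewrite opT_tail ?su' //; apply: opT_ext => w' ->.
  by rewrite su' eqxx.
have tl1 j g : (j.+2 <= k.+3)%N -> opT j g (u ++ v) =
     opT j (fun u' => if size u' == k.+3 then g (u' ++ v) else 0) u.
  by move=> jk; have /(congr1 (@^~ u)) := tl j g jk; rewrite su eqxx.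
have tl2 j h : homog k.+3 h -> (fun u' => if size u' == k.+3 then
     opT j h u' else 0) = opT j h.
  move=> hh; apply: funext => u'; case: ifP => // /negbT su'.
  by rewrite (opT_homog _ hh).
have hh g : homog k.+3 (fun u' => if size u' == k.+3 then g u' else 0).
  by move=> u' /negPf ->.
rewrite !tl1 //; rewrite !(tl, tl2) //; do ?[exact: opT_homog|exact: hh].
move: (fun u' => _) => h {v tl tl1 tl2 hh sw}.
rewrite -(cat_take_drop k u); set a := take _ _; set b := drop _ _.
have sa : size a = k by rewrite size_take su; case: ltnP => //; lia.
have sb : size b = 3 by rewrite size_drop su; lia.
have hd j g : opT (k + j) g (a ++ b) = opT j (fun v' => g (a ++ v')) b.
  by rewrite -{1}sa opT_head.
have hd' j g : (fun v' => opT (k + j) g (a ++ v')) =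
     opT j (fun v' => g (a ++ v')).
  by apply: funext => v'; rewrite -{1}sa opT_head.
have hd0 := hd 0%N; have hd0' := hd' 0%N; have hd1 := hd 1%N; have hd1' := hd' 1%N.
rewrite addn0 in hd0 hd0'; rewrite addn1 in hd1 hd1'.
by rewrite hd0 hd1 !(hd0', hd1') br.
Qed.

End TensorOps.

(** * Exchanging ascending and descending products of a braided twist *)

Section BraidAlgebra.
Variables (R : realType) (V : vectType (Cx R)).
Local Notation C := (Cx R).
Local Notation tens := (tens V).
Variable T : square_op V.
Local Notation opT := (opT T).
Local Notation opTs := (opTs T).
Implicit Types f : tens.

Lemma opT_opTs_comm i s f : all (fun j => (i.+2 <= j) || (j.+2 <= i))%N s ->
  opT i (opTs s f) = opTs s (opT i f).
Proof.
elim: s => //= j s IH /andP[ij sP].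
rewrite -IH //; case/orP: ij => ij; first exact: opT_comm.
by rewrite [RHS]opT_comm.
Qed.

Lemma opTs_comm s1 s2 f :
  all (fun i => all (fun j => (i.+2 <= j) || (j.+2 <= i))%N s2) s1 ->
  opTs s1 (opTs s2 f) = opTs s2 (opTs s1 f).
Proof.
elim: s1 => //= i s1 IH /andP[is2 /IH ->].
by rewrite opT_opTs_comm.
Qed.

Hypothesis br : braided T.

(** [T_m] is shifted by one when it passes through an ascending product: it
commutes with the factors up to [T_m T_(m+1)], where the braid relation
applies, and its successor commutes with the rest. *)
Lemma opTs_asc_braid a n m f : (a <= m)%N -> (m.+2 <= a + n)%N ->
  opTs (iota a n) (opT m f) = opT m.+1 (opTs (iota a n) f).
Proof.
elim: n a => [|n IH] a am mn; first by lia.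
have [ma|ma] := eqVneq m a; last first.
  rewrite [iota a n.+1]/= -![opTs (_ :: _) _]/(opT a (opTs (iota a.+1 n) _)).
  rewrite IH; [|lia|lia].
  by rewrite opT_comm //; lia.
subst m; case: n IH mn => [|n] IH mn; first by lia.
rewrite [iota a n.+2]/=.
rewrite -![opTs (_ :: _ :: _) _]/(opT a (opT a.+1 (opTs (iota a.+2 n) _))).
rewrite -opT_opTs_comm; last first.
  by apply/allP => j; rewrite mem_iota => /andP[? _]; apply/orP; left.
by rewrite opT_braid.
Qed.

Definition desc (j n : nat) : seq nat := rev (iota j (n - j)).

Lemma desc_cat j k n : (j <= k)%N -> (k <= n)%N ->
  desc j n = desc k n ++ desc j k.
Proof.
move=> jk kn; rewrite /desc -rev_cat; congr rev.
have -> : (n - j = (k - j) + (n - k))%N by lia.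
rewrite iotaD; congr (_ ++ iota _ _); lia.
Qed.

Lemma opTs_desc_asc j k f : (1 <= j)%N -> (j <= k)%N ->
  opTs (desc j k) (opTs (iota 0 k) f) =
  opTs (iota 0 k) (opTs (desc j.-1 k.-1) f).
Proof.
move=> j1 jk; rewrite /desc.
have -> : (k.-1 - j.-1 = k - j)%N by lia.
have [m mE] : exists m, m = (k - j)%N by exists (k - j)%N.
rewrite -mE; have jm : (j + m <= k)%N by lia.
clear mE; elim: m jm f => [|m IH] jm f //.
rewrite -addn1 !iotaD !rev_cat !opTs_cat /= IH; last by lia.
rewrite opTs_asc_braid; [|lia|lia].
by congr (opT _ _); lia.
Qed.

Lemma opTs_L_lt n j k f : (k < j)%N -> (j <= n)%N ->
  opTs (desc j n) (opTs (iota 0 k) f) = opTs (iota 0 k) (opTs (desc j n) f).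
Proof.
move=> kj jn; apply: opTs_comm; apply/allP => i.
rewrite mem_rev mem_iota => /andP[ji _]; apply/allP => l.
by rewrite mem_iota => /andP[_ lk]; apply/orP; right; lia.
Qed.

(** Where the two products overlap, the overlapping part of the descending one
passes through the ascending one with its indices lowered by one, and the
last factor of the ascending product joins the descending one. *)
Lemma opTs_L_ge n j k f : (1 <= j)%N -> (j <= k)%N -> (k <= n)%N ->
  opTs (desc j n) (opTs (iota 0 k) f) =
  opTs (iota 0 k.-1) (opTs (desc j.-1 n) f).
Proof.
move=> j1 jk kn; rewrite (desc_cat jk kn) opTs_cat opTs_desc_asc //.
have kE : k = (k.-1 + 1)%N by lia.
rewrite {2}kE iotaD opTs_cat opTs_L_lt //; last by rewrite ltn_predL; apply: leq_trans jk.
congr (opTs _ _); rewrite (@desc_cat j.-1 k.-1 n); [|lia|lia].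
rewrite (@desc_cat k.-1 k n); [|lia|lia].
rewrite !opTs_cat; congr (opTs _ _).
rewrite /desc; have -> : (k - k.-1 = 1)%N by lia.
by rewrite add0n.
Qed.

(** The mirror image [1 + T_(n-1) + T_(n-1) T_(n-2) + ...] of [RT]. *)
Definition RTr (n : nat) f : tens := fun w =>
  \sum_(j < n) opTs (desc j n.-1) f w.

(** The operator [1 (x) RTr n] in degree [n.+1]. *)
Definition RTr_shift (n : nat) f : tens := fun w =>
  \sum_(j < n) opTs (desc j.+1 n) f w.

Lemma RT_opTs n f : RT T n f = fun w => \sum_(k < n) opTs (iota 0 k) f w.
Proof.
by apply: funext => w; apply: eq_bigr => k _; rewrite /opTseg subn0.
Qed.

Lemma linop_RT n : linop (RT T n).
Proof.
apply: (@linop_bigsum _ _ _ _ _ (fun (k : 'I_n) => opTseg T 0 k)) => k.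
exact: linop_opTs.
Qed.

Lemma linop_RTr n : linop (RTr n).
Proof.
apply: (@linop_bigsum _ _ _ _ _ (fun (k : 'I_n) => opTs (desc k n.-1))) => k.
exact: linop_opTs.
Qed.

(** The index pairs of the two double sums correspond by [(j, k) -> (k, j)] for
[k < j] and by [(j, k) -> (k - 1, j - 1)] for [j <= k]. *)
Lemma braid_double_sum (n : nat) (L M : nat -> nat -> C) :
  (forall j k, k < j -> j <= n -> L j k = M k j)%N ->
  (forall j k, 1 <= j -> j <= k -> k <= n -> L j k = M k.-1 j.-1)%N ->
  \sum_(j < n) \sum_(k < n.+1) L j.+1 k = \sum_(k < n) \sum_(j < n.+1) M k j.
Proof.
move=> Llt Lge.
transitivity (\sum_(j < n) (\sum_(k < n | (k <= j)%N) M k j.+1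
                          + \sum_(k < n | (j <= k)%N) M k j)).
  apply: eq_bigr => j _; rewrite (bigID (fun k : 'I_n.+1 => (k <= j)%N)) /=.
  congr (_ + _).
    rewrite big_mkcond big_ord_recr /= leqNgt ltn_ord /= addr0 -big_mkcond /=.
    by apply: eq_bigr => k kj; rewrite Llt //= ltn_ord.
  rewrite big_mkcond big_ord_recl /= add0r -big_mkcond /=.
  apply: eq_big => [k|k kj]; first by rewrite /bump /= -ltnNge; lia.
  by rewrite Lge // /bump /= add1n //; move: kj; rewrite /bump /= add1n -ltnNge.
rewrite big_split /= addrC.
transitivity (\sum_(k < n) (\sum_(j < n | (j <= k)%N) M k j
                          + \sum_(j < n | (k <= j)%N) M k j.+1)).
  rewrite big_split /=; congr (_ + _).
    under eq_bigr do rewrite big_mkcond.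
    rewrite exchange_big; apply: eq_bigr => k _.
    by rewrite [RHS]big_mkcond.
  under eq_bigr do rewrite big_mkcond.
  rewrite exchange_big; apply: eq_bigr => k _.
  by rewrite [RHS]big_mkcond.
apply: eq_bigr => k _; rewrite [RHS](bigID (fun j : 'I_n.+1 => (j <= k)%N)) /=.
congr (_ + _).
  rewrite [RHS]big_mkcond big_ord_recr /= leqNgt ltn_ord /= addr0.
  by rewrite -big_mkcond.
rewrite [RHS]big_mkcond big_ord_recl /= add0r -big_mkcond /=.
by apply: eq_bigl => j; rewrite /bump /= -ltnNge; lia.
Qed.

(** This identity lets the kernel of the twisted inner product be factored from
either side. It holds term by term: a descending followed by an ascending
product of the [T_k] is also an ascending followed by a descending one. *)
Lemma RT_RTr_braid n f :
  RTr_shift n (RT T n.+1 f) = RT T n (RTr n.+1 f).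
Proof.
apply: funext => w; rewrite !RT_opTs /RTr_shift /RTr.
transitivity (\sum_(j < n) \sum_(k < n.+1) opTs (desc j.+1 n) (opTs (iota 0 k) f) w).
  by apply: eq_bigr => j _; rewrite (linop_sum _ _ _ (linop_opTs _ _)).
rewrite (@braid_double_sum n (fun j k => opTs (desc j n) (opTs (iota 0 k) f) w)
     (fun k j => opTs (iota 0 k) (opTs (desc j n) f) w)).
- by apply: eq_bigr => k _; rewrite (linop_sum _ _ _ (linop_opTs _ _)).
- by move=> j k kj jn; rewrite opTs_L_lt.
- by move=> j k j1 jk kn; rewrite opTs_L_ge.
Qed.

End BraidAlgebra.

(** * Semidefinite forms on tensors *)

Notation "r %:K" := ((r%:C)%C : Cx _) (at level 2, format "r %:K").

Section ComplexParts.
Variable R : realType.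
Local Notation C := (Cx R).
Implicit Types x y z : C.
Local Notation Re := (@complex.Re R).
Local Notation Im := (@complex.Im R).

Lemma cxReD x y : Re (x + y) = Re x + Re y. Proof. by case: x; case: y. Qed.
Lemma cxImD x y : Im (x + y) = Im x + Im y. Proof. by case: x; case: y. Qed.
Lemma cxReN x : Re (- x) = - Re x. Proof. by case: x. Qed.
Lemma cxImN x : Im (- x) = - Im x. Proof. by case: x. Qed.
Lemma cxRe_sum (I : Type) (r : seq I) (P : pred I) (F : I -> C) :
  Re (\sum_(i <- r | P i) F i) = \sum_(i <- r | P i) Re (F i).
Proof. by elim/big_rec2: _ => // i y z _ <-; rewrite cxReD. Qed.
Lemma cxReZ (r : R) z : Re (r%:K * z) = r * Re z.
Proof. by case: z => a b /=; rewrite mul0r subr0. Qed.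
Lemma cxRe_conj z : Re (Num.conj z) = Re z. Proof. by case: z. Qed.
Lemma cxIm_conj z : Im (Num.conj z) = - Im z. Proof. by case: z. Qed.
Lemma cxeq x y : Re x = Re y -> Im x = Im y -> x = y.
Proof. by case: x => a b; case: y => a' b' /= -> ->. Qed.
Lemma cxge0 z : 0 <= z -> z = (Re z)%:K /\ 0 <= Re z.
Proof.
by rewrite lecE /= => /andP[/eqP z0 ->]; split => //; apply: cxeq => //=.
Qed.
Lemma cxgt0 z : 0 < z -> z = (Re z)%:K /\ 0 < Re z.
Proof.
by rewrite ltcE /= => /andP[/eqP z0 ->]; split => //; apply: cxeq => //=.
Qed.
Lemma cxReM x y : Re (x * y) = Re x * Re y - Im x * Im y.
Proof. by case: x; case: y. Qed.
Lemma cxImM x y : Im (x * y) = Re x * Im y + Im x * Re y.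
Proof. by case: x; case: y. Qed.
Lemma cxE z : z = (Re z +i* Im z)%C. Proof. by case: z. Qed.
Lemma cx_iE : ('i : C) = (0 +i* 1)%C.
Proof. by []. Qed.

Lemma cxconj_real (r : R) : Num.conj (r%:K) = r%:K.
Proof. by apply: cxeq; rewrite ?cxRe_conj ?cxIm_conj //= oppr0. Qed.
Lemma cx_sqnorm z : Num.conj z * z = (Re z ^+ 2 + Im z ^+ 2)%:K.
Proof.
case: z => a b; apply: cxeq; rewrite ?cxReM ?cxImM cxRe_conj cxIm_conj /=; ring.
Qed.

End ComplexParts.

Section WordSums.
Variables (R : realType) (V : vectType (Cx R)).
Local Notation C := (Cx R).
Local Notation d := (\dim {:V}).
Local Notation tens := (tens V).
Local Notation word := (word V).
Implicit Types f g h : tens.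

Definition wsum (n : nat) (F : word -> C) : C := \sum_(w : n.-tuple 'I_d) F w.

Lemma wsum0 F : wsum 0 F = F [::].
Proof.
rewrite /wsum (bigD1 [tuple]) //= big1 ?addr0 // => t /eqP[].
exact: tuple0.
Qed.

Lemma wsumS n F : wsum n.+1 F = \sum_(i < d) wsum n (fun w => F (i :: w)).
Proof.
rewrite /wsum pair_bigA /=.
rewrite (reindex (fun p : 'I_d * n.-tuple 'I_d => [tuple of p.1 :: p.2])) //=.
exists (fun t : n.+1.-tuple 'I_d => (thead t, [tuple of behead t])) => [[i t] _|t _].
  by rewrite theadE /=; congr (_, _); apply: val_inj.
by rewrite [RHS]tuple_eta.
Qed.

Lemma eq_wsum n F G : (forall w : word, size w = n -> F w = G w) ->
  wsum n F = wsum n G.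
Proof. by move=> FG; apply: eq_bigr => w _; rewrite FG // size_tuple. Qed.

Lemma wsum_cat a b F :
  wsum (a + b) F = wsum b (fun v => wsum a (fun u => F (u ++ v))).
Proof.
elim: a F => [|a IH] F.
  by apply: eq_wsum => w _; rewrite wsum0.
rewrite addSn wsumS (eq_bigr _ (fun i _ => IH _)) /wsum exchange_big.
apply: eq_bigr => v _.
by rewrite -[RHS]/(wsum a.+1 (fun u => F (u ++ v))) wsumS.
Qed.

Lemma wsumSr n F : wsum n.+1 F = \sum_(i < d) wsum n (fun w => F (rcons w i)).
Proof.
rewrite -addn1 wsum_cat wsumS; apply: eq_bigr => i _.
by rewrite wsum0; apply: eq_wsum => w _; rewrite cats1.
Qed.

Definition lslice (i : 'I_d) f : tens := fun w => f (i :: w).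
Definition rslice (i : 'I_d) f : tens := fun w => f (rcons w i).

Lemma tipE n f g : tip n f g = wsum n (fun w => Num.conj (f w) * g w).
Proof. by []. Qed.

Lemma eq_tip n f f' g g' : (forall w : word, size w = n -> f w = f' w) ->
  (forall w : word, size w = n -> g w = g' w) -> tip n f g = tip n f' g'.
Proof. by move=> ff' gg'; rewrite !tipE; apply: eq_wsum => w sw; rewrite ff' ?gg'. Qed.

Lemma tipS n f g :
  tip n.+1 f g = \sum_(i < d) tip n (lslice i f) (lslice i g).
Proof. by rewrite tipE wsumS. Qed.

Lemma tipSr n f g :
  tip n.+1 f g = \sum_(i < d) tip n (rslice i f) (rslice i g).
Proof. by rewrite tipE wsumSr. Qed.

Lemma tip_cat a b f g : tip (a + b) f g =
  wsum b (fun v => tip a (fun u => f (u ++ v)) (fun u => g (u ++ v))).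
Proof. by rewrite tipE wsum_cat. Qed.

(** Linear in the second variable, as [tip] is. *)
Record psd_form (B : tens -> tens -> C) : Prop := PsdForm {
  psd_lin : forall f (a : C) g h, B f (fun w => a * g w + h w) = a * B f g + B f h;
  psd_conj : forall f g, B g f = Num.conj (B f g);
  psd_ge0 : forall f, 0 <= B f f }.

Lemma tip_lin n f (a : C) g h :
  tip n f (fun w => a * g w + h w) = a * tip n f g + tip n f h.
Proof.
rewrite /tip mulr_sumr -big_split; apply: eq_bigr => w _ /=.
by rewrite mulrDr mulrCA.
Qed.

Lemma tip_conj n f g : tip n g f = Num.conj (tip n f g).
Proof.
rewrite /tip rmorph_sum; apply: eq_bigr => w _ /=.
by rewrite rmorphM /= conjCK mulrC.
Qed.

Lemma tip_ge0 n f : 0 <= tip n f f.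
Proof. by apply: sumr_ge0 => w _; rewrite mulrC mul_conjC_ge0. Qed.

Lemma tip_psd n : psd_form (tip n).
Proof. by split; [exact: tip_lin|exact: tip_conj|exact: tip_ge0]. Qed.

Section Psd.
Variable B : tens -> tens -> C.
Hypothesis HB : psd_form B.

Definition qf f : R := complex.Re (B f f).

Lemma qf_ge0 f : 0 <= qf f.
Proof. by have [] := cxge0 (psd_ge0 HB f). Qed.

Lemma psdDr f g h : B f (fun w => g w + h w) = B f g + B f h.
Proof.
have := psd_lin HB f 1 g h; rewrite [in RHS]mul1r => <-; congr (B f _).
by apply: funext => w; rewrite mul1r.
Qed.

Lemma psd0r f : B f (fun=> 0) = 0.
Proof.
have := psd_lin HB f (-1) (fun=> 0) (fun=> 0).
rewrite (_ : (fun w => _) = (fun=> 0)); last first.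
  by apply: funext => w; rewrite mulr0 addr0.
by rewrite mulN1r addNr.
Qed.

Lemma psdZr f a g : B f (fun w => a * g w) = a * B f g.
Proof.
have := psd_lin HB f a g (fun=> 0); rewrite psd0r addr0 => <-; congr (B f _).
by apply: funext => w; rewrite addr0.
Qed.

Lemma psdZl f a g : B (fun w => a * f w) g = Num.conj a * B f g.
Proof. by rewrite (psd_conj HB) psdZr rmorphM /= -(psd_conj HB). Qed.

Lemma psdDl f g h : B (fun w => g w + h w) f = B g f + B h f.
Proof. by rewrite (psd_conj HB) psdDr rmorphD /= -!(psd_conj HB). Qed.

Lemma qfD f g : qf (fun w => f w + g w) = qf f + 2 * complex.Re (B f g) + qf g.
Proof.
rewrite /qf psdDr !psdDl !cxReD (psd_conj HB f g) cxRe_conj; ring.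
Qed.

Lemma qfZ a f : qf (fun w => a * f w) =
  (complex.Re a ^+ 2 + complex.Im a ^+ 2) * qf f.
Proof. by rewrite /qf psdZr psdZl mulrCA mulrA cx_sqnorm cxReZ. Qed.

Lemma psd_CS f g : complex.Re (B f g) ^+ 2 <= qf f * qf g.
Proof.
have H (t : R) : 0 <= qf f + 2 * t * complex.Re (B f g) + t ^+ 2 * qf g.
  have := qf_ge0 (fun w => f w + t%:K * g w).
  by rewrite qfD psdZr cxReZ qfZ /= expr0n addr0 mulrA.
move: (qf_ge0 f) (qf_ge0 g) H; set a := qf f; set c := qf g.
set b := complex.Re _ => a0 c0 H.
have [c00|cn0] := eqVneq c 0.
  have [b0|b0] := eqVneq b 0; first by rewrite b0 c00 expr0n mulr0.
  have := H (- (a + 1) / (2 * b)); rewrite c00.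
  have -> : a + 2 * (- (a + 1) / (2 * b)) * b + (- (a + 1) / (2 * b)) ^+ 2 * 0 = -1.
    by field; lra.
  lra.
have c1 : 0 < c by rewrite lt_def cn0.
have := H (- b / c).
have -> : a + 2 * (- b / c) * b + (- b / c) ^+ 2 * c = (a * c - b ^+ 2) / c.
  by field.
by rewrite pmulr_lge0 ?invr_gt0 // subr_ge0.
Qed.

Definition fn f : R := Num.sqrt (qf f).

Lemma fn_ge0 f : 0 <= fn f. Proof. exact: sqrtr_ge0. Qed.

Lemma sqr_fn f : fn f ^+ 2 = qf f. Proof. by rewrite sqr_sqrtr // qf_ge0. Qed.

Lemma Re_le_fn f g : complex.Re (B f g) <= fn f * fn g.
Proof.
apply: le_trans (ler_norm _) _.
rewrite -[X in X <= _]ger0_norm // -ler_sqr ?nnegrE ?mulr_ge0 ?fn_ge0 //.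
by rewrite exprMn !sqr_fn normr_id real_normK ?num_real // psd_CS.
Qed.

Lemma fnD f g : fn (fun w => f w + g w) <= fn f + fn g.
Proof.
rewrite -ler_sqr ?nnegrE ?addr_ge0 ?fn_ge0 // sqr_fn qfD sqrrD !sqr_fn.
by rewrite lerD2r lerD2l; have := Re_le_fn f g; lra.
Qed.

Lemma fnZ a f : fn (fun w => a * f w) =
  Num.sqrt (complex.Re a ^+ 2 + complex.Im a ^+ 2) * fn f.
Proof. by rewrite /fn qfZ sqrtrM // addr_ge0 ?sqr_ge0. Qed.

Lemma fn_sum (I : Type) (r : seq I) (P : pred I) (F : I -> tens) :
  fn (fun w => \sum_(i <- r | P i) F i w) <= \sum_(i <- r | P i) fn (F i).
Proof.
elim: r => [|i r IH].
  rewrite big_nil /fn /qf (_ : (fun w => _) = (fun=> 0)).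
    by rewrite psd0r sqrtr0.
  by apply: funext => w; rewrite big_nil.
rewrite big_cons (_ : (fun w => _) = (fun w => (if P i then F i w else 0)
    + \sum_(i <- r | P i) F i w)); last first.
  by apply: funext => w; rewrite big_cons; case: ifP; rewrite ?add0r.
case: ifP => Pi.
  by apply: le_trans (fnD _ _) _; rewrite lerD2l.
by rewrite (_ : (fun w => _) = (fun w => \sum_(i <- r | P i) F i w)) //;
  apply: funext => w; rewrite add0r.
Qed.

(** Lax's argument: an operator that is symmetric for [B] and bounded by [c] for
some other norm, here in the form that its orbits grow at most like [c ^+ m],
is bounded by [c] for [B].  Indeed [v m := B (A^m f) (A^m f)] satisfies
[v m ^+ 2 <= v 0 * v (2 m)], so [v 1 > c ^+ 2 * v 0] would force doubly
exponential growth of [v (2 ^ k)] beyond [c ^+ 2 ^ k.+1]. *)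
Lemma lax_bound (A : tens -> tens) (c K : R) f : 0 < c ->
  (forall g h, B (A g) h = B g (A h)) ->
  (forall m, qf (iter m A f) <= K * c ^+ (2 * m)) ->
  complex.Re (B f (A f)) <= c * qf f.
Proof.
move=> c0 sym bnd; pose v m := qf (iter m A f).
have v0 m : 0 <= v m := qf_ge0 _.
have step m : v m ^+ 2 <= v 0%N * v (2 * m)%N.
  have symm k g h : B (iter k A g) h = B g (iter k A h).
    by elim: k g h => // k IH g h; rewrite iterS sym IH -iterSr.
  have := psd_CS f (iter (2 * m) A f).
  by rewrite [in X in X <= _]mul2n -addnn iterD -symm.
have [f0|f0] := eqVneq (v 0%N) 0.
  have := psd_CS f (A f); rewrite -/(v 0%N) f0 mul0r.
  have := sqr_ge0 (complex.Re (B f (A f))) => h1 h2.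
  have /eqP : complex.Re (B f (A f)) ^+ 2 = 0 by apply/eqP; rewrite eq_le h1 h2.
  by rewrite sqrf_eq0 => /eqP ->; rewrite mulr_ge0 ?qf_ge0 // ltW.
have v0p : 0 < v 0%N by rewrite lt_def f0 v0.
suff v1 : v 1%N <= c ^+ 2 * v 0%N.
  have h : complex.Re (B f (A f)) ^+ 2 <= (c * v 0%N) ^+ 2.
    apply: le_trans (psd_CS f (A f)) _; rewrite -/(v 0%N) exprMn expr2.
    by rewrite [X in _ <= X]mulrA mulrC ler_wpM2r.
  apply: le_trans (ler_norm _) _.
  rewrite -ler_sqr ?nnegrE ?mulr_ge0 ?qf_ge0 ?(ltW c0) // real_normK ?num_real //.
pose x := v 1%N / (c ^+ 2 * v 0%N).
rewrite leNgt; apply/negP => lt1.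
have x1 : 1 < x by rewrite ltr_pdivlMr ?mul1r // mulr_gt0 ?exprn_gt0.
have xk k : x ^+ (2 ^ k) <= v (2 ^ k)%N / (c ^+ (2 * 2 ^ k) * v 0%N).
  elim: k => [|k IH]; first by rewrite expr1 expn0 muln1.
  set N := (2 ^ k)%N in IH *.
  have -> : (2 ^ k.+1 = 2 * N)%N by rewrite expnS.
  have cN : c ^+ (2 * (2 * N)) = (c ^+ (2 * N)) ^+ 2.
    by rewrite -exprM; congr (_ ^+ _); lia.
  have xN : x ^+ (2 * N) = (x ^+ N) ^+ 2 by rewrite -exprM mulnC.
  have y0 : 0 < c ^+ (2 * N) by rewrite exprn_gt0.
  rewrite cN xN; move: (c ^+ (2 * N)) y0 IH {cN xN} => y y0 IH.
  have x0 : 0 <= x by apply: ltW; apply: lt_trans x1.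
  apply: (@le_trans _ _ ((v N / (y * v 0%N)) ^+ 2)).
    by rewrite ler_sqr ?nnegrE ?exprn_ge0 ?divr_ge0 ?mulr_ge0 ?v0 ?(ltW y0) // ltW.
  rewrite expr_div_n ler_pdivrMr ?exprn_gt0 ?mulr_gt0 //.
  have -> : v (2 * N)%N / (y ^+ 2 * v 0%N) * (y * v 0%N) ^+ 2 =
    v 0%N * v (2 * N)%N by field; rewrite !lt0r_neq0.
  exact: step.
have K1 k : x ^+ (2 ^ k) <= K / v 0%N.
  apply: le_trans (xk k) _.
  rewrite invfM mulrA ler_pM2r ?invr_gt0 // ler_pdivrMr ?exprn_gt0 //.
  exact: bnd.
have bern k : (x - 1) *+ k <= x ^+ k.
  elim: k => [|k IH]; first by rewrite mulr0n expr0.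
  have h : 1 <= x ^+ k by apply: exprn_ege1; apply: ltW.
  rewrite mulrS exprS.
  have : 0 <= (x - 1) * (x ^+ k - 1) by rewrite mulr_ge0 ?subr_ge0 // ltW.
  move: IH; set y := x ^+ k; rewrite mulrBl mulrBr mul1r mulr1; lra.
have [m mP] : exists m : nat, K / v 0%N / (x - 1) < m%:R.
  exists (Num.bound `|K / v 0%N / (x - 1)|).
  exact: le_lt_trans (ler_norm _) (archi_boundP (normr_ge0 _)).
have : (x - 1) *+ (2 ^ m) <= K / v 0%N := le_trans (bern _) (K1 m).
rewrite ltr_pdivrMr ?subr_gt0 // in mP.
apply/negP; rewrite -ltNge; apply: lt_le_trans mP _.
rewrite mulr_natl ler_wpMn2l ?subr_ge0 ?(ltW x1) //.
exact: ltnW (ltn_expl _ _).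
Qed.

End Psd.
End WordSums.

(** * Norm bounds for the twist *)

Section TwistForms.
Variables (R : realType) (V : vectType (Cx R)).
Local Notation C := (Cx R).
Local Notation d := (\dim {:V}).
Local Notation tens := (tens V).
Local Notation word := (word V).
Variable T : square_op V.
Local Notation opT := (opT T).
Local Notation opTs := (opTs T).
Implicit Types f g h : tens.

Lemma fn_le_qf (B B' : tens -> tens -> C) (c : R) f g :
  psd_form B -> psd_form B' -> 0 <= c ->
  (fn B f <= c * fn B' g) = (qf B f <= c ^+ 2 * qf B' g).
Proof.
move=> HB HB' c0; rewrite -ler_sqr ?nnegrE ?mulr_ge0 ?fn_ge0 //.
by rewrite exprMn !sqr_fn.
Qed.

Lemma lslice_opT k f i : lslice i (opT k.+1 f) = opT k (lslice i f).
Proof. by apply: funext => w; rewrite /lslice opT_cons. Qed.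

Lemma tip_short n k f g : (n < k.+2)%N -> tip n f (opT k g) = 0.
Proof.
move=> nk; rewrite tipE /wsum big1 // => w _.
by rewrite opT_short ?mulr0 // size_tuple.
Qed.

(** In finite dimension the unit ball of degree 2 has a bounded image, so that
the supremum defining [square_op_norm] bounds [T]. *)
Lemma square_op_norm_ge0_bound :
  0 <= square_op_norm T /\
  forall f, tnorm 2 (opT 0 f) <= square_op_norm T * tnorm 2 f.
Proof.
pose E := [set x | exists2 f : tens, tnorm 2 f <= 1 & x = tnorm 2 (opT 0 f)].
have H := tip_psd V 2.
have tn0 : tnorm 2 ((fun=> 0) : tens) = 0 :> R.
  by rewrite /tnorm (psd0r H) sqrtr0.
have E0 : E 0.
  exists (fun=> 0); first by rewrite tn0.
  by rewrite (linop0 (linop_opT T 0)) tn0.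
have ub : has_ubound E.
  pose e (p : 'I_d * 'I_d) : tens := fun w =>
     if w is [:: x; y] then T (x, y) p else 0.
  exists (\sum_p tnorm 2 (e p)) => _ [f f1 ->].
  rewrite /tnorm -/(qf (tip 2) _) -/(fn (tip 2) _).
  have -> : fn (tip 2) (opT 0 f) =
     fn (tip 2) (fun w => \sum_p f [:: p.1; p.2] * e p w).
    rewrite /fn /qf; congr (Num.sqrt (complex.Re _)); apply: eq_tip => w sw;
      (case: w sw => [|x [|y [|? ?]]] // _;
       by rewrite /Defs.opT /=; apply: eq_bigr => p _; rewrite mulrC).
  apply: le_trans (fn_sum H _ _ _) _; apply: ler_sum => p _.
  rewrite (fnZ H) -[X in _ <= X]mul1r ler_wpM2r ?fn_ge0 //.
  rewrite -sqrtr1 ler_wsqrtr //.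
  have f1' : qf (tip 2) f <= 1.
    rewrite -(sqr_fn H); have : 0 <= fn (tip 2) f := fn_ge0 _ _.
    move: f1; rewrite /tnorm -/(qf (tip 2) _) -/(fn (tip 2) _) => f1 f0.
    by rewrite expr_le1.
  apply: le_trans f1'; rewrite /qf tipE /wsum.
  pose t := [tuple p.1; p.2].
  rewrite (bigD1 t) //= cxReD cx_sqnorm /= lerDl cxRe_sum sumr_ge0 // => w _.
  by rewrite cx_sqnorm /= addr_ge0 ?sqr_ge0.
have sE : square_op_norm T = sup E by [].
have q0 : 0 <= square_op_norm T by rewrite sE; apply: ub_le_sup.
split=> // f; rewrite sE.
have [f0|f0] := eqVneq (tnorm 2 f) 0.
  have qf0 : qf (tip 2) f = 0 by rewrite -(sqr_fn H) [fn _ _]f0 expr0n.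
  have f00 : forall w : word, size w = 2 -> f w = 0.
    move=> w sw; apply/eqP; rewrite -normr_eq0 -sqrf_eq0 normCKC.
    rewrite cx_sqnorm; apply/eqP; congr (_%:C)%C.
    have sw' : size w == 2 by apply/eqP.
    move: qf0; rewrite /qf tipE /wsum (bigD1 (Tuple sw')) //= cxReD cx_sqnorm /=.
    move/eqP; rewrite paddr_eq0 ?addr_ge0 ?sqr_ge0 //; first by case/andP => /eqP.
    by rewrite cxRe_sum sumr_ge0 // => u _; rewrite cx_sqnorm /= addr_ge0 ?sqr_ge0.
  rewrite f0 mulr0 -tn0 le_eqVlt; apply/orP; left; apply/eqP.
  rewrite /tnorm; congr (Num.sqrt (complex.Re _)); apply: eq_tip => w sw;
   (rewrite (@opT_ext _ _ _ _ _ (fun=> 0)) ?(linop0 (linop_opT T 0)) // => w' sw';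
    by rewrite f00 ?sw').
have fp : 0 < tnorm 2 f by rewrite lt_def f0 sqrtr_ge0.
rewrite -ler_pdivrMr // mulrC.
apply: ub_le_sup => //; exists (fun w => (tnorm 2 f)^-1%:K * f w).
  rewrite /tnorm -/(qf (tip 2) _) -/(fn (tip 2) _) (fnZ H) /=.
  rewrite expr0n addr0 sqrtr_sqr ger0_norm ?invr_ge0 ?sqrtr_ge0 // mulVf //.
rewrite (linopZ _ _ (linop_opT T 0)).
rewrite [RHS](fnZ H) /= expr0n addr0 sqrtr_sqr ger0_norm ?invr_ge0 ?sqrtr_ge0 //.
Qed.

Local Notation q := (square_op_norm T).

(** The tensor factors that [T] does not touch are sliced off; on the remaining
two the bound is the definition of the norm. *)
Lemma opT_bound n k f :
  fn (tip n) (opT k f) <= q * fn (tip n) f.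
Proof.
have [q0 qb] := square_op_norm_ge0_bound.
suff H : qf (tip n) (opT k f) <= q ^+ 2 * qf (tip n) f.
  by rewrite fn_le_qf //; exact: tip_psd.
have z n' k' f' : (n' < k'.+2)%N ->
    qf (tip n') (opT k' f') <= q ^+ 2 * qf (tip n') f'.
  move=> nk; rewrite {1}/qf tip_short // mulr_ge0 ?sqr_ge0 //.
  exact: (qf_ge0 (tip_psd V n')).
elim: k n f => [|k IH] n f; last first.
  case: n => [|n]; first exact: z.
  rewrite /qf !tipS !cxRe_sum mulr_sumr; apply: ler_sum => i _.
  by rewrite lslice_opT; apply: IH.
case: n => [|[|m]]; [exact: z|exact: z|].
rewrite -[m.+2]/(2 + m)%N /qf !tip_cat /wsum !cxRe_sum mulr_sumr.
apply: ler_sum => v _.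
rewrite (@eq_tip _ _ 2 _ (opT 0 (fun u => f (u ++ v))) _ (opT 0 (fun u => f (u ++ v))));
  try by move=> u su; rewrite opT_tail // su.
have := qb (fun u => f (u ++ v)).
set h := fun u => _; rewrite -[tnorm 2 (opT 0 h)]/(fn (tip 2) (opT 0 h)).
by rewrite -[tnorm 2 h]/(fn (tip 2) h) fn_le_qf //; exact: tip_psd.
Qed.

Lemma opTs_bound n s f :
  fn (tip n) (opTs s f) <= q ^+ (size s) * fn (tip n) f.
Proof.
have [q0 qb] := square_op_norm_ge0_bound.
elim: s => [|k s IH] /=; first by rewrite expr0 mul1r.
apply: le_trans (opT_bound _ _ _) _.
by rewrite exprS -mulrA ler_wpM2l.
Qed.

Hypothesis q1 : q < 1.

(** The sum of the geometric series that bounds the products [T_1 ... T_k] in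
[RT]. *)
Definition rT : R := (1 - q)^-1.

Lemma rT_ge1 : 1 <= rT.
Proof.
have [q0 _] := square_op_norm_ge0_bound.
by rewrite /rT invf_ge1 ?subr_gt0 // gerBl.
Qed.

Lemma rT_gt0 : 0 < rT.
Proof. by apply: lt_le_trans rT_ge1. Qed.

Lemma geom_le n : \sum_(k < n) q ^+ k <= rT.
Proof.
have [q0 _] := square_op_norm_ge0_bound.
rewrite /rT -[X in _ <= X]div1r ler_pdivlMr ?subr_gt0 // mulrC -[1 - q]opprB.
rewrite mulNr -subrX1 opprB.
by rewrite gerBl exprn_ge0.
Qed.

Lemma sum_opTs_bound n m (s : nat -> seq nat) f :
  (forall k, (k < m)%N -> size (s k) = k) ->
  fn (tip n) (fun w => \sum_(k < m) opTs (s k) f w) <= rT * fn (tip n) f.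
Proof.
move=> ss; apply: le_trans (fn_sum (tip_psd V n) _ _ _) _.
apply: (@le_trans _ _ ((\sum_(k < m) q ^+ k) * fn (tip n) f)).
  rewrite mulr_suml; apply: ler_sum => k _.
  by apply: le_trans (opTs_bound _ _ _) _; rewrite ss.
by rewrite ler_wpM2r ?fn_ge0 // geom_le.
Qed.

Lemma RT_bound n m f : fn (tip n) (RT T m f) <= rT * fn (tip n) f.
Proof.
rewrite RT_opTs; apply: (@sum_opTs_bound _ _ (iota 0)) => k _.
by rewrite size_iota.
Qed.

Lemma RTr_bound n m f : fn (tip n) (RTr T m f) <= rT * fn (tip n) f.
Proof.
rewrite (_ : RTr T m f = fun w => \sum_(k < m) opTs (desc (m.-1 - k) m.-1) f w).
  apply: (@sum_opTs_bound _ _ (fun k => desc (m.-1 - k) m.-1)) => k km.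
  by rewrite size_rev size_iota; lia.
apply: funext => w; rewrite /RTr; case: m => [|m]; first by rewrite !big_ord0.
rewrite (reindex_inj rev_ord_inj) /=; apply: eq_bigr => k _.
by rewrite subSS.
Qed.

Lemma id_otimes_bound n (A : tens -> tens) c f : 0 <= c ->
  (forall g, fn (tip n) (A g) <= c * fn (tip n) g) ->
  fn (tip n.+1) (id_otimes A f) <= c * fn (tip n.+1) f.
Proof.
move=> c0 bA.
rewrite fn_le_qf //; try exact: tip_psd.
rewrite /qf !tipS !cxRe_sum mulr_sumr; apply: ler_sum => i _.
by have := bA (lslice i f); rewrite fn_le_qf //; exact: tip_psd.
Qed.

(** [PT 1] is the identity by definition; so is [RT 1], so that the recursion
already starts in degree 0. *)
Lemma PTS n f (w : word) : size w = n.+1 ->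
  PT T n.+1 f w = id_otimes (PT T n) (RT T n.+1 f) w.
Proof.
case: n => [|n] //; case: w => [|i [|? ?]] // _.
by rewrite /= /RT big_ord1.
Qed.

Lemma linop_PT n : linop (PT T n).
Proof.
elim: n => [|[|n] IH] //=.
apply: (@linop_comp _ _ (id_otimes (PT T n.+1))); last exact: linop_RT.
exact: linop_id_otimes.
Qed.

Lemma eq_RT n f g (w : word) : (forall v, size v = size w -> f v = g v) ->
  RT T n f w = RT T n g w.
Proof.
move=> fg; rewrite !RT_opTs; apply: eq_bigr => k _.
elim: (iota 0 k) w fg => [|j s IH] w fg /=; first exact: fg.
by apply: opT_ext => v sv; apply: IH => u su; rewrite fg // su.
Qed.

Lemma PT_bound n f : fn (tip n) (PT T n f) <= rT ^+ n * fn (tip n) f.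
Proof.
elim: n f => [|n IH] f; first by rewrite expr0 mul1r.
rewrite (_ : fn _ _ = fn (tip n.+1) (id_otimes (PT T n) (RT T n.+1 f))); last first.
  by rewrite /fn /qf; congr (Num.sqrt (complex.Re _)); apply: eq_tip => w sw; exact: PTS.
have rn : 0 <= rT ^+ n by rewrite exprn_ge0 // ltW // rT_gt0.
apply: le_trans (id_otimes_bound _ rn IH) _.
by rewrite exprSr -mulrA ler_wpM2l // RT_bound.
Qed.

End TwistForms.

(** * The twisted inner product, built from either side *)

Section TwistedForms.
Variables (R : realType) (V : vectType (Cx R)).
Local Notation C := (Cx R).
Local Notation d := (\dim {:V}).
Local Notation tens := (tens V).
Local Notation word := (word V).
Variable T : square_op V.
Local Notation opTs := (opTs T).
Local Notation tipT := (tipT T).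
Implicit Types f g h : tens.

Lemma eq_PT n f g (w : word) : (forall v, size v = size w -> f v = g v) ->
  PT T n f w = PT T n g w.
Proof.
elim: n f g w => [|[|n] IH] f g w fg /=; try exact: fg.
case: w fg => [|i w] fg //=; apply: IH => v sv.
by apply: eq_RT => u su; apply: fg; rewrite su /= sv.
Qed.

Lemma eq_tipT n f f' g g' : (forall w : word, size w = n -> f w = f' w) ->
  (forall w : word, size w = n -> g w = g' w) -> tipT n f g = tipT n f' g'.
Proof.
move=> ff' gg'; apply: eq_tip => // w sw; apply: eq_PT => v sv.
by apply: gg'; rewrite sv.
Qed.

Lemma tipTS n f g : tipT n.+1 f g =
  \sum_(i < d) tipT n (lslice i f) (lslice i (RT T n.+1 g)).
Proof.
rewrite /Defs.tipT tipS; apply: eq_bigr => i _; apply: eq_tip => // w sw.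
by rewrite /lslice PTS //= sw.
Qed.

Lemma opTs_rcons n s f i (w : word) : all (fun k => k.+2 <= n)%N s ->
  size w = n -> opTs s f (rcons w i) = opTs s (rslice i f) w.
Proof.
elim: s f w => //= k s IH f w /andP[kn sn] sw.
rewrite opT_rcons ?sw //; apply: opT_ext => v sv.
by rewrite IH // sv.
Qed.

Lemma opTs_cons s f i (w : word) :
  opTs (map S s) f (i :: w) = opTs s (lslice i f) w.
Proof.
elim: s w => //= k s IH w; rewrite opT_cons; apply: opT_ext => v _.
exact: IH.
Qed.

Lemma RTr_lslice n f i (w : word) :
  RTr T n.+1 (lslice i f) w = RTr_shift T n.+1 f (i :: w).
Proof.
rewrite /RTr /RTr_shift; apply: eq_bigr => j _.
by rewrite -opTs_cons /desc map_rev -[map S _](iotaDl 1).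
Qed.

Lemma RT_rslice n f i (w : word) : size w = n ->
  RT T n f (rcons w i) = RT T n (rslice i f) w.
Proof.
move=> sw; rewrite !RT_opTs; apply: eq_bigr => k _.
apply: (@opTs_rcons n) => //; apply/allP => j; rewrite mem_iota.
have := ltn_ord k; lia.
Qed.

(** Peeling off the last tensor factor instead of the first, by induction on the
degree; [RT_RTr_braid] exchanges the two kinds of factors. *)
Lemma PTSr n f i (w : word) : braided T -> size w = n ->
  PT T n.+1 f (rcons w i) = PT T n (rslice i (RTr T n.+1 f)) w.
Proof.
move=> br; elim: n f w => [|n IH] f w sw.
  by case: w sw => // _; rewrite /= /rslice /RTr big_ord1 /=.
case: w sw => // a u [su]; rewrite rcons_cons.
rewrite (@PTS _ _ _ _ _ (a :: rcons u i)); last by rewrite /= size_rcons su.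
rewrite -[LHS]/(PT T n.+1 (lslice a (RT T n.+2 f)) (rcons u i)) (IH (lslice a (RT T n.+2 f)) u su).
transitivity (PT T n (lslice a (RT T n.+1 (rslice i (RTr T n.+2 f)))) u).
  apply: eq_PT => v sv.
  rewrite {1}/rslice RTr_lslice RT_RTr_braid // -rcons_cons RT_rslice //=.
  by rewrite sv su.
by rewrite PTS //= su.
Qed.

Lemma tipTSr n f g : braided T -> tipT n.+1 f g =
  \sum_(i < d) tipT n (rslice i f) (rslice i (RTr T n.+1 g)).
Proof.
move=> br; rewrite /Defs.tipT tipSr; apply: eq_bigr => i _.
by apply: eq_tip => // w sw; rewrite {1}/rslice PTSr.
Qed.

Hypothesis hstrict : strict_twist T.

Lemma tipT0 n f g : (forall w : word, size w = n -> f w = 0) -> tipT n f g = 0.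
Proof.
move=> f0; rewrite /Defs.tipT tipE /wsum big1 // => w _.
by rewrite f0 ?size_tuple // conjC0 mul0r.
Qed.

Lemma tipT_gt0 n f : (exists2 w : word, size w = n & f w != 0) ->
  0 < tipT n f f.
Proof.
case: hstrict => _ _ pos; case: n => [|n]; last exact: pos.
case=> -[|//] _ f0; rewrite /Defs.tipT /= tipE wsum0.
by rewrite mulrC mul_conjC_gt0.
Qed.

Lemma tipT_ge0 n f : 0 <= tipT n f f.
Proof.
have [/tipT_gt0/ltW//|h] :=
  EM (exists2 w : word, size w = n & f w != 0).
rewrite tipT0 // => w sw; apply/eqP; apply: contrapT => fw.
by apply: h; exists w => //; apply/negP.
Qed.

Lemma tipT_lin n f (a : C) g h :
  tipT n f (fun w => a * g w + h w) = a * tipT n f g + tipT n f h.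
Proof. by rewrite /Defs.tipT linop_PT tip_lin. Qed.

Lemma tipT_linl n f (a : C) g h :
  tipT n (fun w => a * g w + h w) f = Num.conj a * tipT n g f + tipT n h f.
Proof.
rewrite /Defs.tipT tip_conj tip_lin rmorphD rmorphM /=.
by rewrite -!(tip_conj n).
Qed.

(** Polarisation: a sesquilinear form with real diagonal is Hermitian. *)
Lemma tipT_conj n f g : tipT n g f = Num.conj (tipT n f g).
Proof.
have H (a : C) : 0 <= tipT n f f +
    (a * tipT n f g + Num.conj a * tipT n g f) + Num.conj a * a * tipT n g g.
  have := tipT_ge0 n (fun w => a * g w + f w).
  rewrite tipT_lin !tipT_linl.
  by congr (_ <= _); ring.
have H1 := cxge0 (tipT_ge0 n f); have H2 := cxge0 (tipT_ge0 n g).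
have := H 1; have := H ('i : C); move: H1 H2 {H} => [-> _] [-> _].
move: (tipT n f g) (tipT n g f) => [a b] [a' b'].
rewrite cx_iE => /cxge0[E _] /cxge0[E' _]; move/(congr1 (@complex.Im R)): E.
move/(congr1 (@complex.Im R)): E' => /=.
rewrite !(mul0r, mulr0, mul1r, mulr1, addr0, add0r, oppr0, subr0) => E1 E2.
apply: cxeq => /=; lra.
Qed.

Lemma tipT_psd n : psd_form (tipT n).
Proof. by split; [exact: tipT_lin|exact: tipT_conj|exact: tipT_ge0]. Qed.

Lemma tipT_nondeg n f g : (forall h, tipT n h f = tipT n h g) ->
  forall w : word, size w = n -> f w = g w.
Proof.
move=> fg w sw; apply/eqP; rewrite -subr_eq0; apply: contraT => fgw.
have : 0 < tipT n (fun w => f w - g w) (fun w => f w - g w).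
  by apply: tipT_gt0; exists w.
rewrite (_ : (fun w => f w - g w) = fun w => -1 * g w + f w) ?tipT_lin ?fg.
  by rewrite mulN1r addNr ltxx.
by apply: funext => v; rewrite mulN1r addrC.
Qed.

Hypothesis q1 : square_op_norm T < 1.

Definition hsq (x : 'I_d -> C) : R :=
  \sum_i (complex.Re (x i) ^+ 2 + complex.Im (x i) ^+ 2).

Lemma hsq_ge0 x : 0 <= hsq x.
Proof. by apply: sumr_ge0 => i _; rewrite addr_ge0 ?sqr_ge0. Qed.

(** Creation on either side, and its adjoint.  The slices [sl i] read off the
coefficient of the [i]-th basis vector in the outermost tensor factor of the
side in question, and [A n] is the corresponding factor of [PT n.+1]. *)
Section Side.
Variables (sl : 'I_d -> tens -> tens) (A : nat -> tens -> tens).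
Hypothesis sl_tip : forall n f g,
  tip n.+1 f g = \sum_(i < d) tip n (sl i f) (sl i g).
Hypothesis sl_tipT : forall n f g,
  tipT n.+1 f g = \sum_(i < d) tipT n (sl i f) (sl i (A n g)).
Hypothesis sl_lin : forall i, linop (sl i).
Hypothesis A_bound : forall n f, fn (tip n.+1) (A n f) <= rT T * fn (tip n.+1) f.

Definition side_form n f g : C := \sum_(i < d) tipT n (sl i f) (sl i g).

Lemma side_psd n : psd_form (side_form n).
Proof.
split=> [f a g h|f g|f]; rewrite /side_form.
- rewrite mulr_sumr -big_split; apply: eq_bigr => i _ /=.
  by rewrite sl_lin tipT_lin.
- by rewrite rmorph_sum; apply: eq_bigr => i _ /=; rewrite -tipT_conj.
- by apply: sumr_ge0 => i _; exact: tipT_ge0.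
Qed.

Lemma side_form_bound n f :
  qf (side_form n) f <= rT T ^+ n * qf (tip n.+1) f.
Proof.
rewrite /qf /side_form sl_tip !cxRe_sum mulr_sumr; apply: ler_sum => i _.
apply: le_trans (Re_le_fn (tip_psd V n) _ _) _.
rewrite -[complex.Re _]/(qf (tip n) _) -(sqr_fn (tip_psd V n)) expr2 mulrCA.
by rewrite ler_wpM2l ?fn_ge0 // PT_bound.
Qed.

(** [A n] is symmetric for [side_form n], since composing the two gives the
Hermitian form [tipT n.+1], and it is bounded for the untwisted norm. Hence
[lax_bound] applies. This makes creation bounded. *)
Lemma tipT_side_bound n f : qf (tipT n.+1) f <= rT T * qf (side_form n) f.
Proof.
rewrite /qf sl_tipT -[X in complex.Re X]/(side_form n f (A n f)).
apply: (lax_bound (side_psd n)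
  (K := rT T ^+ n * qf (tip n.+1) f)) => [|g h|m].
- exact: rT_gt0.
- by rewrite (psd_conj (side_psd n)) /side_form -!sl_tipT -tipT_conj.
- have r0 := ltW (rT_gt0 q1).
  apply: le_trans (side_form_bound _ _) _; rewrite -mulrA ler_wpM2l ?exprn_ge0 //.
  rewrite [X in _ <= X]mulrC exprM -exprM mulnC exprM.
  rewrite -fn_le_qf ?exprn_ge0 //; try exact: tip_psd.
  elim: m => [|m IH]; first by rewrite expr0 mul1r.
  rewrite iterS exprS -mulrA; apply: le_trans (A_bound _ _) _.
  by rewrite ler_wpM2l.
Qed.

Variables (cr : tens -> tens) (x : 'I_d -> C).
Hypothesis sl_cr : forall i f, sl i (cr f) = fun w => x i * f w.

Lemma cr_bound n f : qf (tipT n.+1) (cr f) <= rT T * hsq x * qf (tipT n) f.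
Proof.
apply: le_trans (tipT_side_bound _ _) _.
rewrite -mulrA ler_wpM2l ?(ltW (rT_gt0 q1)) //.
rewrite {1}/qf /side_form cxRe_sum /hsq mulr_suml; apply: ler_sum => i _.
by rewrite sl_cr -[X in X <= _]/(qf (tipT n) _) (qfZ (tipT_psd n)).
Qed.

Definition ann_side f : tens := fun w =>
  \sum_(i < d) Num.conj (x i) * sl i (A (size w) f) w.

Lemma cr_ann_adjoint n f g : tipT n.+1 (cr f) g = tipT n f (ann_side g).
Proof.
rewrite sl_tipT.
rewrite (@eq_tipT n f f (ann_side g)
   (fun w => \sum_(i < d) Num.conj (x i) * sl i (A n g) w)) //; last first.
  by move=> w sw; rewrite /ann_side sw.
rewrite [in RHS]/Defs.tipT (linop_sum _ _ _ (linop_PT T n)).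
rewrite [RHS]tipE /wsum.
under [RHS]eq_bigr do rewrite mulr_sumr.
rewrite [RHS]exchange_big; apply: eq_bigr => i _ /=.
rewrite sl_cr (psdZl (tipT_psd n)) -(psdZr (tipT_psd n)).
by rewrite [LHS]tipE.
Qed.

(** Duality: an operator and its adjoint obey the same bound. *)
Lemma ann_bound n g :
  qf (tipT n) (ann_side g) <= rT T * hsq x * qf (tipT n.+1) g.
Proof.
set c := rT T * hsq x; set y := ann_side g.
have c0 : 0 <= c by rewrite mulr_ge0 ?hsq_ge0 ?(ltW (rT_gt0 q1)).
have cs : Num.sqrt c ^+ 2 = c by rewrite sqr_sqrtr.
have h : fn (tipT n.+1) (cr y) <= Num.sqrt c * fn (tipT n) y.
  by rewrite fn_le_qf ?sqrtr_ge0 ?cs ?cr_bound //; exact: tipT_psd.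
have : qf (tipT n) y <= Num.sqrt c * fn (tipT n) y * fn (tipT n.+1) g.
  rewrite {1}/qf {2}/y -cr_ann_adjoint.
  apply: le_trans (Re_le_fn (tipT_psd n.+1) _ _) _.
  by rewrite ler_wpM2r ?fn_ge0.
rewrite -{1}(sqr_fn (tipT_psd n)) expr2 mulrAC.
have -> : (qf (tipT n) y <= c * qf (tipT n.+1) g) =
    (fn (tipT n) y <= Num.sqrt c * fn (tipT n.+1) g).
  by rewrite fn_le_qf ?sqrtr_ge0 ?cs //; exact: tipT_psd.
have [->|y0] := eqVneq (fn (tipT n) y) 0.
  by rewrite mulr_ge0 ?sqrtr_ge0 ?fn_ge0.
have yp : 0 < fn (tipT n) y by rewrite lt_def y0 fn_ge0.
by rewrite ler_pM2r.
Qed.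

End Side.
End TwistedForms.

(** * Real series *)

Section RealSeries.
Variable R : realType.
Implicit Types u v : nat -> R.

Definition summ u := cvgn (series u).
Definition ssum u := limn (series u).

Lemma summ_lin (a : R) u v : summ u -> summ v ->
  summ (fun n => a * u n + v n) /\
  ssum (fun n => a * u n + v n) = a * ssum u + ssum v.
Proof.
move=> cu cv.
have -> : (fun n => a * u n + v n) = (a *: (u : R^o^nat)) + v by [].
have cau : cvgn (series (a *: (u : R^o^nat))) by apply: is_cvg_seriesZ.
split; first by apply: is_cvg_seriesD.
by rewrite /ssum lim_seriesD // lim_seriesZ.
Qed.

Lemma summ_abs_le u v : (forall n, `|u n| <= v n) -> summ v -> summ u.
Proof.
move=> uv cv; apply: normed_cvg.
apply: (@series_le_cvg _ (fun n => `|u n|) v) => // n.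
by apply: le_trans (uv n).
Qed.

Lemma ssum_le u v : summ u -> summ v -> (forall n, u n <= v n) -> ssum u <= ssum v.
Proof. by move=> cu cv uv; apply: lim_series_le. Qed.

Lemma ssum_ge_part u n : summ u -> (forall n, 0 <= u n) -> series u n <= ssum u.
Proof.
move=> cu u0; apply: nondecreasing_cvgn_le => //.
by apply: nondecreasing_series => k _ _; exact: u0.
Qed.

Lemma ssum_ge0 u : summ u -> (forall n, 0 <= u n) -> 0 <= ssum u.
Proof.
by move=> cu u0; have := ssum_ge_part 0 cu u0; rewrite seriesEnat /= big_geq.
Qed.

Lemma ssum_eq0 u : summ u -> (forall n, 0 <= u n) -> ssum u <= 0 ->
  forall n, u n = 0.
Proof.
move=> cu u0 s0 n; apply/eqP; rewrite eq_le u0 andbT.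
apply: le_trans s0; apply: le_trans (ssum_ge_part n.+1 cu u0).
rewrite seriesEnat /= big_nat_recr //= lerDr; apply: sumr_ge0 => i _; exact: u0.
Qed.

Lemma ssum_shift u : u 0%N = 0 -> summ (fun n => u n.+1) ->
  summ u /\ ssum u = ssum (fun n => u n.+1).
Proof.
move=> u0 cu.
have E : [sequence series u n.+1]_n = series (fun n => u n.+1).
  by apply: funext => n; rewrite !seriesEnat /= big_nat_recl //= u0 add0r.
have h : series u @ \oo --> ssum (fun n => u n.+1).
  by rewrite -cvg_shiftS E.
by split; [exact: (cvgP _ h)|apply: cvg_lim].
Qed.

Lemma summ_shift u : summ u -> summ (fun n => u n.+1).
Proof.
move=> cu.
have E : [sequence series u n.+1]_n = series (fun n => u n.+1) + cst (u 0%N).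
  by apply: funext => n; rewrite !seriesEnat /= big_nat_recl //= addrC.
have h : (series (fun n => u n.+1) + cst (u 0%N)) @ \oo --> ssum u.
  by rewrite -E cvg_shiftS.
apply/cvg_ex; exists (ssum u - u 0%N).
have -> : series (fun n => u n.+1) =
    (series (fun n => u n.+1) + cst (u 0%N)) - cst (u 0%N).
  by apply: funext => n; rewrite !fctE addrK.
by apply: cvgB => //; exact: cvg_cst.
Qed.

Lemma ssum_single u n : (forall k, k != n -> u k = 0) ->
  summ u /\ ssum u = u n.
Proof.
move=> uk.
have h : series u @ \oo --> u n.
  apply: (@cvg_near_cst _ _ _ _ _ _); near=> N.
  rewrite seriesEnat /= (bigD1_seq n) ?iota_uniq //=; last first.
    rewrite mem_index_iota leq0n /=; near: N; exact: nbhs_infty_gt.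
  by rewrite big1 ?addr0 // => k /uk.
by split; [exact: (cvgP _ h)|apply: cvg_lim].
Unshelve. all: end_near. Qed.

Lemma ssum_tail u : summ u -> forall e, 0 < e -> exists N, ssum u - series u N < e.
Proof.
move=> cu e e0.
have h : series u @ \oo --> ssum u by [].
have /cvgrPdist_lt /(_ _ e0) [N _ HN] := h.
by exists N; apply: le_lt_trans (ler_norm _) (HN N (leqnn _)).
Qed.

Lemma ssum_tailE u N : summ u ->
  summ (fun n => if (n < N)%N then 0 else u n) /\
  ssum (fun n => if (n < N)%N then 0 else u n) = ssum u - series u N.
Proof.
move=> cu; set v := fun n => _.
have h : series v @ \oo --> ssum u - series u N.
  have h1 : (series u - cst (series u N)) @ \oo --> ssum u - series u N.
    by apply: cvgB => //; exact: cvg_cst.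
  apply: cvg_trans h1; apply: near_eq_cvg; near=> n.
  have Nn : (N <= n)%N by near: n; exact: nbhs_infty_ge.
  rewrite !fctE !seriesEnat /= (big_cat_nat _ (n := N)) //=.
  rewrite addrAC subrr add0r [RHS](big_cat_nat _ (n := N)) //=.
  rewrite [X in _ = X + _](_ : _ = 0) ?add0r; last first.
    by rewrite big_nat_cond big1 // => i /andP[/andP[_ iN] _]; rewrite /v iN.
  rewrite big_nat_cond [RHS]big_nat_cond.
  by apply: eq_bigr => i /andP[/andP[Ni _] _]; rewrite /v ltnNge Ni.
by split; [exact: (cvgP _ h)|apply: cvg_lim].
Unshelve. all: end_near. Qed.

End RealSeries.

(** * The twisted Fock space *)

Section FockSpace.
Variables (R : realType) (V : vectType (Cx R)).
Local Notation C := (Cx R).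
Local Notation tens := (tens V).
Variable T : square_op V.
Local Notation tipT := (tipT T).
Local Notation fock := (fock T).
Local Notation fip := (fip T).
Local Notation fnorm := (fnorm T).
Hypothesis hstrict : strict_twist T.
Implicit Types f g h : tens.

Let tpsd n : psd_form (tipT n) := tipT_psd hstrict n.

Lemma fockE f : fock f = summ (fun n => qf (tipT n) f).
Proof. by []. Qed.

Lemma Re_tipT_le n f g :
  `|complex.Re (tipT n f g)| <= 1 * qf (tipT n) f + qf (tipT n) g.
Proof.
have f0 := qf_ge0 (tpsd n) f; have g0 := qf_ge0 (tpsd n) g.
have CS := psd_CS (tpsd n) f g.
rewrite mul1r -ler_sqr ?nnegrE ?addr_ge0 //.
rewrite real_normK ?num_real //; apply: le_trans CS _.
by rewrite sqrrD; nra.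
Qed.

Lemma Im_tipT n f g :
  complex.Im (tipT n f g) = complex.Re (tipT n f (fun w => (- 'i) * g w)).
Proof.
rewrite (psdZr (tpsd n)) cx_iE; case: (tipT n f g) => a b /=.
by rewrite oppr0 mul0r sub0r mulN1r opprK.
Qed.

Lemma qf_Ni n g : qf (tipT n) (fun w => (- 'i) * g w) = qf (tipT n) g.
Proof. by rewrite (qfZ (tpsd n)) cx_iE /= oppr0 expr0n add0r sqrrN expr1n mul1r. Qed.

Lemma fock_cvg_Re f g : fock f -> fock g ->
  summ (fun n => complex.Re (tipT n f g)).
Proof.
move=> cf cg; apply: summ_abs_le (fun n => Re_tipT_le n f g) _.
by have [] := summ_lin 1 cf cg.
Qed.

Lemma fock_Ni g : fock g -> fock (fun w => (- 'i) * g w).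
Proof.
rewrite !fockE; congr summ; apply: funext => n.
exact: esym (qf_Ni n g).
Qed.

Lemma fock_cvg_Im f g : fock f -> fock g ->
  summ (fun n => complex.Im (tipT n f g)).
Proof.
move=> cf /fock_Ni cg; have := fock_cvg_Re cf cg.
by congr summ; apply: funext => n; rewrite Im_tipT.
Qed.

Lemma fipE f g : fip f g = (ssum (fun n => complex.Re (tipT n f g)) +i*
  ssum (fun n => complex.Im (tipT n f g)))%C.
Proof. by []. Qed.

Lemma qf_lin_le n (a : C) f g : qf (tipT n) (fun w => a * f w + g w) <=
  (3 * (complex.Re a ^+ 2 + complex.Im a ^+ 2)) * qf (tipT n) f
  + (2 * qf (tipT n) g + qf (tipT n) g).
Proof.
rewrite (qfD (tpsd n)) (qfZ (tpsd n)).
have := Re_tipT_le n (fun w => a * f w) g; rewrite (qfZ (tpsd n)).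
by move=> /(le_trans (ler_norm _)); lra.
Qed.

Lemma fock_lin (a : C) f g : fock f -> fock g -> fock (fun w => a * f w + g w).
Proof.
move=> cf cg; have [cgg _] := summ_lin 2 cg cg.
have [cfg _] := summ_lin (3 * (complex.Re a ^+ 2 + complex.Im a ^+ 2)) cf cgg.
apply: summ_abs_le cfg => n; rewrite ger0_norm; first exact: qf_lin_le.
exact: qf_ge0 (tpsd n) _.
Qed.

Lemma homog_fock n f : homog n f -> fock f.
Proof.
move=> hf; have [] // := @ssum_single _ (fun k => qf (tipT k) f) n.
move=> k kn; rewrite /qf tipT0 // => w sw; apply: hf.
by rewrite sw.
Qed.

Lemma fock0 : fock (fun=> 0).
Proof. by apply: (@homog_fock 0) => w. Qed.

Lemma fockD f g : fock f -> fock g -> fock (fun w => f w + g w).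
Proof.
move=> /fock_lin H /H -/(_ 1).
by congr fock; apply: funext => w; rewrite mul1r.
Qed.

Lemma fock_sum (I : Type) (r : seq I) (P : pred I) (F : I -> tens) :
  (forall i, P i -> fock (F i)) -> fock (fun w => \sum_(i <- r | P i) F i w).
Proof.
move=> cF; elim: r => [|i r IH].
  by have := fock0; congr fock; apply: funext => w; rewrite big_nil.
have [Pi|nPi] := boolP (P i).
  have := fockD (cF i Pi) IH; congr fock; apply: funext => w.
  by rewrite big_cons Pi.
have := IH; congr fock; apply: funext => w.
by rewrite big_cons (negPf nPi).
Qed.

Lemma fip_conj f g : fock f -> fock g -> fip g f = Num.conj (fip f g).
Proof.
move=> cf cg; apply: cxeq; rewrite ?cxRe_conj ?cxIm_conj !fipE /=.
  by congr ssum; apply: funext => n; rewrite (psd_conj (tpsd n)) cxRe_conj.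
have ci := fock_cvg_Im cf cg; have [_ e] := summ_lin (-2) ci ci.
transitivity (-2 * ssum (fun n => complex.Im (tipT n f g)) +
  ssum (fun n => complex.Im (tipT n f g))); last by ring.
rewrite -e; congr ssum; apply: funext => n.
by rewrite (psd_conj (tpsd n)) cxIm_conj; ring.
Qed.

Lemma fip_lin f (a : C) g h : fock f -> fock g -> fock h ->
  fip f (fun w => a * g w + h w) = a * fip f g + fip f h.
Proof.
move=> cf cg ch.
have rg := fock_cvg_Re cf cg; have ig := fock_cvg_Im cf cg.
have rh := fock_cvg_Re cf ch; have ih := fock_cvg_Im cf ch.
apply: cxeq; rewrite !fipE.
  have [c1 e1] := summ_lin (- complex.Im a) ig rh.
  have [_ e2] := summ_lin (complex.Re a) rg c1.
  rewrite cxReD cxReM /=.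
  transitivity (ssum (fun n => complex.Re a * complex.Re (tipT n f g) +
    (- complex.Im a * complex.Im (tipT n f g) + complex.Re (tipT n f h)))).
    congr ssum; apply: funext => n; rewrite (psd_lin (tpsd n)) cxReD cxReM; ring.
  by rewrite e2 e1; ring.
have [c1 e1] := summ_lin (complex.Im a) rg ih.
have [_ e2] := summ_lin (complex.Re a) ig c1.
rewrite cxImD cxImM /=.
transitivity (ssum (fun n => complex.Re a * complex.Im (tipT n f g) +
    (complex.Im a * complex.Re (tipT n f g) + complex.Im (tipT n f h)))).
  congr ssum; apply: funext => n; rewrite (psd_lin (tpsd n)) cxImD cxImM; ring.
by rewrite e2 e1; ring.
Qed.

Lemma fip_linl f (a : C) g h : fock f -> fock g -> fock h ->
  fip (fun w => a * g w + h w) f = Num.conj a * fip g f + fip h f.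
Proof.
move=> cf cg ch; rewrite (fip_conj cf (fock_lin (a := a) cg ch)) fip_lin // rmorphD rmorphM /=.
by rewrite -!fip_conj.
Qed.

Lemma fip_homog n f g : homog n g -> fip f g = tipT n f g.
Proof.
move=> hg.
have z k : k != n -> tipT k f g = 0.
  move=> kn; rewrite (psd_conj (tpsd k)) tipT0 ?conjC0 // => w sw.
  by apply: hg; rewrite sw.
have [_ e1] := @ssum_single _ (fun k => complex.Re (tipT k f g)) n
  (fun k kn => congr1 (@complex.Re R) (z k kn)).
have [_ e2] := @ssum_single _ (fun k => complex.Im (tipT k f g)) n
  (fun k kn => congr1 (@complex.Im R) (z k kn)).
by rewrite fipE e1 e2; case: (tipT n f g).
Qed.

(** Strict positivity makes the inner product nondegenerate in each degree, and
the components of a family are its products with homogeneous tensors. *)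
Lemma fip_separates f g : (forall n h, homog n h -> fip f h = fip g h) -> f = g.
Proof.
move=> fg; apply: funext => w.
apply: (tipT_nondeg hstrict (n := size w)) => // h.
pose h' : tens := fun v => if size v == size w then h v else 0.
have hh : homog (size w) h' by move=> v /negPf sv; rewrite /h' sv.
have := fg _ _ hh; rewrite !(fip_homog _ hh).
have E k : tipT (size w) k h' = tipT (size w) k h.
  by apply: eq_tipT => // v sv; rewrite /h' sv eqxx.
by rewrite !E (psd_conj (tpsd _) f h) (psd_conj (tpsd _) g h) => ->.
Qed.

Lemma fnormE f : fnorm f = Num.sqrt (ssum (fun n => qf (tipT n) f)).
Proof. by []. Qed.

Lemma fnorm_le (c : R) f g : 0 <= c -> fock f -> fock g ->
  (ssum (fun n => qf (tipT n) f) <= c * ssum (fun n => qf (tipT n) g)) ->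
  fnorm f <= Num.sqrt c * fnorm g.
Proof. by move=> c0 cf cg le; rewrite !fnormE -sqrtrM // ler_wsqrtr. Qed.

(** An operator that raises the degree by one, and its adjoint. Bounds and
adjointness are required degree by degree; summed over the degrees they give
adjoint bounded operators on the Fock space. *)
Record ladder (A B : fop V) (c : R) : Prop := Ladder {
  ladder_ge0 : 0 <= c;
  ladder_linl : linop A;
  ladder_linr : linop B;
  ladder_nil : forall f, A f [::] = 0;
  ladder_boundl : forall n f, qf (tipT n.+1) (A f) <= c * qf (tipT n) f;
  ladder_boundr : forall n f, qf (tipT n) (B f) <= c * qf (tipT n.+1) f;
  ladder_adj : forall n f g, tipT n.+1 (A f) g = tipT n f (B g) }.

Section Ladder.
Variables (A B : fop V) (c : R).
Hypothesis L : ladder A B c.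

Lemma ladder_tip0 f g : tipT 0 (A f) g = 0.
Proof. by apply: tipT0 => -[|//] _; exact: ladder_nil L f. Qed.

Lemma ladder_bounded_l : bounded_op T A.
Proof.
have c0 := ladder_ge0 L.
have z f : qf (tipT 0) (A f) = 0 by rewrite /qf ladder_tip0.
have H f : fock f -> summ (fun n => qf (tipT n.+1) (A f)) /\
   ssum (fun n => qf (tipT n.+1) (A f)) <= c * ssum (fun n => qf (tipT n) f).
  move=> cf.
  have [cf' e] := summ_lin (c - 1) cf cf.
  have cA : summ (fun n => qf (tipT n.+1) (A f)).
    apply: summ_abs_le cf' => n; rewrite ger0_norm; last exact: qf_ge0 (tpsd _) _.
    by apply: le_trans (ladder_boundl L n f) _; lra.
  split=> //; apply: le_trans (ssum_le cA cf' _) _ => [n|].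
    by apply: le_trans (ladder_boundl L n f) _; lra.
  by rewrite e; lra.
split.
- by move=> f /H[cA _]; have [] := @ssum_shift _ (fun n => qf (tipT n) (A f)) (z f) cA.
- by move=> a f g _ _; exact: ladder_linl L _ _ _.
- exists (Num.sqrt c) => f cf; have [cA le] := H f cf.
  have [cA' e] := @ssum_shift _ (fun n => qf (tipT n) (A f)) (z f) cA.
  by apply: fnorm_le => //; rewrite e.
Qed.

Lemma ladder_bounded_r : bounded_op T B.
Proof.
have c0 := ladder_ge0 L.
have H f : fock f -> fock (B f) /\
   ssum (fun n => qf (tipT n) (B f)) <= c * ssum (fun n => qf (tipT n) f).
  move=> cf; have cf1 := summ_shift cf.
  have [cf' e] := summ_lin (c - 1) cf1 cf1.
  have cB : fock (B f).
    apply: summ_abs_le cf' => n; rewrite ger0_norm; last exact: qf_ge0 (tpsd _) _.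
    by apply: le_trans (ladder_boundr L n f) _; lra.
  split=> //; apply: le_trans (ssum_le cB cf' _) _ => [n|].
    by apply: le_trans (ladder_boundr L n f) _; lra.
  have le : ssum (fun n => qf (tipT n.+1) f) <= ssum (fun n => qf (tipT n) f).
    pose u n := if n is k.+1 then qf (tipT k.+1) f else 0.
    have [cu <-] := @ssum_shift _ u erefl cf1.
    apply: ssum_le => // -[|n] //=; exact: qf_ge0 (tpsd _) _.
  have := ler_wpM2l c0 le; rewrite e; lra.
split.
- by move=> f /H[].
- by move=> a f g _ _; exact: ladder_linr L _ _ _.
- by exists (Num.sqrt c) => f cf; have [cB le] := H f cf; apply: fnorm_le.
Qed.

Lemma ladder_fip f g : fock f -> fock g -> fip (A f) g = fip f (B g).
Proof.
move=> cf cg; have [fA _ _] := ladder_bounded_l; have [fB _ _] := ladder_bounded_r.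
rewrite !fipE.
have [_ ->] := @ssum_shift _ (fun n => complex.Re (tipT n (A f) g))
  (congr1 (@complex.Re R) (ladder_tip0 f g))
  (summ_shift (fock_cvg_Re (fA _ cf) cg)).
have [_ ->] := @ssum_shift _ (fun n => complex.Im (tipT n (A f) g))
  (congr1 (@complex.Im R) (ladder_tip0 f g))
  (summ_shift (fock_cvg_Im (fA _ cf) cg)).
by congr (_ +i* _)%C; congr ssum; apply: funext => n; rewrite (ladder_adj L).
Qed.

End Ladder.
End FockSpace.

(** * Contractions and the crossing relation *)

Section Contractions.
Variables (R : realType) (V : vectType (Cx R)).
Local Notation C := (Cx R).
Local Notation d := (\dim {:V}).
Local Notation tens := (tens V).
Local Notation word := (word V).
Variables (form : {dot V for Num.conj}) (H : set V) (T : square_op V).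
Local Notation opT := (opT T).
Local Notation opTs := (opTs T).
Local Notation ctr := (Defs.contraction form H).
Local Notation e := (tnth (onb form)).
Implicit Types f g h : tens.

Definition tomita_kernel (a b : 'I_d) : C := ip form (tomita H (e a)) (e b).
Local Notation s := tomita_kernel.

Lemma contraction_takeE k f (w : word) : ctr k f w =
  \sum_p s p.1 p.2 * f (take k w ++ p.1 :: p.2 :: drop k w).
Proof. by []. Qed.

Lemma contractionE u w f :
  ctr (size u) f (u ++ w) = \sum_p s p.1 p.2 * f (u ++ p.1 :: p.2 :: w).
Proof. by rewrite /Defs.contraction take_size_cat // drop_size_cat. Qed.

Lemma contraction_head u k f (w : word) :
  ctr (size u + k) f (u ++ w) = ctr k (fun v => f (u ++ v)) w.
Proof.
rewrite /Defs.contraction; apply: eq_bigr => p _; congr (_ * f _).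
by rewrite take_cat drop_cat ltnNge leq_addr /= addKn catA.
Qed.

Lemma contraction_cons k f i (w : word) :
  ctr k.+1 f (i :: w) = ctr k (lslice i f) w.
Proof. exact: (contraction_head [:: i]). Qed.

Lemma contraction_homog N k f : (2 <= N)%N -> homog N f -> homog (N - 2) (ctr k f).
Proof.
move=> N2 hf w sw; rewrite /Defs.contraction big1 // => p _.
rewrite hf ?mulr0 // size_cat /= !addnS -size_cat cat_take_drop.
by apply: contra sw => /eqP; lia.
Qed.

Lemma homog_ext N f g : homog N f -> homog N g ->
  (forall w : word, size w = N -> f w = g w) -> f = g.
Proof.
move=> hf hg fg; apply: funext => w; have [/fg//|sw] := eqVneq (size w) N.
by rewrite hf ?hg.
Qed.

Lemma split_word k (w : word) : (k <= size w)%N ->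
  exists u v, w = u ++ v /\ size u = k.
Proof.
move=> kw; exists (take k w), (drop k w); rewrite cat_take_drop; split => //.
by rewrite size_take; case: ltnP => //; lia.
Qed.

Lemma opT_contraction_ge a b f : (a <= b)%N ->
  opT b (ctr a f) = ctr a (opT b.+2 f).
Proof.
move=> ab; apply: funext => w.
have [sw|sw] := ltnP (size w) b.+2.
  rewrite opT_short // /Defs.contraction big1 // => p _.
  rewrite opT_short ?mulr0 // size_cat /= !addnS -size_cat cat_take_drop; lia.
have [u [v [-> su]]] := @split_word a w (leq_trans ab (ltnW (ltnW sw))).
have [k ->] : exists k, b = (size u + k)%N by exists (b - a)%N; lia.
rewrite opT_head.
have -> : (fun v0 : word => ctr a f (u ++ v0)) =
  fun v0 => \sum_p s p.1 p.2 * f (u ++ p.1 :: p.2 :: v0).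
  by apply: funext => v0; rewrite -su contractionE.
rewrite (linop_sum _ _ _ (linop_opT T k)) -su contractionE.
apply: eq_bigr => p _; rewrite (linopZ _ _ (linop_opT T k)); congr (_ * _).
have -> : (size u + k).+2 = (size (u ++ [:: p.1; p.2]) + k)%N.
  by rewrite size_cat /=; lia.
rewrite -[p.1 :: p.2 :: v]/([:: p.1; p.2] ++ v) catA opT_head.
by congr (opT k _); apply: funext => v0; rewrite -catA.
Qed.

Lemma opT_contraction_lt_at a b f (w : word) : (b.+2 <= a)%N -> (a <= size w)%N ->
  opT b (ctr a f) w = ctr a (opT b f) w.
Proof.
move=> ba /split_word [u [v [-> su]]].
rewrite opT_tail ?su // -su contractionE.
have -> : opT b (fun w0 : word => ctr (size u) f (w0 ++ v)) u =
  opT b (fun w0 => \sum_p s p.1 p.2 * f (w0 ++ p.1 :: p.2 :: v)) u.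
  by apply: opT_ext => w' <-; rewrite contractionE.
rewrite (linop_sum _ _ _ (linop_opT T b)).
apply: eq_bigr => p _; rewrite (linopZ _ _ (linop_opT T b)); congr (_ * _).
by rewrite opT_tail // su.
Qed.

Lemma opT_contraction_lt N a b f : homog N f -> (a.+2 <= N)%N -> (b.+2 <= a)%N ->
  opT b (ctr a f) = ctr a (opT b f).
Proof.
move=> hf aN ba; apply: (@homog_ext (N - 2)).
- by apply: opT_homog; apply: contraction_homog => //; lia.
- by apply: contraction_homog => //; [lia|exact: opT_homog].
- by move=> w sw; apply: opT_contraction_lt_at => //; lia.
Qed.

Lemma contraction_contraction N a b f : homog N f -> (b + 4 <= N)%N -> (a <= b)%N ->
  ctr b (ctr a f) = ctr a (ctr b.+2 f).
Proof.
move=> hf bN ab; apply: (@homog_ext (N - 2 - 2)).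
- by do 2!(apply: contraction_homog; first by lia).
- by do 2!(apply: contraction_homog; first by lia).
move=> w sw.
have /split_word [u [v [-> su]]] : (a <= size w)%N by lia.
have [k kE] : exists k, b = (size u + k)%N by exists (b - a)%N; lia.
rewrite kE contraction_head -[in RHS]su contractionE [LHS]contraction_takeE.
transitivity (\sum_p s p.1 p.2 * \sum_q s q.1 q.2 *
   f (u ++ q.1 :: q.2 :: take k v ++ p.1 :: p.2 :: drop k v)).
  by apply: eq_bigr => p _; rewrite -su contractionE.
under eq_bigr do rewrite mulr_sumr.
rewrite exchange_big; apply: eq_bigr => p _ /=.
rewrite contraction_takeE mulr_sumr; apply: eq_bigr => q _; rewrite mulrCA; congr (_ * (_ * f _)).
rewrite take_cat drop_cat.
have -> : ((size u + k).+2 < size u)%N = false by lia.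
have -> : ((size u + k).+2 - size u = k.+2)%N by lia.
by rewrite -catA.
Qed.

(** The relation [C_1 T_2 = C_2 T_1] on three tensor factors, in coordinates.
This is all that is used of crossing symmetry. *)
Definition kernel_crossing : Prop := forall a b c v,
  \sum_x s a x * T (x, v) (b, c) = \sum_y T (v, y) (a, b) * s y c.

Hypothesis crossing : kernel_crossing.

Lemma contraction_crossing N a f : homog N f -> (a + 3 <= N)%N ->
  ctr a (opT a.+1 f) = ctr a.+1 (opT a f).
Proof.
move=> hf aN; apply: (@homog_ext (N - 2)).
- by apply: contraction_homog; [lia|apply: opT_homog].
- by apply: contraction_homog; [lia|apply: opT_homog].
move=> w sw.
have [u [v' [wE su]]] := @split_word a w ltac:(lia).
rewrite wE; have [x0 [v ->]] : exists x0 v, v' = x0 :: v.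
  case: v' wE => [|x0 v] wE; last by exists x0, v.
  by exfalso; move: sw; rewrite wE size_cat /=; lia.
rewrite -{1}su contractionE -cat_rcons.
have -> : a.+1 = size (rcons u x0) by rewrite size_rcons su.
rewrite contractionE.
transitivity (\sum_p \sum_q \sum_(x : 'I_d) s p.1 p.2 * T (p.2, x0) (q.1, q.2) *
    (x == q.1)%:R * f (u ++ p.1 :: q.1 :: q.2 :: v)).
  apply: eq_bigr => p _.
  have -> : size (rcons u x0) = (size (u ++ [:: p.1]) + 0)%N.
    by rewrite size_rcons size_cat addn0 addn1.
  rewrite (_ : u ++ [:: p.1, p.2, x0 & v] = (u ++ [:: p.1]) ++ [:: p.2, x0 & v]);
    last by rewrite -catA.
  rewrite opT_head /Defs.opT /= mulr_sumr.
  apply: eq_bigr => q _; rewrite (bigD1 q.1) //= eqxx mulr1.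
  rewrite big1 ?addr0 => [|x /negPf ->]; last by rewrite mulr0 mul0r.
  by rewrite mulrA -!catA -surjective_pairing.
transitivity (\sum_(a0 : 'I_d) \sum_(b0 : 'I_d) \sum_(c0 : 'I_d)
   (\sum_x s a0 x * T (x, x0) (b0, c0)) * f (u ++ a0 :: b0 :: c0 :: v)).
  rewrite -(pair_bigA _ (fun a0 x => \sum_q \sum_(y : 'I_d) s a0 x * T (x, x0) (q.1, q.2) *
    (y == q.1)%:R * f (u ++ a0 :: q.1 :: q.2 :: v))) /=.
  apply: eq_bigr => a0 _; rewrite exchange_big /=.
  rewrite -(pair_bigA _ (fun b0 c0 => \sum_x0' \sum_(y : 'I_d) s a0 x0' *
     T (x0', x0) (b0, c0) * (y == b0)%:R * f (u ++ a0 :: b0 :: c0 :: v))) /=.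
  apply: eq_bigr => b0 _; apply: eq_bigr => c0 _; rewrite mulr_suml.
  apply: eq_bigr => x _; rewrite (bigD1 b0) //= eqxx mulr1.
  by rewrite big1 ?addr0 // => y /negPf ->; rewrite mulr0 mul0r.
transitivity (\sum_p \sum_q s p.1 p.2 * (T (x0, p.1) (q.1, q.2) *
    f (u ++ q.1 :: q.2 :: p.2 :: v))); last first.
  apply: eq_bigr => p _; rewrite -mulr_sumr; congr (_ * _).
  rewrite cat_rcons -{1}su -[size u]addn0 opT_head /Defs.opT /=.
  by apply: eq_bigr => q _; rewrite -surjective_pairing.
rewrite [RHS]exchange_big /=.
rewrite -(pair_bigA _ (fun a0 b0 => \sum_p s p.1 p.2 * (T (x0, p.1) (a0, b0) *
    f (u ++ a0 :: b0 :: p.2 :: v)))) /=.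
apply: eq_bigr => a0 _; apply: eq_bigr => b0 _.
rewrite -(pair_bigA _ (fun y c0 => s y c0 * (T (x0, y) (a0, b0) *
    f (u ++ a0 :: b0 :: c0 :: v)))) [RHS]exchange_big /=.
apply: eq_bigr => c0 _; rewrite crossing mulr_suml; apply: eq_bigr => y _.
by rewrite mulrA [s y c0 * _]mulrC.
Qed.

Lemma opTs_contraction_ge a l f : all (fun b => a <= b)%N l ->
  opTs l (ctr a f) = ctr a (opTs [seq b.+2 | b <- l] f).
Proof.
elim: l => //= b l IH /andP[ab al].
by rewrite IH // opT_contraction_ge.
Qed.

Lemma opTs_contraction_lt N a l f : homog N f -> (a.+2 <= N)%N ->
  all (fun b => b.+2 <= a)%N l -> opTs l (ctr a f) = ctr a (opTs l f).
Proof.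
move=> hf aN; elim: l => //= b l IH /andP[ab al].
by rewrite IH // (@opT_contraction_lt N) //; apply: opTs_homog.
Qed.

Lemma map_iota_S2 a n : [seq b.+2 | b <- iota a n] = iota a.+2 n.
Proof. exact: esym (iotaDl 2 a n). Qed.

Lemma map_iota_S a n : map S (iota a n) = iota a.+1 n.
Proof. exact: esym (iotaDl 1 a n). Qed.

(** Both contractions are pulled to the left, where they act on different tensor
factors; the first one shifts the positions of the second by two. *)
Lemma swap_disjoint N i j k l f : homog N f ->
  (i < j)%N -> (j < k)%N -> (k < l)%N -> (l < N)%N ->
  ctr (k - 2) (opTseg T (k - 2).+1 (l - 2) (ctr i (opTseg T i.+1 j f))) =
  ctr i (opTseg T i.+1 j (ctr k (opTseg T k.+1 l f))).
Proof.
move=> hf ij jk kl lN; rewrite /opTseg -!/(opTs _ _).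
rewrite [X in ctr (k - 2) X]opTs_contraction_ge; last first.
  by apply/allP => b; rewrite mem_iota; lia.
rewrite map_iota_S2.
have -> : ((k - 2).+3 = k.+1)%N by lia.
have -> : (l - 2 - (k - 2).+1 = l - k.+1)%N by lia.
rewrite (@contraction_contraction N); [|by do 2!apply: opTs_homog|lia|lia].
congr (ctr i _); have -> : (k - 2).+2 = k by lia.
rewrite (@opTs_contraction_lt N); first last.
- by apply/allP => b; rewrite mem_iota; lia.
- by lia.
- exact: opTs_homog.
congr (ctr k _); apply: opTs_comm; apply/allP => b; rewrite mem_iota => bP.
by apply/allP => c; rewrite mem_iota => cP; apply/orP; right; lia.
Qed.

Hypothesis br : braided T.

Lemma opTs_asc_braids a n l f : all (fun m => (a <= m) && (m.+2 <= a + n))%N l ->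
  opTs (iota a n) (opTs l f) = opTs (map S l) (opTs (iota a n) f).
Proof.
elim: l => //= m l IH /andP[/andP[am mn] al].
by rewrite opTs_asc_braid // IH.
Qed.

(** Once both contractions are pulled to the left, one product of twists passes
through the other by the braid relation, and the twist [T_k] that is left
over next to a contraction is handled by [contraction_crossing]. *)
Lemma swap_crossing N i j k l f : homog N f ->
  (i < k)%N -> (k < j)%N -> (j < l)%N -> (l < N)%N ->
  ctr (k - 1) (opTseg T (k - 1).+1 (l - 2) (ctr i (opTseg T i.+1 j f))) =
  ctr i (opTseg T i.+1 (j - 1) (ctr k (opTseg T k.+1 l f))).
Proof.
move=> hf ik kj jl lN.
have [a aE] : exists a, k = (i.+1 + a)%N by exists (k - i.+1)%N; lia.
have [b bE] : exists b, j = (k.+1 + b)%N by exists (j - k.+1)%N; lia.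
have [c cE] : exists c, l = (j.+1 + c)%N by exists (l - j.+1)%N; lia.
rewrite /opTseg -!/(opTs _ _).
have -> : (l - 2 - (k - 1).+1 = b + c)%N by lia.
have -> : (j - i.+1 = a + (1 + b))%N by lia.
have -> : (j - 1 - i.+1 = a + b)%N by lia.
have -> : (l - k.+1 = b + c + 1)%N by lia.
rewrite [X in ctr (k - 1) X]opTs_contraction_ge; last first.
  by apply/allP => m; rewrite mem_iota; lia.
rewrite map_iota_S2.
have -> : ((k - 1).+3 = k.+2)%N by lia.
rewrite (@contraction_contraction N); [|by do 2!apply: opTs_homog|lia|lia].
congr (ctr i _); have -> : (k - 1).+2 = k.+1 by lia.
rewrite !(iotaD i.+1) -aE !opTs_cat.
rewrite (opTs_contraction_ge (a := k) (l := iota k b)); last first.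
  by apply/allP => m; rewrite mem_iota; lia.
rewrite map_iota_S2.
rewrite (@opTs_comm _ _ T (iota k.+2 (b + c))); last first.
  apply/allP => m; rewrite mem_iota => mP; apply/allP => m'; rewrite mem_iota => mP'.
  by apply/orP; right; lia.
rewrite -(@opTs_contraction_lt N); first last.
- by apply/allP => m; rewrite mem_iota; lia.
- by lia.
- by do 2!apply: opTs_homog.
congr (opTs _ _).
rewrite -[opTs (iota k (1 + b)) _]/(opT k (opTs (iota k.+1 b) _)) addn1.
rewrite -(@opT_opTs_comm _ _ T k); last first.
  by apply/allP => m; rewrite mem_iota => mP; apply/orP; left; lia.
rewrite -(@contraction_crossing N); [|by do 2!apply: opTs_homog|lia].
congr (ctr k _).
rewrite -[opT k.+1 _]/(opTs (iota k.+1 (b + c).+1) _) opTs_asc_braids.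
  by rewrite map_iota_S.
by apply/allP => m; rewrite mem_iota => mP; lia.
Qed.

(** Every use of [contraction_crossing] moves the contraction one place to the
right and turns one factor of the ascending product into one of the
descending product. *)
Lemma contraction_sweep n f : homog n.+2 f ->
  ctr 0 (opTs (iota 1 n) f) = ctr n (opTs (desc 0 n) f).
Proof.
move=> hf.
suff sweep k : (k <= n)%N -> ctr 0 (opTs (iota 1 n) f) =
    ctr k (opTs (desc 0 k) (opTs (iota k.+1 (n - k)) f)).
  by rewrite (sweep n) // subnn.
elim: k => [|k IH] kn; first by rewrite subn0.
rewrite IH; last by lia.
have -> : (n - k = 1 + (n - k.+1))%N by lia.
rewrite iotaD opTs_cat -[opTs (iota k.+1 1) _]/(opT k.+1 _).
rewrite -opT_opTs_comm; last first.
  apply/allP => m; rewrite mem_rev mem_iota => mP; apply/orP; right; lia.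
rewrite (@contraction_crossing n.+2); [|by do 2!apply: opTs_homog|lia].
rewrite (@desc_cat 0 k k.+1) // opTs_cat addn1.
by rewrite /desc subSn // subnn.
Qed.

End Contractions.

(** * Left and right field operators *)

Section Fields.
Variables (R : realType) (V : vectType (Cx R)).
Local Notation d := (\dim {:V}).
Local Notation tens := (tens V).
Local Notation word := (word V).
Variables (form : {dot V for Num.conj}) (H : set V) (T : square_op V).
Local Notation opTs := (opTs T).
Local Notation fock := (fock T).
Local Notation fip := (fip T).
Local Notation coord := (Defs.coord form).
Local Notation creation := (creation form).
Local Notation S := (tomita H).
Local Notation Sd := (antiadjoint form (tomita H)).
Implicit Types f g h : tens.

Hypothesis hstrict : strict_twist T.
Hypothesis br : braided T.
Hypothesis q1 : square_op_norm T < 1.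

Definition creationR (a : V) f : tens := fun w =>
  if rev w is i :: u then coord i a * f (rev u) else 0.

(** The adjoint of [creation a], by an explicit formula. *)
Definition annL (a : V) : tens -> tens :=
  ann_side (@lslice R V) (fun n => RT T n.+1) (coord^~ a).

(** The adjoint of [creationR a], by an explicit formula. *)
Definition annR (a : V) : tens -> tens :=
  ann_side (@rslice R V) (fun n => RTr T n.+1) (coord^~ a).

Lemma lslice_creation a i f : lslice i (creation a f) = fun w => coord i a * f w.
Proof. by []. Qed.

Lemma creationR_rcons a f w i : creationR a f (rcons w i) = coord i a * f w.
Proof. by rewrite /creationR rev_rcons revK. Qed.

Lemma rslice_creationR a i f : rslice i (creationR a f) = fun w => coord i a * f w.
Proof. by apply: funext => w; rewrite /rslice creationR_rcons. Qed.

Lemma linop_creation a : linop (creation a).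
Proof.
move=> c f g; apply: funext => -[|i w] /=; first by rewrite mulr0 addr0.
by rewrite mulrDr mulrCA.
Qed.

Lemma linop_creationR a : linop (creationR a).
Proof.
move=> c f g; apply: funext; case/lastP => [|w i].
  by rewrite /creationR /= mulr0 addr0.
by rewrite !creationR_rcons mulrDr mulrCA.
Qed.

Lemma linop_ann_side (sl : 'I_d -> tens -> tens) (A : nat -> tens -> tens) x :
  (forall i, linop (sl i)) -> (forall n, linop (A n)) -> linop (ann_side sl A x).
Proof.
move=> ls lA c f g; apply: funext => w; rewrite /ann_side mulr_sumr -big_split.
by apply: eq_bigr => i _ /=; rewrite lA ls mulrDr mulrCA.
Qed.

Lemma linop_lslice i : linop (@lslice R V i). Proof. by []. Qed.
Lemma linop_rslice i : linop (@rslice R V i). Proof. by []. Qed.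

Lemma linop_annL a : linop (annL a).
Proof. by apply: linop_ann_side => // n; exact: linop_RT. Qed.

Lemma linop_annR a : linop (annR a).
Proof. by apply: linop_ann_side => // n; exact: linop_RTr. Qed.

Lemma ladderL a : ladder T (creation a) (annL a) (rT T * hsq (coord^~ a)).
Proof.
have sT n f g := tipTS T n f g.
have st n f g := @tipS R V n f g.
have bA n f : fn (tip n.+1) (RT T n.+1 f) <= rT T * fn (tip n.+1) f by exact: RT_bound.
split.
- by rewrite mulr_ge0 ?hsq_ge0 ?(ltW (rT_gt0 q1)).
- exact: linop_creation.
- exact: linop_annL.
- by [].
- by move=> n f; apply: (cr_bound hstrict q1 st sT linop_lslice bA).
- by move=> n f; apply: (ann_bound hstrict q1 st sT linop_lslice bA (cr := creation a)).
- by move=> n f g; apply: (cr_ann_adjoint hstrict sT).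
Qed.

Lemma ladderR a : ladder T (creationR a) (annR a) (rT T * hsq (coord^~ a)).
Proof.
have sT n f g := tipTSr n f g br.
have st n f g := @tipSr R V n f g.
have bA n f : fn (tip n.+1) (RTr T n.+1 f) <= rT T * fn (tip n.+1) f by exact: RTr_bound.
split.
- by rewrite mulr_ge0 ?hsq_ge0 ?(ltW (rT_gt0 q1)).
- exact: linop_creationR.
- exact: linop_annR.
- by [].
- by move=> n f; apply: (cr_bound hstrict q1 st sT linop_rslice bA (rslice_creationR a)).
- by move=> n f; apply: (ann_bound hstrict q1 st sT linop_rslice bA (rslice_creationR a)).
- by move=> n f g; apply: (cr_ann_adjoint hstrict sT (rslice_creationR a)).
Qed.

Lemma fock_bounded A f : bounded_op T A -> fock f -> fock (A f).
Proof. by case=> H1 _ _ /H1. Qed.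

Lemma ladder_adjoint A B c f g : ladder T A B c -> fock f -> fock g ->
  fip (B f) g = fip f (A g).
Proof.
move=> L cf cg; have bA := ladder_bounded_l hstrict L.
have bB := ladder_bounded_r hstrict L.
rewrite (fip_conj hstrict cg (fock_bounded bB cf)) -(ladder_fip hstrict L) //.
by rewrite -(fip_conj hstrict (fock_bounded bA cg) cf).
Qed.

(** The annihilation operator is characterised as the adjoint of the creation
operator, hence it agrees with the explicit one on the Fock space. *)
Lemma annihilationP a : bounded_op T (annihilation form T a) /\
  forall f, fock f -> annihilation form T a f = annL a f.
Proof.
have L := ladderL a; have bB := ladder_bounded_r hstrict L.
have [bA adj] : bounded_op T (annihilation form T a) /\
    adjoint_op T (creation a) (annihilation form T a).
  apply: (@xgetPex {classic fop V} _
    [set B | bounded_op T B /\ adjoint_op T (creation a) B]).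
  by exists (annL a); split => // f g cf cg; apply: ladder_adjoint L _ _.
split=> // f cf; apply: (fip_separates hstrict) => n h hh.
have ch : fock h := homog_fock hh.
by rewrite adj // -(ladder_adjoint L).
Qed.

Definition fieldL (x : V) f : tens := fun w => creation x f w + annL (S x) f w.
(** Pairing the right creation by [x] with the right annihilation by [S* x],
rather than by [S x], is what makes these operators commute with all
[fieldL]. *)
Definition fieldR (x : V) f : tens := fun w => creationR x f w + annR (Sd x) f w.

Lemma creationR_fieldR x f : creationR x f = (fun w => -1 * annR (Sd x) f w + fieldR x f w).
Proof. by apply: funext => w; rewrite /fieldR mulN1r addrCA addNr addr0. Qed.

Lemma field_opE x f : fock f -> field_op form T H x f = fieldL x f.
Proof.
by move=> cf; rewrite /field_op; apply: funext => w; rewrite (annihilationP _).2.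
Qed.

Lemma linop_fieldL x : linop (fieldL x).
Proof.
move=> c f g; apply: funext => w.
rewrite /fieldL linop_creation linop_annL; ring.
Qed.

Lemma linop_fieldR x : linop (fieldR x).
Proof.
move=> c f g; apply: funext => w.
rewrite /fieldR linop_creationR linop_annR; ring.
Qed.

Lemma creation_creationR a b f : creation a (creationR b f) = creationR b (creation a f).
Proof.
apply: funext => w; case/lastP: w => [|w i] //; rewrite creationR_rcons.
case: w => [|j w] /=; first by rewrite !mulr0.
by rewrite creationR_rcons mulrCA.
Qed.

Lemma annL_annR a b f : annL a (annR b f) = annR b (annL a f).
Proof.
apply: funext => w; apply: (tipT_nondeg hstrict (n := size w)) => // h.
rewrite -!(ladder_adj (ladderL _)) -!(ladder_adj (ladderR _)).
by rewrite -(ladder_adj (ladderL _)) creation_creationR.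
Qed.

Lemma opTs_ext l f g (w : word) : (forall v, size v = size w -> f v = g v) ->
  opTs l f w = opTs l g w.
Proof.
elim: l w => [|j l IH] w fg /=; first exact: fg.
by apply: opT_ext => v sv; apply: IH => u su; rewrite fg // su.
Qed.

(** Only the longest product in [RT] reaches the last tensor factor, where the
created vector sits; it gives the correction term. *)
Lemma annL_creationR a b f (w : word) : annL a (creationR b f) w = creationR b (annL a f) w +
  \sum_i Num.conj (coord i a) * opTs (iota 0 (size w)) (creationR b f) (i :: w).
Proof.
rewrite {1}/annL /ann_side /lslice.
under eq_bigr do rewrite RT_opTs big_ord_recr /= mulrDr.
rewrite big_split /=; congr (_ + _).
case/lastP: w => [|w j].
  by rewrite big1 // => i _; rewrite big_ord0 mulr0.
rewrite creationR_rcons /annL /ann_side mulr_sumr; apply: eq_bigr => i _.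
rewrite mulrCA; congr (_ * _); rewrite size_rcons.
have E := @RT_rslice _ _ T (size w).+1 (creationR b f) j (i :: w) erefl.
rewrite rcons_cons RT_opTs in E; rewrite {}E rslice_creationR.
by rewrite (linopZ _ _ (linop_RT T _)).
Qed.

Lemma annR_creation a b f (w : word) :
  annR b (creation a f) w = creation a (annR b f) w +
  \sum_i Num.conj (coord i b) * opTs (desc 0 (size w)) (creation a f) (rcons w i).
Proof.
rewrite {1}/annR /ann_side /rslice.
under eq_bigr do rewrite /RTr big_ord_recl /= mulrDr.
rewrite big_split /= addrC; congr (_ + _).
case: w => [|j w].
  by rewrite big1 // => i _; rewrite big_ord0 mulr0.
rewrite /Defs.creation /annR /ann_side mulr_sumr; apply: eq_bigr => i _.
rewrite mulrCA; congr (_ * _).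
have E := RTr_lslice T (size w) (creation a f) j (rcons w i).
rewrite lslice_creation (linopZ _ _ (linop_RTr T _)) in E.
by rewrite /rslice E.
Qed.

Hypothesis lS : antilinear S.
Hypothesis iS : involutive S.
Hypothesis crossing : kernel_crossing form H T.
Local Notation s := (tomita_kernel form H).

Lemma kernel_suml a j : \sum_i s i j * coord i a = Num.conj (coord j (S a)).
Proof.
rewrite [in RHS](antilinear_expand form lS) /Defs.coord ip_sumr rmorph_sum.
apply: eq_bigr => i _ /=; rewrite ipZr rmorphM /= conjCK -ip_conj mulrC.
by [].
Qed.

Lemma kernel_sumr a i : \sum_j s i j * coord j a = Num.conj (coord i (Sd a)).
Proof.
rewrite /Defs.coord ip_antiadjoint // -ip_conj [in RHS](onb_expand form a) ip_sumr.
by apply: eq_bigr => j _; rewrite ipZr mulrC.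
Qed.

(** Both sides contract [a (x) f (x) b]. On the left, [b] is carried to the
front through all of [f] and contracted with [a]; on the right, [a] is
carried to the end and contracted with [b]. They agree by
[contraction_sweep]. *)
Lemma field_sweep a b f (w : word) :
  \sum_i Num.conj (coord i (S a)) * opTs (iota 0 (size w)) (creationR b f) (i :: w) =
  \sum_i Num.conj (coord i (Sd b)) * opTs (desc 0 (size w)) (creation a f) (rcons w i).
Proof.
set n := size w.
(* Only the component of [f] in degree [n] contributes; [contraction_sweep]
   needs a homogeneous tensor. *)
pose f' : tens := fun v => if size v == n then f v else 0.
have E1 i : opTs (iota 0 n) (creationR b f) (i :: w) = opTs (iota 0 n) (creationR b f') (i :: w).
  apply: opTs_ext; case/lastP => // v j; rewrite size_rcons /= => -[sv].
  by rewrite !creationR_rcons /f' sv eqxx.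
have E2 i : opTs (desc 0 n) (creation a f) (rcons w i) =
            opTs (desc 0 n) (creation a f') (rcons w i).
  apply: opTs_ext => -[|j v]; rewrite size_rcons //= => -[sv].
  by rewrite /f' sv eqxx.
under eq_bigr do rewrite E1; under [RHS]eq_bigr do rewrite E2.
pose F := creation a (creationR b f').
have hF : homog n.+2 F.
  move=> [|j v] //= sv; case/lastP: v sv => [|v k]; first by rewrite /creationR /= mulr0.
  rewrite size_rcons creationR_rcons !eqSS => /negPf sv.
  by rewrite /f' sv !mulr0.
have := congr1 (@^~ w) (contraction_sweep crossing hF).
rewrite [X in X = _ -> _](_ : _ =
  \sum_i Num.conj (coord i (S a)) * opTs (iota 0 n) (creationR b f') (i :: w)).
  move=> ->; rewrite -{1}[w]cats0 contractionE.
  rewrite -(pair_bigA _ (fun i j => s i j * opTs (desc 0 n) F (w ++ [:: i; j]))) /=.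
  apply: eq_bigr => i _; rewrite -kernel_sumr mulr_suml; apply: eq_bigr => j _.
  rewrite -mulrA; congr (_ * _).
  rewrite -cat_rcons cats1 (@opTs_rcons _ _ _ n.+1); first last.
  - by rewrite size_rcons.
  - by apply/allP => k; rewrite mem_rev mem_iota => kP; lia.
  by rewrite /F creation_creationR rslice_creationR (linopZ _ _ (linop_opTs T _)).
rewrite (contractionE form H [::] w).
rewrite -(pair_bigA _ (fun i j => s i j * opTs (iota 1 n) F ([::] ++ [:: i, j & w]))) /=.
rewrite exchange_big; apply: eq_bigr => j _ /=.
rewrite -kernel_suml mulr_suml; apply: eq_bigr => i _; rewrite -mulrA; congr (_ * _).
rewrite -map_iota_S opTs_cons lslice_creation.
by rewrite (linopZ _ _ (linop_opTs T _)).
Qed.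

(** Creations on different sides commute, and so do their adjoints. A creation
on one side commutes with an annihilation on the other up to a term that
carries a vector through all tensor factors, and the two such terms cancel
by [field_sweep]. *)
Lemma fieldL_fieldR x y f : fieldL x (fieldR y f) = fieldR y (fieldL x f).
Proof.
rewrite {1}/fieldL {1}/fieldR.
rewrite (linopD _ _ (linop_creation _)) (linopD _ _ (linop_annL _)).
rewrite {1}/fieldR {1}/fieldL.
rewrite (linopD _ _ (linop_creationR _)) (linopD _ _ (linop_annR _)).
apply: funext => w; rewrite annL_annR creation_creationR annL_creationR annR_creation.
rewrite field_sweep; ring.
Qed.

End Fields.

(** * The vacuum separates the left algebra *)

Section LeftAlgebra.
Variables (R : realType) (V : vectType (Cx R)).
Local Notation C := (Cx R).
Local Notation d := (\dim {:V}).
Local Notation tens := (tens V).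
Variables (form : {dot V for Num.conj}) (H : set V) (T : square_op V).
Local Notation tipT := (tipT T).
Local Notation fock := (fock T).
Local Notation fip := (fip T).
Local Notation fnorm := (fnorm T).
Local Notation bounded_op := (bounded_op T).
Local Notation commutant := (commutant T).
Local Notation e := (tnth (onb form)).
Local Notation coord := (Defs.coord form).
Local Notation S := (tomita H).
Local Notation Sd := (antiadjoint form (tomita H)).
Implicit Types f g h : tens.

Hypothesis hstrict : strict_twist T.
Let tpsd n : psd_form (tipT n) := tipT_psd hstrict n.

Definition nsq f : R := ssum (fun n => qf (tipT n) f).

Lemma nsq_ge0 f : fock f -> 0 <= nsq f.
Proof. by move=> cf; apply: ssum_ge0 => // n; exact: (qf_ge0 (tpsd n)). Qed.

Lemma bounded_opP A : bounded_op A <->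
  [/\ forall f, fock f -> fock (A f),
      forall (a : C) f g, fock f -> fock g ->
        A (fun w => a * f w + g w) = (fun w => a * A f w + A g w) &
      exists2 M : R, 0 <= M & forall f, fock f -> nsq (A f) <= M * nsq f].
Proof.
split=> -[cA lA [M]].
  move=> bA; split=> //; exists (M ^+ 2); first exact: sqr_ge0.
  move=> f cf; have := bA f cf; rewrite /Defs.fnorm.
  rewrite -[complex.Re (fip f f)]/(nsq f) -[complex.Re _]/(nsq (A f)).
  have h : 0 <= M * Num.sqrt (nsq f) \/ M * Num.sqrt (nsq f) < 0.
    by case: ltP; [right|left].
  case: h => h le; last first.
    by exfalso; have := le_lt_trans le h; rewrite ltNge sqrtr_ge0.
  move: le; rewrite -ler_sqr ?nnegrE ?sqrtr_ge0 // exprMn.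
  by rewrite !sqr_sqrtr ?nsq_ge0 //; apply: cA.
move=> M0 bA; split=> //; exists (Num.sqrt M) => f cf.
by apply: fnorm_le => //; [apply: cA|exact: bA].
Qed.

Lemma nsq_lin_le (a : C) f g : fock f -> fock g ->
  nsq (fun w => a * f w + g w) <=
  3 * (complex.Re a ^+ 2 + complex.Im a ^+ 2) * nsq f + 3 * nsq g.
Proof.
move=> cf cg; set k := 3 * _.
have [cgg e1] := summ_lin 2 cg cg.
have [cfg e2] := summ_lin k cf cgg.
have := ssum_le (fock_lin hstrict cf cg) cfg (fun n => qf_lin_le hstrict n a f g).
rewrite e2 e1 => le; apply: le_trans le _.
have -> : ssum (fun n => complex.Re (tipT n g g)) = nsq g by [].
have -> : ssum (fun n => complex.Re (tipT n f f)) = nsq f by [].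
rewrite -/k; lra.
Qed.

Lemma bounded_op_lin (a : C) A B : bounded_op A -> bounded_op B ->
  bounded_op (fun f w => a * A f w + B f w).
Proof.
move=> /bounded_opP[cA lA [M M0 bA]] /bounded_opP[cB lB [N N0 bB]].
apply/bounded_opP; split.
- by move=> f cf; apply: (fock_lin hstrict); [apply: cA|apply: cB].
- move=> c f g cf cg; apply: funext => w; rewrite lA // lB //; ring.
- pose k : R := 3 * (complex.Re a ^+ 2 + complex.Im a ^+ 2).
  have k0 : 0 <= k by rewrite mulr_ge0 // addr_ge0 ?sqr_ge0.
  exists (k * M + 3 * N); first by rewrite addr_ge0 // mulr_ge0 //; exact: ltW.
  move=> f cf; apply: le_trans (nsq_lin_le _ (cA _ cf) (cB _ cf)) _.
  have hA := bA f cf; have hB := bB f cf.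
  apply: (@le_trans _ _ (k * (M * nsq f) + 3 * (N * nsq f))).
    by rewrite -/k; apply: lerD; rewrite ler_wpM2l.
  by rewrite le_eqVlt; apply/orP; left; apply/eqP; ring.
Qed.

Lemma bounded_op_comp A B : bounded_op A -> bounded_op B -> bounded_op (A \o B).
Proof.
move=> /bounded_opP[cA lA [M M0 bA]] /bounded_opP[cB lB [N N0 bB]].
apply/bounded_opP; split.
- by move=> f cf; apply: cA; apply: cB.
- by move=> c f g cf cg; rewrite /= lB // lA //; exact: cB.
- exists (M * N) => [|f cf]; first by rewrite mulr_ge0.
  apply: le_trans (bA _ (cB _ cf)) _; rewrite -mulrA ler_wpM2l //; exact: bB.
Qed.

Lemma bounded_op_id : bounded_op id.
Proof. by apply/bounded_opP; split=> //; exists 1 => // f _; rewrite mul1r. Qed.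

Lemma bounded_op0 : bounded_op (fun _ _ => 0).
Proof.
apply/bounded_opP; split.
- by move=> f _; exact: fock0.
- by move=> a f g _ _; apply: funext => w; rewrite mulr0 addr0.
- exists 0 => // f cf; rewrite mul0r /nsq.
  have [_ ->] := @ssum_single _ (fun n => qf (tipT n) (fun=> 0)) 0%N
    (fun k _ => congr1 (@complex.Re R) (psd0r (tpsd k) _)).
  by rewrite /qf (psd0r (tpsd _)).
Qed.

Lemma bounded_op_eq A B : bounded_op A -> (forall f, fock f -> A f = B f) ->
  bounded_op B.
Proof.
move=> /bounded_opP[cA lA [M M0 bA]] AB; apply/bounded_opP; split.
- by move=> f cf; rewrite -AB //; apply: cA.
- by move=> c f g cf cg; rewrite -!AB ?lA //; apply: (fock_lin hstrict).
- by exists M => // f cf; rewrite -AB //; apply: bA.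
Qed.

Section Commutants.
Variable M : set (fop V).
Hypothesis bM : M `<=` bounded_op.

Lemma commutant_eq A B : commutant M A -> (forall f, fock f -> A f = B f) ->
  commutant M B.
Proof.
move=> [bA cA] AB; split; first exact: bounded_op_eq bA AB.
move=> D MD f cf; rewrite -!AB ?cA //.
exact: fock_bounded (bM MD) cf.
Qed.

Lemma commutant_lin (a : C) A B : commutant M A -> commutant M B ->
  commutant M (fun f w => a * A f w + B f w).
Proof.
move=> [bA cA] [bB cB]; split; first exact: bounded_op_lin.
move=> D MD f cf; have [_ lD _] := bM MD.
by rewrite lD ?cA ?cB //; [exact: fock_bounded bA cf|exact: fock_bounded bB cf].
Qed.

Lemma commutant_comp A B : commutant M A -> commutant M B -> commutant M (A \o B).
Proof.
move=> [bA cA] [bB cB]; split; first exact: bounded_op_comp.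
move=> D MD f cf; have cBf := fock_bounded bB cf; have [fD _ _] := bM MD.
by rewrite /= cA // cB.
Qed.

Lemma commutant_id : commutant M id.
Proof. by split; first exact: bounded_op_id. Qed.

Lemma commutant0 : commutant M (fun _ _ => 0).
Proof.
split; first exact: bounded_op0.
move=> D MD f cf; have [_ lD _] := bM MD.
have := lD (-1) (fun=> 0) (fun=> 0) (@fock0 _ _ T) (@fock0 _ _ T).
rewrite (_ : (fun w => _) = (fun=> 0)); last by apply: funext => w; rewrite mulr0 addr0.
by move=> ->; apply: funext => w; rewrite mulN1r addNr.
Qed.

Lemma commutant_bounded : commutant M `<=` bounded_op.
Proof. by move=> A []. Qed.

End Commutants.

Lemma commutant_triple M : M `<=` bounded_op ->
  commutant (commutant (commutant M)) = commutant M.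
Proof.
move=> bM; apply/seteqP; split=> A [bA cA]; split=> // B.
  move=> MB f cf; apply: cA => //; split; first exact: bM.
  by move=> D [bD cD] g cg; rewrite cD.
by move=> [bB cB] f cf; rewrite cB.
Qed.

(** The truncations of [f] to finitely many degrees converge to [f], so that a
bounded operator that vanishes on homogeneous tensors vanishes on [f]. *)
Lemma bounded_op_dense D : bounded_op D ->
  (forall n f, homog n f -> D f = (fun=> 0)) -> forall f, fock f -> D f = (fun=> 0).
Proof.
move=> /bounded_opP[cD lD [M M0 bD]] D0 f cf.
pose tr N : tens := fun w => if (size w < N)%N then f w else 0.
pose pr N : tens := fun w => if (size w == N)%N then f w else 0.
have hpr N : homog N (pr N) by move=> w /negPf sw; rewrite /pr sw.
have trS N : tr N.+1 = fun w => 1 * tr N w + pr N w.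
  apply: funext => w; rewrite /tr /pr ltnS leq_eqVlt mul1r.
  by case: ltngtP; rewrite ?addr0 ?add0r.
have ctr N : fock (tr N) /\ D (tr N) = (fun=> 0).
  elim: N => [|N [IH1 IH2]].
    rewrite (_ : tr 0%N = fun=> 0); last by apply: funext.
    by split; [exact: fock0|apply: (D0 0%N) => w].
  have cp : fock (pr N) := homog_fock (hpr N).
  rewrite trS; split; first exact: fock_lin.
  rewrite lD // IH2 (D0 N _ (hpr N)); apply: funext => w.
  by rewrite mulr0 addr0.
have tailE N : (fun w => -1 * tr N w + f w) =
    (fun w => if (size w < N)%N then 0 else f w).
  by apply: funext => w; rewrite /tr; case: ifP; rewrite ?mulN1r ?addNr // oppr0 add0r.
have small eps : 0 < eps -> nsq (D f) <= M * eps.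
  move=> e0; have [N tN] := ssum_tail cf e0.
  have [cN DN] := ctr N.
  have -> : D f = D (fun w => -1 * tr N w + f w).
    by rewrite lD // DN; apply: funext => w; rewrite mulr0 add0r.
  have ct := fock_lin hstrict cN cf (a := -1).
  apply: le_trans (bD _ ct) _; rewrite ler_wpM2l //.
  have [_ e1] := ssum_tailE N cf.
  apply: ltW; apply: le_lt_trans tN; rewrite -e1 le_eqVlt; apply/orP; left.
  apply/eqP; rewrite tailE /nsq; congr ssum; apply: funext => n.
  case: ltnP => nN.
    by rewrite /qf tipT0 // => w ->; rewrite nN.
  rewrite /qf; congr (complex.Re _); apply: eq_tipT => w ->;
  by rewrite ltnNge nN.
have le0 : nsq (D f) <= 0.
  rewrite leNgt; apply/negP => pos.
  have M1 : 0 < M + 1 by rewrite ltr_wpDl.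
  have := small (nsq (D f) / (M + 1)) (divr_gt0 pos M1).
  rewrite mulrA ler_pdivlMr // mulrDr mulr1 mulrC.
  by rewrite gerDl leNgt pos.
have z := ssum_eq0 (cD _ cf) (fun n => qf_ge0 (tpsd n) (D f)) le0.
apply: funext => w; apply/eqP; apply: contraT => Dw.
have : 0 < tipT (size w) (D f) (D f) by apply: tipT_gt0 => //; exists w.
move=> /cxgt0[_].
by rewrite z ltxx.
Qed.

Hypothesis br : braided T.
Hypothesis q1 : square_op_norm T < 1.
Hypothesis lS : antilinear S.
Hypothesis iS : involutive S.
Hypothesis crossing : kernel_crossing form H T.
Local Notation fieldL := (fieldL form H T).
Local Notation fieldR := (fieldR form H T).

Lemma bounded_ladder_sum A B A' B' c c' : ladder T A B c -> ladder T A' B' c' ->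
  bounded_op (fun f w => A f w + B' f w).
Proof.
move=> L L'; have bA := ladder_bounded_l hstrict L.
have bB := ladder_bounded_r hstrict L'.
apply: bounded_op_eq (bounded_op_lin 1 bA bB) _ => f cf.
by apply: funext => w; rewrite mul1r.
Qed.

Lemma bounded_fieldL x : bounded_op (fieldL x).
Proof. exact: bounded_ladder_sum (ladderL form hstrict q1 x) (ladderL form hstrict q1 (S x)). Qed.

Lemma bounded_fieldR x : bounded_op (fieldR x).
Proof.
exact: bounded_ladder_sum (ladderR form hstrict br q1 x)
  (ladderR form hstrict br q1 (Sd x)).
Qed.

Lemma bounded_field_op x : bounded_op (field_op form T H x).
Proof.
apply: bounded_op_eq (bounded_fieldL x) _ => f cf.
by rewrite field_opE.
Qed.

Lemma fip_addl f g h : fock f -> fock g -> fock h ->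
  fip (fun w => g w + h w) f = fip g f + fip h f.
Proof.
move=> cf cg ch; have -> : (fun w => g w + h w) = (fun w => 1 * g w + h w).
  by apply: funext => w; rewrite mul1r.
by rewrite fip_linl // rmorph1 mul1r.
Qed.

Lemma fip_addr f g h : fock f -> fock g -> fock h ->
  fip f (fun w => g w + h w) = fip f g + fip f h.
Proof.
move=> cf cg ch; have -> : (fun w => g w + h w) = (fun w => 1 * g w + h w).
  by apply: funext => w; rewrite mul1r.
by rewrite fip_lin // mul1r.
Qed.

Lemma fieldR_adjoint x f g : fock f -> fock g ->
  fip (fieldR x f) g = fip f (fieldR (Sd x) g).
Proof.
move=> cf cg.
have L y := ladderR form hstrict br q1 y.
have bl y := ladder_bounded_l hstrict (L y).
have brr y := ladder_bounded_r hstrict (L y).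
have iSd : Sd (Sd x) = x by apply: antiadjoint_involutive.
rewrite fip_addl //; [|exact: fock_bounded (bl _) _|exact: fock_bounded (brr _) _].
rewrite fip_addr //; [|exact: fock_bounded (bl _) _|exact: fock_bounded (brr _) _].
rewrite iSd (ladder_fip hstrict (L x)) // (ladder_adjoint hstrict (L (Sd x))) //.
by rewrite addrC.
Qed.

Definition right_fields : set (fop V) := [set fieldR x | x in setT].

Lemma right_fields_bounded : right_fields `<=` bounded_op.
Proof. by move=> _ [x _ <-]; exact: bounded_fieldR. Qed.

(** The right fields are closed under adjoints, the adjoint of [fieldR x] being
[fieldR (S* x)]. *)
Lemma von_neumann_right_commutant : von_neumann T (commutant right_fields).
Proof.
have bR := right_fields_bounded.
split; [exact: commutant_bounded| |exact: commutant_triple].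
move=> A B [bA cA] bB adj; split=> // _ [x _ <-] f cf.
have rx y : right_fields (fieldR y) by exists y.
have fR y g : fock g -> fock (fieldR y g).
  by move=> cg; exact: fock_bounded (bounded_fieldR y) cg.
apply: (fip_separates hstrict) => n h hh; have ch : fock h := homog_fock hh.
have cB g : fock g -> fock (B g) by move=> cg; exact: fock_bounded bB cg.
have cA' g : fock g -> fock (A g) by move=> cg; exact: fock_bounded bA cg.
rewrite (fieldR_adjoint x (cB _ cf) ch) (adj _ _ cf (fR _ _ ch)).
rewrite -(cA _ (rx (Sd x)) _ ch) -(fieldR_adjoint x cf (cA' _ ch)).
by rewrite (adj _ _ (fR _ _ cf) ch).
Qed.

Lemma left_algebra_commutes A : left_algebra form T H A -> commutant right_fields A.
Proof.
move=> /(_ _ von_neumann_right_commutant); apply => _ [x _ <-].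
split; first exact: bounded_field_op.
move=> _ [y _ <-] f cf; rewrite !field_opE //.
  by rewrite fieldL_fieldR.
exact: fock_bounded (bounded_fieldR y) cf.
Qed.

Lemma annR_homog n x f : homog n.+1 f -> homog n (annR form T x f).
Proof.
move=> hf w sw; rewrite /annR /ann_side big1 // => i _.
have -> : rslice i (RTr T (size w).+1 f) w = 0; last by rewrite mulr0.
rewrite /rslice /RTr big1 // => j _.
by rewrite (@opTs_homog _ _ T _ _ _ hf) // size_rcons eqSS.
Qed.

Lemma annR0 x f : homog 0 f -> annR form T x f = (fun=> 0).
Proof.
move=> hf; apply: funext => w; rewrite /annR /ann_side big1 // => i _.
have -> : rslice i (RTr T (size w).+1 f) w = 0; last by rewrite mulr0.
rewrite /rslice /RTr big1 // => j _.
by rewrite (@opTs_homog _ _ T _ _ _ hf) // size_rcons.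
Qed.

(** The right fields create all tensors from the vacuum, degree by degree, and
[D] commutes with them. *)
Lemma commutant_separating D : commutant right_fields D ->
  D (vacuum form) = (fun=> 0) -> forall f, fock f -> D f = (fun=> 0).
Proof.
move=> [bD cD] D0; have [fD lD _] := bD.
apply: bounded_op_dense => // n.
have lD0 : D (fun=> 0) = (fun=> 0).
  have [_ c0] := commutant0 (fun A (MA : [set D] A) => eq_ind _ bounded_op bD A (esym MA)).
  exact: (c0 D erefl (fun=> 0) (@fock0 _ _ T)).
suff H2 : (forall f, homog n f -> D f = (fun=> 0)) /\
     (forall f, homog n.+1 f -> D f = (fun=> 0)) by case: H2.
have rec m : (forall f, homog m f -> D f = (fun=> 0)) ->
    (forall x f, homog m f -> D (annR form T x f) = (fun=> 0)) ->
    forall f, homog m.+1 f -> D f = (fun=> 0).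
  move=> H1 H2 f hf.
  have hs i : homog m (rslice i f).
    by move=> w sw; rewrite /rslice hf // size_rcons eqSS.
  have Dcr i g : homog m g -> D (creationR form (e i) g) = (fun=> 0).
    move=> hg; have cg : fock g := homog_fock hg.
    have bl := ladder_bounded_l hstrict (ladderR form hstrict br q1 (e i)).
    have brr := ladder_bounded_r hstrict (ladderR form hstrict br q1 (Sd (e i))).
    have cc := fock_bounded bl cg; have ca := fock_bounded brr cg.
    rewrite (creationR_fieldR form H T).
    rewrite lD //; last exact: fock_bounded (bounded_fieldR _) cg.
    rewrite H2 //.
    rewrite -(cD (fieldR (e i)) (ex_intro2 _ _ (e i) I erefl)) // H1 //.
    have := linop0 (linop_fieldR form H T (e i)) => ->.
    by apply: funext => w; rewrite mulr0 addr0.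
  have -> : f = fun w => \sum_i creationR form (e i) (rslice i f) w.
    apply: funext; case/lastP => [|w j].
      by rewrite hf // big1 // => i _.
    rewrite (bigD1 j) //= creationR_rcons /Defs.coord ip_onb eqxx mul1r big1 ?addr0 //.
    by move=> i ij; rewrite creationR_rcons /Defs.coord ip_onb eq_sym (negPf ij) mul0r.
  have cs : forall i : 'I_d, fock (creationR form (e i) (rslice i f)).
    move=> i; have bl := ladder_bounded_l hstrict (ladderR form hstrict br q1 (e i)).
    exact: fock_bounded bl (homog_fock (hs i)).
  elim: (index_enum _) => [|i r IH].
    by rewrite -lD0; congr D; apply: funext => w; rewrite big_nil.
  rewrite (_ : (fun w => _) = (fun w => 1 * creationR form (e i) (rslice i f) w +
      \sum_(j <- r) creationR form (e j) (rslice j f) w)); last first.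
    by apply: funext => w; rewrite big_cons mul1r.
  rewrite lD //; last by apply: fock_sum.
  by rewrite IH Dcr //; apply: funext => w; rewrite mulr0 addr0.
elim: n => [|n [IH1 IH2]]; last first.
  split=> //; apply: rec => // x f hf; apply: IH1.
  exact: annR_homog.
have H0 f : homog 0 f -> D f = (fun=> 0).
  move=> hf; have -> : f = fun w => f [::] * vacuum form w + 0.
    apply: funext => -[|i w]; first by rewrite /vacuum /= mulr1 addr0.
    by rewrite hf // /vacuum /= mulr0 addr0.
  rewrite (lD _ _ _ _ (@fock0 _ _ T)) ?D0 ?lD0.
    by apply: funext => w; rewrite mulr0 addr0.
  by apply: (@homog_fock _ _ T 0) => -[].
split=> //; apply: rec => // x f hf.
by rewrite annR0.
Qed.

(** Operators of the left algebra commute with the right fields, so their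
difference is covered by [commutant_separating]. *)
Lemma left_algebra_unique A A' : left_algebra form T H A -> left_algebra form T H A' ->
  A (vacuum form) = A' (vacuum form) -> forall f, fock f -> A f = A' f.
Proof.
move=> /left_algebra_commutes cA /left_algebra_commutes cA' AA' f cf.
have bR := right_fields_bounded.
have H0 : (fun w => -1 * A' (vacuum form) w + A (vacuum form) w) = (fun=> 0).
  by apply: funext => w; rewrite AA' mulN1r addNr.
have /(_ _ cf) H1 := commutant_separating (commutant_lin bR (-1) cA' cA) H0.
apply: funext => w; have /(congr1 (@^~ w)) := H1.
by rewrite mulN1r addrC => /eqP; rewrite subr_eq0 => /eqP.
Qed.

End LeftAlgebra.

(** * The Wick recursion *)

Section WickRecursion.
Variables (R : realType) (V : vectType (Cx R)).
Local Notation C := (Cx R).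
Local Notation d := (\dim {:V}).
Local Notation tens := (tens V).
Local Notation word := (word V).
Variables (form : {dot V for Num.conj}) (H : set V) (T : square_op V).
Local Notation opTs := (opTs T).
Local Notation fock := (fock T).
Local Notation e := (tnth (onb form)).
Local Notation coord := (Defs.coord form).
Local Notation S := (tomita H).
Local Notation ctr := (Defs.contraction form H).
Local Notation fldL := (fieldL form H T).
Implicit Types f g h t : tens.

(** The signed sum over the incomplete matchings of the last [n] tensor factors,
the first [k] factors being left alone, organised by the partner of the first
of these [n] factors. *)
Fixpoint Qop (n k : nat) t : tens :=
  if n is m.+1 then fun w => Qop m k.+1 t w -
    (if m is l.+1 then
       \sum_(j < m) Qop l k (ctr k (opTs (iota k.+1 j) t)) w else 0)
  else t.

Lemma QopSS l k t (w : word) : Qop l.+2 k t w = Qop l.+1 k.+1 t w -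
  \sum_(j < l.+1) Qop l k (ctr k (opTs (iota k.+1 j) t)) w.
Proof. by []. Qed.

Lemma Qop1 k t : Qop 1 k t = t.
Proof. by apply: funext => w /=; rewrite subr0. Qed.

Lemma Qop_lslice n k i t : lslice i (Qop n k.+1 t) = Qop n k (lslice i t).
Proof.
elim/ltn_ind: n k t => -[|[|l]] IH k t; rewrite ?Qop1 //.
apply: funext => w; rewrite {1}/lslice !QopSS.
have -> : Qop l.+1 k.+2 t (i :: w) = Qop l.+1 k.+1 (lslice i t) w.
  by rewrite -IH.
congr (_ - _); apply: eq_bigr => j _.
rewrite -[LHS]/(lslice i _ w) IH //; congr (Qop l k _ w).
apply: funext => v; rewrite /lslice contraction_cons.
congr (ctr k _ v); apply: funext => u.
by rewrite /lslice -map_iota_S opTs_cons.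
Qed.

Lemma contraction_opTs_homog l k j t : homog (l.+2 + k) t ->
  homog (l + k) (ctr k (opTs (iota k.+1 j) t)).
Proof.
move=> ht; rewrite (_ : (l + k = l.+2 + k - 2)%N); last by lia.
by apply: contraction_homog; [lia|apply: opTs_homog].
Qed.

Lemma Qop_low n k t (w : word) : homog (n + k) t -> (size w < k)%N -> Qop n k t w = 0.
Proof.
elim/ltn_ind: n k t w => -[|[|l]] IH k t w ht wk; rewrite ?Qop1.
- by apply: ht; lia.
- by apply: ht; lia.
rewrite QopSS IH //; [|by rewrite addnS|by lia].
rewrite big1 ?subr0 // => j _; apply: IH => //.
exact: contraction_opTs_homog.
Qed.

Lemma Qop_high n k t (w : word) : homog (n + k) t -> (n + k < size w)%N -> Qop n k t w = 0.
Proof.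
elim/ltn_ind: n k t w => -[|[|l]] IH k t w ht wk; rewrite ?Qop1.
- by apply: ht; lia.
- by apply: ht; lia.
rewrite QopSS IH //; [|by rewrite addnS|by lia].
rewrite big1 ?subr0 // => j _; apply: IH => //; last by lia.
exact: contraction_opTs_homog.
Qed.

(** [Gf N t] applies to the vacuum the polynomial in the field operators that
has the coefficients of [t] in the degrees up to [N]. *)
Fixpoint Gf (N : nat) t : tens := fun v => t [::] * vacuum form v +
  (if N is M.+1 then \sum_i fldL (e i) (Gf M (lslice i t)) v else 0).

Lemma linop_Gf N : linop (Gf N).
Proof.
elim: N => [|N IH] a f g; apply: funext => v /=; first by ring.
have -> : \sum_i fldL (e i) (Gf N (lslice i (fun w => a * f w + g w))) v =
  \sum_i (a * fldL (e i) (Gf N (lslice i f)) v + fldL (e i) (Gf N (lslice i g)) v).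
  by apply: eq_bigr => i _; rewrite linop_lslice IH linop_fieldL.
rewrite big_split /= -mulr_sumr; ring.
Qed.

Lemma coord_onb i j : coord i (e j) = (i == j)%:R.
Proof. by rewrite /Defs.coord ip_onb. Qed.

Lemma sum_creation n t : homog n.+1 t ->
  (fun v => \sum_i creation form (e i) (lslice i t) v) = t.
Proof.
move=> ht; apply: funext => -[|j v] /=.
  by rewrite big1 // ht.
rewrite (bigD1 j) //= coord_onb eqxx mul1r big1 ?addr0 // => i ij.
by rewrite coord_onb eq_sym (negPf ij) mul0r.
Qed.

Lemma RT_homog n m f : homog n f -> homog n (RT T m f).
Proof.
move=> hf w sw; rewrite RT_opTs big1 // => k _.
by rewrite (@opTs_homog _ _ T _ _ _ hf).
Qed.

(** The [j]-th summand of [RT] brings the [j]-th of the remaining factors to the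
front, where annihilation contracts it with the first factor. *)
Lemma sum_annL m t v : homog m.+1 t ->
  \sum_i annL form T (S (e i)) (lslice i t) v =
  \sum_(j < m) ctr 0 (opTs (iota 1 j) t) v.
Proof.
move=> ht.
have hl i : homog m (lslice i t) by move=> w sw; rewrite /lslice ht.
have [sv|sv] := eqVneq (size v).+1 m; last first.
  rewrite big1 => [|i _]; last first.
    rewrite /annL /ann_side big1 // => j _.
    by rewrite /lslice (RT_homog _ (hl i)) ?mulr0.
  rewrite big1 // => j _; rewrite /Defs.contraction big1 // => p _.
  rewrite (@opTs_homog _ _ T _ _ _ ht) ?mulr0 //= take0 drop0 /=.
  by apply: contra sv => /eqP; lia.
rewrite /annL /ann_side sv.
transitivity (\sum_i \sum_b \sum_(j < m)
   tomita_kernel form H i b * opTs (iota 0 j) (lslice i t) (b :: v)).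
  apply: eq_bigr => i _; apply: eq_bigr => b _.
  rewrite /lslice RT_opTs -mulr_sumr; congr (_ * _).
  by rewrite /Defs.coord /tomita_kernel -ip_conj.
rewrite pair_bigA exchange_big /=; apply: eq_bigr => j _.
rewrite /Defs.contraction take0 drop0 /=; apply: eq_bigr => p _.
by rewrite -map_iota_S opTs_cons.
Qed.

Lemma Gf_0 N : Gf N (fun=> 0) = (fun=> 0).
Proof. exact: linop0 (linop_Gf N). Qed.

(** Induction on the degree. The field operators applied to the first factor
create it, or contract it with one of the others as in [sum_annL]; the sum
over partners in [Qop] subtracts exactly these contractions. *)
Lemma Gf_Qop N n t : (n <= N)%N -> homog n t -> Gf N (Qop n 0 t) = t.
Proof.
elim/ltn_ind: n N t => -[|m] IH N t nN ht.
  have -> : Qop 0 0 t = t by [].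
  have l0 i : lslice i t = fun=> 0 by apply: funext => w; rewrite /lslice ht.
  apply: funext => v; case: N nN => [|N] _ /=.
    rewrite addr0; case: v => [|i v]; first by rewrite /vacuum /= mulr1.
    by rewrite [RHS]ht // /vacuum /= mulr0.
  rewrite big1 => [|i _]; last by rewrite l0 Gf_0 (linop0 (linop_fieldL _ _ _ _)).
  rewrite addr0; case: v => [|i v]; first by rewrite /vacuum /= mulr1.
  by rewrite [RHS]ht // /vacuum /= mulr0.
case: N nN => // N nN.
have H1 : Gf N.+1 (Qop m 1 t) = fun v => t v +
    \sum_(j < m) ctr 0 (opTs (iota 1 j) t) v.
  apply: funext => v /=.
  rewrite Qop_low ?mul0r ?add0r //; last by rewrite addn1.
  transitivity (\sum_i fldL (e i) (lslice i t) v).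
    apply: eq_bigr => i _; rewrite Qop_lslice IH //.
    by move=> w sw; rewrite /lslice ht.
  rewrite /fieldL big_split /= -(@sum_annL m) //; congr (_ + _).
  by rewrite -[in RHS](sum_creation ht).
have -> : Qop m.+1 0 t = fun w => -1 * (if m is l.+1 then
       \sum_(j < m) Qop l 0 (ctr 0 (opTs (iota 1 j) t)) w else 0) + Qop m 1 t w.
  by apply: funext => w; rewrite mulN1r addrC.
rewrite linop_Gf H1; apply: funext => v; case: m IH ht nN {H1} => [|l] IH ht nN.
  by rewrite Gf_0 big_ord0 mulr0 add0r addr0.
rewrite (linop_sum _ _ _ (linop_Gf N.+1)).
rewrite mulN1r [t v + _]addrC addrA (_ : - _ + _ = 0) ?add0r //.
apply/eqP; rewrite addrC subr_eq0; apply/eqP; apply: eq_bigr => j _.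
rewrite IH //; first by lia.
by have := @contraction_opTs_homog l 0 j t; rewrite !addn0; exact.
Qed.

Hypothesis hstrict : strict_twist T.
Hypothesis q1 : square_op_norm T < 1.

Lemma fock_field_op x f : fock f -> fock (field_op form T H x f).
Proof. exact: fock_bounded (bounded_field_op form H hstrict q1 x). Qed.

Lemma fock_field_word w f : fock f -> fock (field_word form T H w f).
Proof.
by move=> cf; elim: w => [|i w IH] //=; exact: fock_field_op.
Qed.

Lemma fock_vacuum : fock (vacuum form).
Proof. by apply: (@homog_fock _ _ T 0) => -[]. Qed.

Definition field_sum (N : nat) t : fop V := fun f v =>
  \sum_(k < N.+1) wsum k (fun w => t w * field_word form T H w f v).

Lemma field_sumS N t f v : fock f -> field_sum N.+1 t f v = t [::] * f v +
  \sum_i fldL (e i) (field_sum N (lslice i t) f) v.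
Proof.
move=> cf; rewrite /field_sum big_ord_recl wsum0 /=; congr (_ + _).
transitivity (\sum_i \sum_(k < N.+1) wsum k
   (fun w => t (i :: w) * fldL (e i) (field_word form T H w f) v)).
  rewrite exchange_big; apply: eq_bigr => k _; rewrite wsumS.
  apply: eq_bigr => i _; apply: eq_wsum => w _ /=.
  by rewrite (field_opE form H hstrict q1) //; exact: fock_field_word.
apply: eq_bigr => i _; rewrite (linop_sum _ _ _ (linop_fieldL _ _ _ _)).
apply: eq_bigr => k _; rewrite /wsum (linop_sum _ _ _ (linop_fieldL _ _ _ _)).
by apply: eq_bigr => w _; rewrite (linopZ _ _ (linop_fieldL _ _ _ _)).
Qed.

Lemma field_sum_vacuum N t : field_sum N t (vacuum form) = Gf N t.
Proof.
elim: N t => [|N IH] t; apply: funext => v.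
  by rewrite /field_sum big_ord1 wsum0 /= addr0.
by rewrite (field_sumS _ _ _ fock_vacuum) /=; congr (_ + _); apply: eq_bigr => i _; rewrite IH.
Qed.

(** A tensor of bounded degree has finitely many coefficients, so that the sum
over all words is a finite one. *)
Lemma field_mapE N t : (forall w : word, (N < size w)%N -> t w = 0) ->
  field_map form T H t = field_sum N t.
Proof.
move=> tN; apply: funext => f; apply: funext => v; rewrite /field_map.
set F := fun w => t w * field_word form T H w f v.
pose s := flatten [seq [seq val w | w : k.-tuple 'I_d] | k <- iota 0 N.+1].
have ms w : (w \in s) = (size w <= N)%N.
  apply/flatten_mapP/idP => [[k]|wN].
    by rewrite mem_iota => /andP[_ kN] /mapP[u _ ->]; rewrite size_tuple; lia.
  exists (size w); first by rewrite mem_iota; lia.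
  by apply/mapP; exists (in_tuple w); rewrite ?mem_enum.
have us : uniq s.
  rewrite /s; elim: (iota 0 N.+1) (iota_uniq 0 N.+1) => //= k r IH /andP[kr ur].
  rewrite cat_uniq IH // andbT (map_inj_uniq val_inj) enum_uniq /=.
  apply/hasPn => w /flatten_mapP[j jr /mapP[u _ ->]].
  apply/negP => /mapP[u' _ uu']; move: kr; apply/negP/negPn.
  by rewrite -(size_tuple u') -uu' size_tuple.
transitivity (\sum_(w \in [set` s]) F w).
  apply: esym; apply: fsbig_widen => // w [_] /= /negP ws.
  by rewrite /F tN ?mul0r // ltnNge -ms.
rewrite -fsbig_seq // /s big_flatten big_map /field_sum -(big_mkord xpredT
  (fun k => wsum k F)) /index_iota subn0.
by apply: eq_bigr => k _; rewrite big_map /wsum big_enum.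
Qed.

Hypothesis lS : antilinear S.
Hypothesis Hdec : forall v : V, exists h h' : V, [/\ H h, H h' & v = h + 'i *: h'].

Lemma fieldL_linear a x y f (w : word) :
  fldL (a *: x + y) f w = a * fldL x f w + fldL y f w.
Proof.
rewrite /fieldL lS /annL /ann_side.
have -> : creation form (a *: x + y) f w =
    a * creation form x f w + creation form y f w.
  case: w => [|i w] /=; first by rewrite mulr0 addr0.
  by rewrite /Defs.coord ip_linear; ring.
have -> : \sum_i Num.conj (coord i (Num.conj a *: S x + S y)) *
      lslice i (RT T (size w).+1 f) w =
   a * (\sum_i Num.conj (coord i (S x)) * lslice i (RT T (size w).+1 f) w) +
   \sum_i Num.conj (coord i (S y)) * lslice i (RT T (size w).+1 f) w.
  rewrite mulr_sumr -big_split; apply: eq_bigr => i _ /=.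
  by rewrite /Defs.coord ip_linear rmorphD rmorphM /= conjCK; ring.
ring.
Qed.

Section InVonNeumann.
Variable M : set (fop V).
Hypothesis vM : von_neumann T M.
Hypothesis gM : [set field_op form T H h | h in H] `<=` M.

Let M' := commutant T M.
Let bM' : M' `<=` bounded_op T := @commutant_bounded R V T M.

Let ME : commutant T M' = M.
Proof. by case: vM. Qed.

Lemma field_op_in_vN x : M (field_op form T H x).
Proof.
have [h [h' [Hh Hh' ->]]] := Hdec x.
have Mh : commutant T M' (field_op form T H h) by rewrite ME; apply: gM; exists h.
have Mh' : commutant T M' (field_op form T H h') by rewrite ME; apply: gM; exists h'.
rewrite -ME; apply: (commutant_eq hstrict bM' (commutant_lin hstrict bM' 'i Mh' Mh)) => f cf.
apply: funext => w; rewrite !(field_opE form H hstrict q1) //.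
by rewrite [h + _]addrC fieldL_linear.
Qed.

Lemma field_word_in_vN w : M (field_word form T H w).
Proof.
elim: w => [|i w IH] /=; first by rewrite -ME; exact: commutant_id.
have Mi := field_op_in_vN (e i).
by move: IH Mi; rewrite -ME => IH Mi; exact: commutant_comp.
Qed.

Lemma sum_in_vN (I : Type) (r : seq I) (c : I -> C) (A : I -> fop V) :
  (forall i, M (A i)) -> M (fun f w => \sum_(i <- r) c i * A i f w).
Proof.
move=> MA; rewrite -ME; elim: r => [|i r IH].
  apply: (commutant_eq hstrict bM' (commutant0 hstrict bM')) => f cf.
  by apply: funext => w; rewrite big_nil.
have MAi : commutant T M' (A i) by rewrite ME.
apply: (commutant_eq hstrict bM' (commutant_lin hstrict bM' (c i) MAi IH)) => f cf.
by apply: funext => w; rewrite big_cons.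
Qed.

Lemma field_sum_in_vN N t : M (field_sum N t).
Proof.
have Mk k : M (fun f v => wsum k (fun w => t w * field_word form T H w f v)).
  rewrite /wsum; apply: (sum_in_vN _ (fun w : k.-tuple 'I_d => t w)
     (A := fun w => field_word form T H w)) => w.
  exact: field_word_in_vN.
have := sum_in_vN (index_enum 'I_N.+1) (fun=> 1) (fun k : 'I_N.+1 => Mk k).
congr M; apply: funext => f; apply: funext => v.
by apply: eq_bigr => k _; rewrite mul1r.
Qed.

End InVonNeumann.

Hypothesis br : braided T.
Hypothesis iS : involutive S.
Hypothesis crossing : kernel_crossing form H T.

(** Both sides belong to the left algebra and map the vacuum to [t]. *)
Lemma wick_Qop n t f : homog n t -> fock f ->
  wick form T H t f = field_map form T H (Qop n 0 t) f.
Proof.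
move=> ht cf.
have E : field_map form T H (Qop n 0 t) = field_sum n (Qop n 0 t).
  by apply: field_mapE => w nw; apply: Qop_high; rewrite addn0.
have lE : left_algebra form T H (field_map form T H (Qop n 0 t)).
  by move=> M vM gM; rewrite E; exact: field_sum_in_vN.
have vE : field_map form T H (Qop n 0 t) (vacuum form) = t.
  by rewrite E field_sum_vacuum Gf_Qop.
have [lW vW] : left_algebra form T H (wick form T H t) /\
    wick form T H t (vacuum form) = t.
  apply: (@xgetPex {classic fop V} _
    [set A | left_algebra form T H A /\ A (vacuum form) = t]).
  by exists (field_map form T H (Qop n 0 t)).
apply: (left_algebra_unique hstrict br q1 lS iS crossing lW lE) => //.
by rewrite vW vE.
Qed.

End WickRecursion.

(** * Independence of the order of contraction *)

Section Ranks.
Implicit Types (u : seq nat) (p q : nat * nat).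

(** The position of the strand [m] once the strands in [u] have been removed. *)
Definition rank u m := (m - count (fun x => x < m) u)%N.

Lemma count_le_range u a b (P : pred nat) : uniq u ->
  (forall x, x \in u -> P x -> a <= x < b)%N -> (count P u <= b - a)%N.
Proof.
move=> uu Pab; rewrite -size_filter -(size_iota a (b - a)).
apply: uniq_leq_size; first exact: filter_uniq.
by move=> x; rewrite mem_filter mem_iota => /andP[Px xu]; have := Pab x xu Px; lia.
Qed.

Lemma count_lt_split u a b : (a < b)%N -> a \notin u ->
  count (fun x => x < b)%N u =
  (count (fun x => x < a)%N u + count (fun x => a < x < b)%N u)%N.
Proof.
move=> ab; elim: u => //= x u IH; rewrite inE negb_or => /andP[xa au].
rewrite IH //; have : x != a by rewrite eq_sym.
case: (ltngtP x a) => xa' //; lia.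
Qed.

Lemma count_lt_le u m : uniq u -> (count (fun x => x < m)%N u <= m)%N.
Proof.
by move=> uu; have := @count_le_range u 0 m _ uu (fun x _ h => h); rewrite subn0.
Qed.

Lemma rank_ltn u a b : uniq u -> a \notin u -> (a < b)%N -> (rank u a < rank u b)%N.
Proof.
move=> uu au ab; rewrite /rank (count_lt_split ab au).
have h1 := count_lt_le a uu.
have h2 : (count (fun x => a < x < b)%N u <= b - a.+1)%N.
  by apply: count_le_range => // x _; lia.
lia.
Qed.

Lemma rank_bound u n m : uniq u -> all (fun x => x < n)%N u -> m \notin u ->
  (m < n)%N -> (rank u m < n - size u)%N.
Proof.
move=> uu /allP un mu mn; rewrite /rank.
have h1 := count_lt_le m uu.
have h2 : (count (fun x => m < x)%N u <= n - m.+1)%N.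
  by apply: count_le_range => // x xu mx; rewrite mx un.
have h3 : size u = (count (fun x => x < m)%N u + count (fun x => m < x)%N u)%N.
  elim: u mu {uu un h1 h2} => //= x u IH; rewrite inE negb_or => /andP[mx /IH ->].
  by case: (ltngtP x m) mx => //= _ _; lia.
lia.
Qed.

Lemma rank_cons2 u i j m : rank [:: i, j & u] m = (rank u m - (i < m) - (j < m))%N.
Proof. by rewrite /rank /=; lia. Qed.

Definition endpoints (ps : seq (nat * nat)) : seq nat :=
  flatten [seq [:: p.1; p.2] | p <- ps].

Definition nested p q := ((p.1 < q.1) && (q.2 < p.2))%N.

End Ranks.

Section OrderIndependence.
Variables (R : realType) (V : vectType (Cx R)).
Local Notation tens := (tens V).
Variables (form : {dot V for Num.conj}) (H : set V) (T : square_op V).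
Local Notation ctr := (Defs.contraction form H).
Local Notation cpairs := (contract_pairs form T H).
Implicit Types f g h t : tens.

Definition contract1 u (p : nat * nat) f : tens :=
  ctr (rank u p.1) (opTseg T (rank u p.1).+1 (rank u p.2) f).

Lemma cpairs_cons u p ps f :
  cpairs u (p :: ps) f = cpairs [:: p.1, p.2 & u] ps (contract1 u p f).
Proof. by case: p. Qed.

Lemma cpairs_perm u u' ps f : perm_eq u u' -> cpairs u ps f = cpairs u' ps f.
Proof.
elim: ps u u' f => // p ps IH u u' f uu'; rewrite !cpairs_cons.
rewrite (IH _ [:: p.1, p.2 & u']); last by rewrite !perm_cons.
have E m : rank u m = rank u' m by rewrite /rank (permP uu').
by rewrite /contract1 !E.
Qed.

Lemma contract1_homog N u p f : (2 <= N)%N -> homog N f ->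
  homog (N - 2) (contract1 u p f).
Proof.
by move=> N2 hf; apply: contraction_homog => //; apply: opTs_homog.
Qed.

Hypothesis br : braided T.
Hypothesis crossing : kernel_crossing form H T.

(** As neither pair encloses the other, they are disjoint or crossing;
[swap_disjoint] and [swap_crossing] apply to the ranks of their endpoints. *)
Lemma contract1_swap n u p q f :
  uniq (endpoints [:: p; q] ++ u) -> all (fun x => x < n)%N (endpoints [:: p; q] ++ u) ->
  (p.1 < p.2)%N -> (q.1 < q.2)%N -> ~~ nested p q -> ~~ nested q p ->
  homog (n - size u) f ->
  contract1 [:: p.1, p.2 & u] q (contract1 u p f) =
  contract1 [:: q.1, q.2 & u] p (contract1 u q f).
Proof.
wlog pq : p q / (p.1 < q.1)%N => [WL|].
  move=> ue ae p12 q12 npq nqp hf.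
  have ne : p.1 != q.1.
    by move: ue; rewrite /= !inE !negb_or; case/andP => /and3P[_ ? _].
  have [pq|qp|E] := ltngtP p.1 q.1; [exact: WL| |by rewrite E eqxx in ne].
  have pe : perm_eq (endpoints [:: q; p] ++ u) (endpoints [:: p; q] ++ u).
    rewrite perm_cat2r; apply/permP => P /=; lia.
  apply: esym; apply: WL => //; first by rewrite (perm_uniq pe).
  by rewrite (perm_all _ pe).
case: p q pq => [i j] [k l] /= ik.
rewrite !inE !negb_or /nested /= => /and5P[/and4P[ij' _ il iu] /and3P[jk jl ju]].
move=> /andP[kl' ku] lu uu /and5P[iN jN kN lN uN] ij kl npq _ hf.
have rij := rank_ltn uu iu ij; have rkl := rank_ltn uu ku kl.
have rik := rank_ltn uu iu ik.
have rl := rank_bound uu uN lu lN; have rj := rank_bound uu uN ju jN.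
have jl2 : (j < l)%N.
  by move: npq; rewrite ik /= -leqNgt leq_eqVlt (negPf jl).
have rjl := rank_ltn uu ju jl2.
rewrite /contract1 /= !rank_cons2 ik.
have -> : (i < l)%N by lia.
have -> : (k < i)%N = false by lia.
have -> : (l < i)%N = false by lia.
have -> : (l < j)%N = false by lia.
rewrite jl2 /= !subn0.
have [jk2|kj2|E] := ltngtP j k; last by rewrite E eqxx in jk.
  have rjk := rank_ltn uu ju jk2.
  have := swap_disjoint form H T hf rij rjk rkl rl.
  by rewrite /= ?subn0 ?subn2 ?subn1.
have rkj := rank_ltn uu ku kj2.
have := swap_crossing crossing br hf rik rkj rjl rl.
by rewrite /= ?subn0 ?subn2 ?subn1.
Qed.

Lemma cpairs_swap n u p q ps f :
  uniq (endpoints [:: p; q] ++ u) -> all (fun x => x < n)%N (endpoints [:: p; q] ++ u) ->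
  (p.1 < p.2)%N -> (q.1 < q.2)%N -> ~~ nested p q -> ~~ nested q p ->
  homog (n - size u) f ->
  cpairs u [:: p, q & ps] f = cpairs u [:: q, p & ps] f.
Proof.
move=> ue ae p12 q12 npq nqp hf; rewrite !cpairs_cons.
rewrite (contract1_swap ue ae) //; apply: cpairs_perm.
by apply/permP => P /=; lia.
Qed.

Definition wf_pairs (n : nat) u (ps : seq (nat * nat)) : bool :=
  [&& uniq (endpoints ps ++ u), all (fun x => x < n)%N (endpoints ps ++ u) &
      all (fun p => p.1 < p.2)%N ps].

Lemma wf_pairs_cons n u p ps : wf_pairs n u (p :: ps) ->
  wf_pairs n [:: p.1, p.2 & u] ps /\ (size u + 2 <= n)%N.
Proof.
case/and3P => ue ae /= /andP[p12 aps]; split.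
  have pe : perm_eq (endpoints ps ++ [:: p.1, p.2 & u]) (endpoints (p :: ps) ++ u).
    rewrite /endpoints /= -!/(endpoints _); apply/permP => P /=.
    by rewrite !count_cat /=; lia.
  by apply/and3P; split => //; rewrite ?(perm_uniq pe) ?(perm_all _ pe).
have := uniq_leq_size ue (s2 := iota 0 n).
rewrite size_iota /endpoints /= size_cat => h.
apply: leq_trans (h _); first by lia.
by move=> x xu; rewrite mem_iota /=; exact: (allP ae).
Qed.

Lemma wf_pairs_perm n u ps qs : perm_eq ps qs -> wf_pairs n u ps = wf_pairs n u qs.
Proof.
move=> pq; have pe : perm_eq (endpoints ps ++ u) (endpoints qs ++ u).
  by rewrite perm_cat2r; apply: perm_flatten; exact: perm_map.
by rewrite /wf_pairs (perm_uniq pe) (perm_all _ pe) (perm_all _ pq).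
Qed.

Lemma cpairs_move_front n u s1 p s2 f : wf_pairs n u (s1 ++ p :: s2) ->
  all (fun q => ~~ nested p q && ~~ nested q p) s1 -> homog (n - size u) f ->
  cpairs u (s1 ++ p :: s2) f = cpairs u (p :: s1 ++ s2) f.
Proof.
elim: s1 u f => // q s1 IH u f wf; rewrite [all _ _]/=.
move=> /andP[/andP[npq nqp] as1] hf; rewrite !cat_cons.
have [wf' sn] := wf_pairs_cons wf.
rewrite cpairs_cons IH //; last first.
  rewrite /= (_ : n - (size u).+2 = n - size u - 2)%N; last by lia.
  by apply: contract1_homog => //; lia.
rewrite -cpairs_cons.
have pe : perm_eq (q :: s1 ++ p :: s2) [:: q, p & s1 ++ s2].
  by rewrite perm_cons -cat1s perm_catCA.
have := wf; rewrite (wf_pairs_perm _ _ pe) => /and3P[ue ae /and3P[q12 p12 _]].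
apply: (@cpairs_swap n) => //.
- by apply: (subseq_uniq _ ue); rewrite -!catA /=; do 4!(rewrite /= eqxx); exact: suffix_subseq.
- by move: ae; rewrite /= !all_cat /= => /and5P[-> -> -> -> /andP[_ ->]].
Qed.

Definition unnested (ps : seq (nat * nat)) := pairwise (fun p q => ~~ nested q p) ps.

(** The pair whose left end is leftmost can be brought to the front: it encloses
none of the pairs that precede it, by admissibility, and none of them
encloses it. Repeating this sorts any admissible order by left ends. *)
Lemma cpairs_sorted n u (s t : seq (nat * nat)) f : wf_pairs n u s -> perm_eq s t ->
  sorted (fun p q => p.1 < q.1)%N t -> unnested s -> homog (n - size u) f ->
  cpairs u s f = cpairs u t f.
Proof.
elim: t u s f => [|p t IH] u s f wf st srt us hf.
  by rewrite (perm_nilP st).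
have ps : p \in s by rewrite (perm_mem st) mem_head.
case/splitPr: ps wf st us => s1 s2 wf st us.
have st' : perm_eq (s1 ++ s2) t.
  by rewrite -(perm_cons p) -(perm_catCA s1 [:: p] s2).
have lt : all (fun q => p.1 < q.1)%N t.
  by apply: order_path_min srt => x y z /=; exact: ltn_trans.
rewrite /unnested pairwise_cat [pairwise _ (p :: s2)]/= in us.
case/and3P: us => /allrelP us12 us1 /andP[_ us2].
rewrite (@cpairs_move_front n) //; last first.
  apply/allP => q qs1; rewrite us12 ?mem_head //= /nested.
  have : q \in t by rewrite -(perm_mem st') mem_cat qs1.
  by move/(allP lt) => pq; rewrite (ltnNge q.1) (ltnW pq).
have wf' : wf_pairs n u (p :: s1 ++ s2).
  by rewrite -(wf_pairs_perm n u (ps := s1 ++ p :: s2)) // -(cat1s p s2) perm_catCA.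
have [wf2 sn] := wf_pairs_cons wf'.
rewrite !cpairs_cons; apply: IH => //.
- exact: path_sorted srt.
- rewrite /unnested pairwise_cat us1 us2 !andbT.
  by apply/allrelP => x y xs ys; apply: us12 => //; rewrite inE ys orbT.
- rewrite /= (_ : n - (size u).+2 = n - size u - 2)%N; last by lia.
  by apply: contract1_homog => //; lia.
Qed.

End OrderIndependence.

(** * Incomplete matchings of a sorted list *)

Section Matchings.
Implicit Types (l : seq nat) (ps : seq (nat * nat)).

Definition del_nth (j : nat) l := take j l ++ drop j.+1 l.

(** The same recursion as for [Qop]: the first point is a singleton, or it is
paired with one of the other points. The number [n] is the size of [l] and
makes the recursion structural. *)
Fixpoint matchings (n : nat) l : seq (seq (nat * nat)) :=
  if n is m.+1 then
    if l is x :: l' then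
      matchings m l' ++
      (if m is k.+1 then
        flatten [seq [seq (x, nth 0%N l' j) :: ps | ps <- matchings k (del_nth j l')]
                | j <- iota 0 m] else [::])
    else [:: [::]]
  else [:: [::]].

Lemma matchingsSS k x l : matchings k.+2 (x :: l) = matchings k.+1 l ++
  flatten [seq [seq (x, nth 0%N l j) :: ps | ps <- matchings k (del_nth j l)]
          | j <- iota 0 k.+1].
Proof. by []. Qed.

Lemma matchings1 x : matchings 1 [:: x] = [:: [::]]. Proof. by []. Qed.

Lemma size_del_nth j l : (j < size l)%N -> size (del_nth j l) = (size l).-1.
Proof. by move=> jl; rewrite size_cat size_takel ?size_drop; lia. Qed.

Lemma nth_del_nth j l a : (j < size l)%N -> nth 0%N (del_nth j l) a =
  if (a < j)%N then nth 0%N l a else nth 0%N l a.+1.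
Proof.
move=> jl; rewrite nth_cat size_takel; last by lia.
case: ltnP => aj; first by rewrite nth_take.
by rewrite nth_drop; congr nth; lia.
Qed.

Lemma del_nth_perm j l : (j < size l)%N -> perm_eq l (nth 0%N l j :: del_nth j l).
Proof.
move=> jl; rewrite -[l in perm_eq l _](cat_take_drop j) (drop_nth 0%N) //.
by rewrite -cat1s perm_catCA.
Qed.

Lemma del_nth_subseq j l : subseq (del_nth j l) l.
Proof.
rewrite -[X in subseq _ X](cat_take_drop j l) cat_subseq //.
by rewrite -add1n -drop_drop drop_subseq.
Qed.

Definition lefts_sorted ps := sorted (fun p q : nat * nat => p.1 < q.1)%N ps.

Lemma mem_endpoints x ps :
  reflect (exists2 p, p \in ps & x = p.1 \/ x = p.2) (x \in endpoints ps).
Proof.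
apply: (iffP flatten_mapP) => [[p pp xp]|[p pp xp]]; exists p => //.
  by move: xp; rewrite !inE => /orP[] /eqP ->; [left|right].
by rewrite !inE; case: xp => ->; rewrite eqxx ?orbT.
Qed.

Definition good_pairs l ps : bool :=
  [&& lefts_sorted ps, all (fun p => p.1 < p.2)%N ps, uniq (endpoints ps) &
      all (fun x => x \in l) (endpoints ps)].

Lemma matchings_good n l ps : size l = n -> sorted ltn l ->
  (ps \in matchings n l) = good_pairs l ps.
Proof.
elim/ltn_ind: n l ps => n IH [|x l] ps sl srt.
  rewrite -sl inE; apply/eqP/idP => [->//|/and4P[_ _ _]].
  by case: ps.
case: n IH sl => [|[|k]] IH // [sl].
  case: l sl srt => // _ _; rewrite matchings1 inE.
  apply/eqP/idP => [->//|/and4P[_]].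
  case: ps => //= -[a b] ps /andP[/= ab _] _ /and3P[].
  by rewrite !inE => /eqP ax /eqP bx; rewrite ax bx ltnn in ab.
rewrite -[_ \in _]/(ps \in matchings k.+2 (x :: l)) matchingsSS mem_cat.
have xl : all (fun y => x < y)%N l by apply: order_path_min srt; exact: ltn_trans.
have srtl : sorted ltn l := path_sorted srt.
have uxl : uniq (x :: l) by apply: sorted_uniq srt; [exact: ltn_trans|exact: ltnn].
have IHl qs := IH k.+1 (ltnSn _) l qs sl srtl.
have sub j : (j < k.+1)%N -> size (del_nth j l) = k.
  by move=> jk; rewrite size_del_nth sl.
have srtj j : sorted ltn (del_nth j l).
  by apply: subseq_sorted (del_nth_subseq j l) srtl; exact: ltn_trans.
apply/orP/idP => [[]|].
- rewrite IHl => /and4P[h1 h2 h3 h4]; apply/and4P; split=> //.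
  by apply: sub_all h4 => y yl; rewrite inE yl orbT.
- move=> /flatten_mapP[j]; rewrite mem_iota /= => jk /mapP[qs].
  rewrite IH ?sub // => /and4P[h1 h2 h3 h4] ->.
  have yl : nth 0%N l j \in l by rewrite mem_nth // sl.
  have pe : perm_eq l (nth 0%N l j :: del_nth j l) by apply: del_nth_perm; rewrite sl.
  have /andP[yn _] : uniq (nth 0%N l j :: del_nth j l).
    by rewrite -(perm_uniq pe); case/andP: uxl.
  have sd : {subset del_nth j l <= l} := mem_subseq (del_nth_subseq j l).
  have xnl : x \notin l by case/andP: uxl.
  apply/and4P; split.
  + rewrite /lefts_sorted /= path_min_sorted //; apply/allP => q qq /=.
    apply: (allP xl); apply: sd; apply: (allP h4).
    by apply/mem_endpoints; exists q => //; left.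
  + by rewrite /= h2 andbT; exact: (allP xl).
  + have sub2 : {subset endpoints qs <= del_nth j l} by apply/allP.
    rewrite /= h3 andbT inE negb_or -andbA; apply/and3P; split.
    * by apply: contraNneq xnl => ->.
    * by apply: contra xnl => /sub2/sd.
    * by apply: contra yn => /sub2.
  + rewrite /= !inE eqxx yl orbT /=; apply: sub_all h4 => z /sd zl.
    by rewrite inE zl orbT.
- case/and4P; case: ps => [|[a b] qs]; first by left; rewrite IHl.
  move=> h1 h2 h3 h4.
  have lts : all (fun q => a < q.1)%N qs.
    by apply: (order_path_min (leT := fun p q : nat * nat => p.1 < q.1)%N) h1 => p q r;
      exact: ltn_trans.
  have /andP[ab h2'] : (a < b)%N && all (fun p => p.1 < p.2)%N qs := h2.
  have [ax|ax] := eqVneq a x.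
    right; subst a; have bl : b \in l.
      move: h4 => /= /and3P[_ + _]; rewrite inE => /orP[/eqP bx|//].
      by rewrite bx ltnn in ab.
    apply/flatten_mapP; exists (index b l).
      by rewrite mem_iota /= -sl index_mem.
    rewrite nth_index //; apply/mapP; exists qs => //.
    have jl : (index b l < size l)%N by rewrite index_mem.
    rewrite IH ?sub //; last by rewrite -sl.
    apply/and4P; split => //; first exact: path_sorted h1.
      by move: h3 => /= /and3P[].
    have pe := del_nth_perm jl; rewrite nth_index // in pe.
    apply/allP => z zq; move: h3 => /= /and3P[xn bn _].
    have zx : z != x by apply: contraNneq xn => <-; rewrite inE zq orbT.
    have zb : z != b by apply: contraNneq bn => <-.
    have : z \in x :: l by apply: (allP h4); rewrite /= !inE zq !orbT.
    by rewrite inE (negPf zx) /= (perm_mem pe) inE (negPf zb).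
  left; rewrite IHl; apply/and4P; split=> //.
  apply/allP => z zp; have := allP h4 z zp; rewrite inE => /orP[/eqP zx|//].
  have xa : (x < a)%N.
    have := allP h4 a; rewrite /= inE eqxx => /(_ isT); rewrite inE (negPf ax) /=.
    exact: (allP xl).
  exfalso; case/mem_endpoints: zp => p; rewrite inE => pq.
  have ap : (a <= p.1)%N by case/orP: pq => [/eqP -> //|/(allP lts)/ltnW].
  have p12 : (p.1 < p.2)%N by apply: (allP h2); rewrite inE.
  by case=> E; lia.
Qed.

Lemma matchings_uniq n l : size l = n -> sorted ltn l -> uniq (matchings n l).
Proof.
elim/ltn_ind: n l => n IH [|x l] sl srt; first by rewrite -sl.
case: n IH sl => [|[|k]] IH // [sl].
rewrite -[uniq _]/(uniq (matchings k.+2 (x :: l))) matchingsSS cat_uniq.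
have srtl : sorted ltn l := path_sorted srt.
have uxl : uniq (x :: l) by apply: sorted_uniq srt; [exact: ltn_trans|exact: ltnn].
have /andP[xnl ul] := uxl.
have sub j : (j < k.+1)%N -> size (del_nth j l) = k.
  by move=> jk; rewrite size_del_nth sl.
have srtj j : sorted ltn (del_nth j l).
  by apply: subseq_sorted (del_nth_subseq j l) srtl; exact: ltn_trans.
rewrite IH // andTb; apply/andP; split.
  apply/hasPn => ps /flatten_mapP[j _ /mapP[qs _ ->]].
  apply/negP; rewrite matchings_good // => /and4P[_ _ _ /= /andP[xl _]].
  by rewrite xl in xnl.
have : all (fun j => j < k.+1)%N (iota 0 k.+1).
  by apply/allP => j; rewrite mem_iota.
elim: (iota 0 k.+1) (iota_uniq 0 k.+1) => // j r IHr /= /andP[jr ur] /andP[jk ark].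
rewrite cat_uniq IHr // andbT map_inj_uniq; last by move=> a b [].
rewrite IH ?sub // ?andTb; apply/hasPn => ps /flatten_mapP[i ir /mapP[qs _ ->]].
apply/negP => /mapP[qs' _ [/eqP]].
have ik := allP ark i ir.
rewrite nth_uniq ?sl // => /eqP ij _.
by rewrite -ij ir in jr.
Qed.

End Matchings.

(** * Matchings as partitions into singletons and pairs *)

Section MatchingSum.
Variables (R : realType) (V : vectType (Cx R)).
Local Notation tens := (tens V).
Local Notation word := (word V).
Variables (form : {dot V for Num.conj}) (H : set V) (T : square_op V).
Local Notation cpairs := (contract_pairs form T H).

(** Contracting the first point [x] of [l] with its partner is one step of the
recursion of [Qop]. The hypothesis on ranks says that the points of [l] are
the tensor factors at positions [k], ..., [k + n - 1]. *)
Lemma matchings_Qop n l k u (t : tens) (w : word) : size l = n -> sorted ltn l ->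
  (forall a, a < n -> rank u (nth 0 l a) = k + a)%N ->
  \sum_(ps <- matchings n l) (-1) ^+ size ps * cpairs u ps t w = Qop form H T n k t w.
Proof.
elim/ltn_ind: n l k u t => n IH [|x l] k u t sl srt rk.
  by rewrite -sl big_seq1 expr0 mul1r.
case: n IH sl rk => [|[|m]] IH // [sl] rk.
  by rewrite (size0nil sl) matchings1 big_seq1 expr0 mul1r Qop1.
have srtl : sorted ltn l := path_sorted srt.
have xl : all (fun y => x < y)%N l by apply: order_path_min srt; exact: ltn_trans.
rewrite matchingsSS big_cat QopSS; congr (_ + _).
  apply: (IH m.+1) => // a am; have := rk a.+1 am; rewrite /= => ->.
  by rewrite addnS.
rewrite big_flatten big_map -sumrN -(big_mkord xpredT
  (fun j => - Qop form H T m k (Defs.contraction form H k (opTs T (iota k.+1 j) t)) w)).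
rewrite /index_iota subn0 !big_seq; apply: eq_bigr => j.
rewrite mem_iota add0n => /andP[_ jm].
rewrite big_map -(IH m _ (del_nth j l) k [:: x, nth 0%N l j & u]) //; first last.
- move=> a am; rewrite nth_del_nth ?sl // rank_cons2.
  case: ltnP => aj.
    have -> : (x < nth 0 l a)%N by apply: (allP xl); rewrite mem_nth // sl; lia.
    have -> : (nth 0 l j < nth 0 l a)%N = false.
      apply/negbTE; rewrite -leqNgt ltnW //.
      by rewrite (sorted_ltn_nth ltn_trans) ?inE ?sl //; lia.
    by have := rk a.+1; rewrite /= => ->; lia.
  have -> : (x < nth 0 l a.+1)%N by apply: (allP xl); rewrite mem_nth // sl; lia.
  have -> : (nth 0 l j < nth 0 l a.+1)%N.
    by rewrite (sorted_ltn_nth ltn_trans) ?inE ?sl //; lia.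
  by have := rk a.+2; rewrite /= => ->; lia.
- by apply: subseq_sorted (del_nth_subseq j l) srtl; exact: ltn_trans.
- by rewrite size_del_nth sl.
rewrite -sumrN; apply: eq_bigr => ps _.
rewrite [size _]/= exprS mulN1r mulNr; congr (- (_ * _)).
rewrite cpairs_cons /contract1 /=.
have -> : rank u x = k by have := rk 0%N isT; rewrite /= addn0.
have -> : rank u (nth 0 l j) = (k + j.+1)%N by have := rk j.+1; apply.
by rewrite /opTseg addnS subSS addKn.
Qed.

End MatchingSum.

Section Partitions.
Local Close Scope classical_set_scope.

Lemma endpoints_inj ps p q x : uniq (endpoints ps) -> p \in ps -> q \in ps ->
  x = p.1 \/ x = p.2 -> x = q.1 \/ x = q.2 -> p = q.
Proof.
elim: ps => //= r ps IH /and3P[]; rewrite inE negb_or => /andP[_ r1 r2 ups].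
have out s y : s \in ps -> y = s.1 \/ y = s.2 -> y = r.1 \/ y = r.2 -> False.
  move=> sps ys yr; have : y \in endpoints ps by apply/mem_endpoints; exists s.
  by case: yr => ->; apply/negP.
rewrite !inE => /orP[/eqP ->|pp] /orP[/eqP ->|qq] // px qx.
- by case: (out q x).
- by case: (out p x).
- exact: IH px qx.
Qed.

Lemma uniq_endpoints ps : uniq ps -> (forall p, p \in ps -> p.1 != p.2) ->
  (forall p q x, p \in ps -> q \in ps -> x = p.1 \/ x = p.2 ->
     x = q.1 \/ x = q.2 -> p = q) -> uniq (endpoints ps).
Proof.
elim: ps => //= r ps IH /andP[rps ups] ne inj.
have out y : y = r.1 \/ y = r.2 -> y \notin endpoints ps.
  move=> yr; apply/negP => /mem_endpoints[s sps ys].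
  by move: rps; rewrite (inj r s y) ?mem_head // ?sps // inE sps orbT.
rewrite inE negb_or ne ?mem_head // !out /=; try by [left|right].
apply: IH => // [p pp|p q x pp qq]; first by apply: ne; rewrite inE pp orbT.
by apply: inj; rewrite inE ?pp ?qq orbT.
Qed.

Lemma index_pairwise (A : eqType) (r : rel A) (s : seq A) : uniq s ->
  {in s &, forall p q, r p q -> (index p s < index q s)%N} ->
  pairwise (fun p q => ~~ r q p) s.
Proof.
elim: s => //= a s IH /andP[sa us] rs; apply/andP; split.
  apply/allP => b bs; apply/negP => rba.
  have := rs b a; rewrite !inE bs !eqxx orbT /= => /(_ isT isT rba).
  by case: ifP.
apply: IH => // p q ps qs rpq.
have := rs p q; rewrite !inE ps qs !orbT => /(_ isT isT rpq).
have -> : (a == p) = false by apply: contraNF sa => /eqP ->.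
by have -> : (a == q) = false by apply: contraNF sa => /eqP ->.
Qed.

Variable n : nat.
Implicit Types (P Q : {set {set 'I_n}}) (B : {set 'I_n}).

Definition lefts_le (p q : nat * nat) := (p.1 <= q.1)%N.

(** Increasing left ends are an admissible order, since an enclosing pair starts
first; it is also the order in which [matchings] lists the pairs. *)
Definition canonical_pairs P : seq (nat * nat) :=
  sort lefts_le (val_pairs (enum (ordered_pairings P))).

Lemma mem_canonical P (p : 'I_n * 'I_n) :
  ((val p.1, val p.2) \in canonical_pairs P) = (p \in ordered_pairings P).
Proof.
rewrite mem_sort; apply/mapP/idP => [[q]|pP].
  rewrite mem_enum => qP [e1 e2]; suff -> : p = q by [].
  by case: p q e1 e2 {qP} => [? ?] [? ?] /= /val_inj -> /val_inj ->.
by exists p; rewrite ?mem_enum.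
Qed.

Lemma canonicalP P (p : nat * nat) : reflect
  (exists2 q : 'I_n * 'I_n, q \in ordered_pairings P & p = (val q.1, val q.2))
  (p \in canonical_pairs P).
Proof.
rewrite mem_sort; apply: (iffP mapP) => -[q qP ->]; exists q => //.
  by rewrite mem_enum in qP.
by rewrite mem_enum.
Qed.

Lemma pair_set_inj (i j k l : 'I_n) : (i < j)%N -> (k < l)%N ->
  [set i; j] = [set k; l] -> (i, j) = (k, l).
Proof.
move=> ij kl E.
have : i \in [set k; l] by rewrite -E !inE eqxx.
have : j \in [set k; l] by rewrite -E !inE eqxx orbT.
have : k \in [set i; j] by rewrite E !inE eqxx.
rewrite !inE => /orP[] /eqP h1 /orP[] /eqP h2 /orP[] /eqP h3; subst => //;
  by lia.
Qed.

Lemma partition_inj P B B' x : P \in partitions12 n -> B \in P -> B' \in P ->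
  x \in B -> x \in B' -> B = B'.
Proof.
rewrite inE => /andP[/and3P[_ tP _] _] BP BP' xB xB'.
by rewrite -(def_pblock tP BP xB) (def_pblock tP BP' xB').
Qed.

Lemma ordered_pairings_inj P (p q : 'I_n * 'I_n) x : P \in partitions12 n ->
  p \in ordered_pairings P -> q \in ordered_pairings P ->
  x \in [set p.1; p.2] -> x \in [set q.1; q.2] -> p = q.
Proof.
move=> PP; rewrite !inE => /andP[p12 pP] /andP[q12 qP] xp xq.
have E : [set p.1; p.2] = [set q.1; q.2].
  by apply: (partition_inj PP pP qP (x := x)); rewrite !inE.
by have := pair_set_inj p12 q12 E; rewrite -!surjective_pairing.
Qed.

Lemma canonical_good P : P \in partitions12 n ->
  good_pairs (iota 0 n) (canonical_pairs P).
Proof.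
move=> PP.
have lt p : p \in canonical_pairs P -> (p.1 < p.2)%N.
  by case/canonicalP => q; rewrite inE => /andP[q12 _] ->.
have inj p q x : p \in canonical_pairs P -> q \in canonical_pairs P ->
    x = p.1 \/ x = p.2 -> x = q.1 \/ x = q.2 -> p = q.
  case/canonicalP => p' pP -> /canonicalP[q' qP ->] /= xp xq.
  have [y [xy yp]] : exists y : 'I_n, x = val y /\ y \in [set p'.1; p'.2].
    by case: xp => ->; [exists p'.1|exists p'.2]; split => //; rewrite !inE eqxx ?orbT.
  suff -> : p' = q' by [].
  apply: (ordered_pairings_inj PP pP qP yp); rewrite !inE.
  by case: xq; rewrite xy => /val_inj ->; rewrite eqxx ?orbT.
have uc : uniq (canonical_pairs P).
  rewrite sort_uniq map_inj_uniq ?enum_uniq // => -[a b] [c d] /= [] /val_inj -> /val_inj ->.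
  by [].
have ue : uniq (endpoints (canonical_pairs P)).
  by apply: uniq_endpoints => // p /lt; rewrite neq_ltn => ->.
have srt : sorted lefts_le (canonical_pairs P).
  by apply: sort_sorted => p q; exact: leq_total.
apply/and4P; split=> //; last first.
- apply/allP => x /mem_endpoints[p /canonicalP[q _ ->]] /=.
  by rewrite mem_iota /=; case=> ->; rewrite add0n ltn_ord.
- by apply/allP.
rewrite /lefts_sorted -(@sorted_map _ _ fst ltn).
rewrite ltn_sorted_uniq_leq sorted_map srt andbT map_inj_in_uniq // => p q pc qc pq.
by apply: (inj p q p.1); [| |left|left].
Qed.

(** The blocks that are not pairs are the singletons of the remaining points. *)
Lemma ordered_pairings_det P Q : P \in partitions12 n -> Q \in partitions12 n ->
  ordered_pairings P = ordered_pairings Q -> P \subset Q.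
Proof.
move=> PP QP E; apply/fintype.subsetP => B BP.
have two B' P' : #|B'| = 2%N -> B' \in P' ->
    exists2 p : 'I_n * 'I_n, p \in ordered_pairings P' & B' = [set p.1; p.2].
  move=> /eqP/cards2P[i [j [ij ->]]] BP'.
  have [ltij|ltji|/val_inj e] := ltngtP i j; last by rewrite e eqxx in ij.
    by exists (i, j); rewrite ?inE //= ltij.
  by exists (j, i); rewrite ?inE /= ?ltji 1?finset.setUC.
have op12 p P' : p \in ordered_pairings P' -> [set p.1; p.2] \in P'.
  by rewrite inE => /andP[].
have := PP; rewrite inE => /andP[_ /forall_inP/(_ B BP)] /orP[|] cB; last first.
  have [p pP ->] := two B P (eqP cB) BP.
  by apply: op12; rewrite -E.
have /cards1P[x Bx] := cB.
have := QP; rewrite inE => /andP[/and3P[/eqP cQ tQ _] /forall_inP Q12].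
have xQ : x \in finset.cover Q by rewrite cQ inE.
have BQ : finset.pblock Q x \in Q by rewrite finset.pblock_mem.
have xB' : x \in finset.pblock Q x by rewrite finset.mem_pblock.
have /orP[|] := Q12 _ BQ; last first.
  move=> /eqP c2; have [p pQ pE] := two _ _ c2 BQ.
  have pP : [set p.1; p.2] \in P by apply: op12; rewrite E.
  have : B = [set p.1; p.2].
    by apply: (partition_inj PP BP pP (x := x)); rewrite -?pE // Bx inE.
  by move: cB => /[swap] ->; rewrite -pE c2.
move=> /cards1P[y yE]; move: BQ xB'; rewrite yE inE => + /eqP xy.
by rewrite Bx xy.
Qed.

Lemma canonical_inj : {in partitions12 n &, injective canonical_pairs}.
Proof.
move=> P Q PP QP E.
have EO : ordered_pairings P = ordered_pairings Q.
  by apply/setP => p; rewrite -!mem_canonical E.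
by apply/eqP; rewrite finset.eqEsubset !ordered_pairings_det.
Qed.

Lemma canonical_surj ps : good_pairs (iota 0 n) ps ->
  exists2 P, P \in partitions12 n & canonical_pairs P = ps.
Proof.
case/and4P => srt /allP lt ue /allP mem.
have inj := endpoints_inj ue.
(* [key] maps both ends of a pair to its left end and fixes all other points;
   its fibres are the blocks. *)
pose key (x : nat) := head x [seq p.1 | p <- ps & p.2 == x].
have keyP x : key x = x \/ (key x, x) \in ps.
  rewrite /key; case E : [seq p <- ps | p.2 == x] => [|p s]; first by left.
  have : p \in [seq p <- ps | p.2 == x] by rewrite E mem_head.
  by rewrite mem_filter /= => /andP[/eqP <- pp]; right; rewrite -surjective_pairing.
have key2 p : p \in ps -> key p.2 = p.1.
  move=> pp; case: (keyP p.2) => [k2|k2]; last first.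
    by have := inj _ _ p.2 k2 pp (or_intror erefl) (or_intror erefl) => /(congr1 fst).
  move: k2; rewrite /key; case E : [seq p <- ps | _] => [|q s] /=.
    have : p \in [seq p' <- ps | p'.2 == p.2] by rewrite mem_filter eqxx.
    by rewrite E.
  have : q \in [seq p' <- ps | p'.2 == p.2] by rewrite E mem_head.
  rewrite mem_filter => /andP[/eqP e2 qq] _.
  by rewrite (inj q p p.2 qq pp (or_intror (esym e2)) (or_intror erefl)).
have key1 p : p \in ps -> key p.1 = p.1.
  move=> pp; case: (keyP p.1) => // k1.
  have /(congr1 snd) /= e := inj _ _ p.1 k1 pp (or_intror erefl) (or_introl erefl).
  by have := lt p pp; rewrite -e ltnn.
have keyE x y : key x = key y -> (x < y)%N -> (x, y) \in ps.
  move=> kxy xy; case: (keyP x) (keyP y) => [kx|kx] [ky|ky].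
  - by move: xy; rewrite -kx kxy ky ltnn.
  - by rewrite -kxy kx in ky.
  - by have := lt _ kx; rewrite /= kxy ky => /(ltn_trans xy); rewrite ltnn.
  - rewrite -kxy in ky; have /(congr1 snd) /= e := inj _ _ (key x) kx ky (or_introl erefl) (or_introl erefl).
    by rewrite e ltnn in xy.
pose f (x : 'I_n) := key x.
pose P := preim_partition f [set: 'I_n].
have pP : finset.partition P [set: 'I_n] := preim_partitionP f _.
have bP B : B \in P -> exists x, B = [set y | f x == f y].
  by case/imsetP => x _ ->; exists x; apply/setP => y; rewrite !inE.
have inP x : [set y | f x == f y] \in P.
  by apply/imsetP; exists x => //; apply/setP => y; rewrite !inE.
have two (i j : 'I_n) : (val i, val j) \in ps -> [set y | f i == f y] = [set i; j].
  move=> ij; apply/setP => y; rewrite !inE.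
  have fi : f i = i := key1 _ ij; have fj : f j = i := key2 _ ij.
  apply/eqP/orP => [fy|[] /eqP ->]; rewrite ?fi ?fj //.
  have [yi|iy|/val_inj ->] := ltngtP y i; last by left.
    have yps : (val y, val i) \in ps by apply: keyE.
    have /(congr1 snd) /= e := inj _ _ (val i) yps ij (or_intror erefl) (or_introl erefl).
    by have := lt _ ij; rewrite /= -e ltnn.
  have yps : (val i, val y) \in ps by apply: keyE.
  have /(congr1 snd) /= /val_inj e := inj _ _ (val i) yps ij (or_introl erefl) (or_introl erefl).
  by right; rewrite e.
have PP : P \in partitions12 n.
  rewrite inE pP /=; apply/forall_inP => B /bP[x ->].
  have [[i [j [ij fx]]]|no] := EM (exists i j : 'I_n,
      (val i, val j) \in ps /\ f x = f i).
    rewrite fx (two _ _ ij) cards2; have := lt _ ij; rewrite /= neq_ltn => ->.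
    by rewrite orbT.
  rewrite (_ : [set y | f x == f y] = [set x]) ?cards1 //.
  apply/setP => y; rewrite !inE; apply/eqP/eqP => [fy|-> //].
  have [xy|yx|/val_inj //] := ltngtP y x; exfalso; apply: no.
    exists y, x; split; [by apply: keyE|by []].
  exists x, y; split => //; by apply: keyE.
exists P => //.
have /and4P[srtP _ _ _] := canonical_good PP.
apply: (irr_sorted_eq (leT := fun p q : nat * nat => p.1 < q.1)%N) => //.
- by move=> p q s; exact: ltn_trans.
- by move=> p; rewrite ltnn.
move=> p; apply/canonicalP/idP => [[q]|pp].
  rewrite inE => /andP[q12 /bP[x qx]] ->; apply: keyE => //.
  have h1 : q.1 \in [set q.1; q.2] by rewrite !inE eqxx.
  have h2 : q.2 \in [set q.1; q.2] by rewrite !inE eqxx orbT.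
  by move: h1 h2; rewrite qx !inE => /eqP e1 /eqP e2; rewrite -[LHS]/(f q.1) -e1 e2.
have b1 : (p.1 < n)%N.
  by have := mem p.1; rewrite mem_iota; apply; apply/mem_endpoints; exists p => //; left.
have b2 : (p.2 < n)%N.
  by have := mem p.2; rewrite mem_iota; apply; apply/mem_endpoints; exists p => //; right.
exists (Ordinal b1, Ordinal b2); last by rewrite -surjective_pairing.
rewrite inE /= lt //= -(two (Ordinal b1) (Ordinal b2)) //=.
by rewrite -surjective_pairing.
Qed.

Lemma perm_canonical : perm_eq [seq canonical_pairs P | P <- enum (partitions12 n)]
  (matchings n (iota 0 n)).
Proof.
have si := size_iota 0 n; have so := iota_ltn_sorted 0 n.
apply: uniq_perm; last 1 first.
- move=> ps; rewrite matchings_good //; apply/mapP/idP => [[P]|/canonical_surj[P PP <-]].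
    by rewrite mem_enum => PP ->; exact: canonical_good.
  by exists P; rewrite ?mem_enum.
- rewrite map_inj_in_uniq ?enum_uniq // => P Q; rewrite !mem_enum.
  exact: canonical_inj.
- exact: matchings_uniq.
Qed.

Lemma card_pairings P : P \in partitions12 n -> #|pairings P| = size (canonical_pairs P).
Proof.
move=> PP; rewrite size_sort size_map -cardE.
have -> : pairings P = [set [set p.1; p.2] | p in ordered_pairings P].
  apply/setP => B; rewrite inE; apply/andP/imsetP => [[BP /cards2P[i [j [ij BE]]]]|[p]].
    have [ltij|ltji|/val_inj e] := ltngtP i j; last by rewrite e eqxx in ij.
      by exists (i, j); rewrite ?inE //= ltij -BE.
    by exists (j, i); rewrite ?inE /= ?ltji 1?finset.setUC -?BE // finset.setUC.
  rewrite inE => /andP[p12 pP] ->; split => //.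
  by rewrite cards2 neq_ltn p12.
rewrite card_in_imset // => p q pP qP E.
apply: (ordered_pairings_inj PP pP qP (x := p.1)); first by rewrite !inE eqxx.
by rewrite -E !inE eqxx.
Qed.

End Partitions.

Section PartitionSum.
Local Close Scope classical_set_scope.
Variables (R : realType) (V : vectType (Cx R)).
Variables (form : {dot V for Num.conj}) (H : set V) (T : square_op V).
Hypothesis br : braided T.
Hypothesis crossing : kernel_crossing form H T.

Lemma WT_canonical n (t : tens V) P s : homog n t -> P \in partitions12 n ->
  admissible P s ->
  WT form T H (val_pairs s) t = WT form T H (canonical_pairs P) t.
Proof.
move=> ht PP [us sP adm].
have pe : perm_eq (val_pairs s) (canonical_pairs P).
  rewrite perm_sym perm_sort perm_map //; apply: uniq_perm => //; first exact: enum_uniq.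
  by move=> p; rewrite mem_enum sP.
have /and4P[srt lt ue mem] := canonical_good PP.
apply: (cpairs_sorted br crossing (n := n)) => //; last by rewrite subn0.
- rewrite (wf_pairs_perm _ _ pe); apply/and3P; rewrite cats0; split=> //.
  by apply: sub_all mem => x; rewrite mem_iota.
- rewrite /unnested /val_pairs pairwise_map.
  have adm' : {in s &, forall p q : 'I_n * 'I_n, nested (val p.1, val p.2) (val q.1, val q.2) ->
      (index p s < index q s)%N}.
    by move=> p q ps qs /andP[pq qp]; apply: adm.
  exact: (index_pairwise us adm').
Qed.

(** Every admissible order may be replaced by that of increasing left ends; the
lists of pairs that arise are those of [matchings]. *)
Lemma WT_sum n (t : tens V) phi (w : word V) : homog n t ->
  (forall P, P \in partitions12 n -> admissible P (phi P)) ->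
  \sum_(P in partitions12 n) (-1) ^+ #|pairings P| *
    WT form T H (val_pairs (phi P)) t w = Qop form H T n 0 t w.
Proof.
move=> ht adm.
rewrite -(@matchings_Qop _ _ form H T n (iota 0 n) 0 [::] t w) ?size_iota ?iota_ltn_sorted //;
  last by move=> a an; rewrite /rank /= subn0 nth_iota.
rewrite -(perm_big _ (perm_canonical n)) big_map big_enum /=.
apply: eq_bigr => P PP; rewrite card_pairings //; congr (_ * _).
by rewrite (WT_canonical ht PP (adm P PP)).
Qed.

End PartitionSum.

(** * Second order Taylor expansions *)

Section PowerSeriesRemainder.

(** The terms from [n = 3] on are dominated by a geometric series of ratio at
most one half. *)
Lemma series_remainder (K : numFieldType) (u : nat -> K) (l B t : K) :
  0 <= B -> 0 <= t -> t <= 2^-1 -> (forall n, `|u n| <= B * t ^+ n) ->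
  series u @ \oo --> l -> `|l - (u 0%N + u 1%N + u 2%N)| <= 2 * B * t ^+ 3.
Proof.
move=> B0 t0 t2 ub cu.
have part n : `|series u (3 + n)%N - (u 0%N + u 1%N + u 2%N)| <=
    2 * B * t ^+ 3 * (1 - (2^-1) ^+ n).
  elim: n => [|n IH].
    rewrite seriesEnat /= !big_nat_recr //= big_geq // add0r subrr normr0.
    by rewrite expr0 subrr mulr0.
  rewrite addnS seriesEnat /= big_nat_recr //= -[\sum_(0 <= i < 3 + n) _]/(series u (3 + n)%N).
  rewrite addrAC; apply: le_trans (ler_normD _ _) _.
  apply: (@le_trans _ _ (2 * B * t ^+ 3 * (1 - 2^-1 ^+ n) + B * t ^+ 3 * 2^-1 ^+ n)).
    apply: lerD => //; apply: le_trans (ub _) _.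
    rewrite exprD mulrA ler_wpM2l ?mulr_ge0 ?exprn_ge0 //.
    by apply: lerXn2r; rewrite ?nnegrE ?invr_ge0.
  rewrite le_eqVlt; apply/orP; left; apply/eqP; rewrite [_ ^+ n.+1]exprS; by field.
apply/ler_addgt0Pr => e e0.
have /cvgrPdist_lt /(_ _ e0) [N _ HN] := cu.
have := HN (3 + N)%N (leq_addl _ _) => /= lN.
have -> : l - (u 0%N + u 1%N + u 2%N) = (l - series u (3 + N)%N) +
  (series u (3 + N)%N - (u 0%N + u 1%N + u 2%N)) by ring.
apply: le_trans (ler_normD _ _) _; rewrite addrC lerD //; last exact: ltW.
apply: le_trans (part N) _; rewrite -[X in _ <= X]mulr1 ler_wpM2l ?mulr_ge0 ?exprn_ge0 //.
Qed.

Variable R : realType.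
Implicit Types x : R.

Lemma expR_taylor2 x : `|x| <= 2^-1 ->
  `|expR x - (1 + x + x ^+ 2 / 2)| <= 2 * `|x| ^+ 3.
Proof.
move=> x2.
have := @series_remainder R (exp_coeff x) (expR x) 1 `|x| ler01 (normr_ge0 _) x2.
rewrite mulr1 /exp_coeff /= !factS fact0 /= expr0 expr1 !divr1 mul1n muln1 => H.
apply: H; last exact: is_cvg_series_exp_coeff.
move=> n; rewrite mul1r normrM normrX ler_piMr ?exprn_ge0 //.
rewrite ger0_norm ?invr_ge0 // invf_le1 ?ltr0n ?fact_gt0 //.
by rewrite ler1n fact_gt0.
Qed.

Lemma trig_coeff_le (b : bool) (k n : nat) x :
  `|b%:R * (-1) ^+ k * x ^+ n / n`!%:R| <= 1 * `|x| ^+ n.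
Proof.
rewrite !normrM normrX normrX normrN1 expr1n mulr1 mul1r mulrAC ler_piMl ?exprn_ge0 //.
rewrite normr_nat mulr_ile1 ?ler0n //; first by case: b.
rewrite ger0_norm ?invr_ge0 // invf_le1 ?ltr0n ?fact_gt0 //.
by rewrite ler1n fact_gt0.
Qed.

Lemma cos_taylor2 x : `|x| <= 2^-1 ->
  `|cos x - (1 - x ^+ 2 / 2)| <= 2 * `|x| ^+ 3.
Proof.
move=> x2.
have := @series_remainder R (cos_coeff x) (cos x) 1 `|x| ler01 (normr_ge0 _) x2.
rewrite mulr1 /cos_coeff /= !factS fact0 /= expr0 expr1 mul1n muln1.
have -> : 1 * 1 * 1 / 1%:R + 0 * 1 * x / 1%:R + 1 * (-1) ^ 1%N * x ^+ 2 / 2 =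
    1 - x ^+ 2 / 2 :> R.
  by rewrite expr1z; field.
move=> H; apply: H; last by rewrite unlock; exact: is_cvg_series_cos_coeff.
by move=> n; rewrite -exprnP; exact: trig_coeff_le.
Qed.

Lemma sin_taylor2 x : `|x| <= 2^-1 -> `|sin x - x| <= 2 * `|x| ^+ 3.
Proof.
move=> x2.
have := @series_remainder R (sin_coeff x) (sin x) 1 `|x| ler01 (normr_ge0 _) x2.
rewrite mulr1 /sin_coeff /= !factS fact0 /= expr0 expr1 mul1n muln1.
have -> : 0 * 1 * 1 / 1%:R + 1 * 1 * x / 1%:R + 0 * 1 * x ^+ 2 / 2 = x :> R.
  by field.
move=> H; apply: H; last by rewrite unlock; exact: is_cvg_series_sin_coeff.
by move=> n; exact: trig_coeff_le.
Qed.

End PowerSeriesRemainder.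

Section Jets.
Variable R : realType.
Local Notation C := (Cx R).
Implicit Types (z h : C) (f g : C -> C).

Definition nrm z : R := complex.Re `|z|.

Lemma nrmE z : `|z| = (nrm z)%:K.
Proof. by have [] := cxge0 (normr_ge0 z). Qed.

Lemma nrm_ge0 z : 0 <= nrm z.
Proof. by have [] := cxge0 (normr_ge0 z). Qed.

Lemma nrmM z h : nrm (z * h) = nrm z * nrm h.
Proof. by rewrite /nrm normrM !nrmE cxReZ. Qed.

Lemma nrmX z n : nrm (z ^+ n) = nrm z ^+ n.
Proof.
elim: n => [|n IH]; last by rewrite !exprS nrmM IH.
by rewrite !expr0 /nrm normr1.
Qed.

Lemma nrmD z h : nrm (z + h) <= nrm z + nrm h.
Proof.
by have := ler_normD z h; rewrite !nrmE lecE => /andP[_] /=.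
Qed.

Lemma nrmN z : nrm (- z) = nrm z. Proof. by rewrite /nrm normrN. Qed.
Lemma nrmB z h : nrm (z - h) <= nrm z + nrm h.
Proof. by rewrite -(nrmN h) nrmD. Qed.
Lemma nrm0 : nrm 0 = 0. Proof. by rewrite /nrm normr0. Qed.
Lemma nrm1 : nrm 1 = 1. Proof. by rewrite /nrm normr1. Qed.
Lemma nrm_eq0 z : nrm z = 0 -> z = 0.
Proof. by move=> z0; apply/eqP; rewrite -normr_eq0 nrmE z0. Qed.
Lemma nrmC (r : R) : nrm r%:K = `|r|.
Proof. by rewrite /nrm normc_def /= expr0n addr0 sqrtr_sqr. Qed.
Lemma sqr_nrm z : nrm z ^+ 2 = complex.Re z ^+ 2 + complex.Im z ^+ 2.
Proof. by rewrite /nrm normc_def /= sqr_sqrtr // addr_ge0 ?sqr_ge0. Qed.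
Lemma nrmV z : nrm z^-1 = (nrm z)^-1.
Proof.
have [->|z0] := eqVneq z 0; first by rewrite invr0 nrm0 invr0.
have n0 : nrm z != 0 by apply: contraNneq z0 => /nrm_eq0 ->.
by apply: (mulIf n0); rewrite -nrmM !mulVf // nrm1.
Qed.

Lemma nrm_le z : nrm z <= `|complex.Re z| + `|complex.Im z|.
Proof.
rewrite -ler_sqr ?nnegrE ?nrm_ge0 ?addr_ge0 // sqr_nrm.
have := real_normK (num_real (complex.Re z)); have := real_normK (num_real (complex.Im z)).
have := normr_ge0 (complex.Re z); have := normr_ge0 (complex.Im z); nra.
Qed.

Lemma cxCM (r s : R) : (r * s)%:K = r%:K * s%:K.
Proof. by apply: cxeq; rewrite ?cxReM ?cxImM /=; ring. Qed.
Lemma cxCX (r : R) n : (r ^+ n)%:K = r%:K ^+ n.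
Proof. by elim: n => [|n IH]; rewrite ?expr0 // !exprS cxCM IH. Qed.
Lemma cxC2 : (2 : R)%:K = 2.
Proof. by apply: cxeq => //=; rewrite addr0. Qed.
Lemma cxC2V : (2^-1 : R)%:K = 2^-1.
Proof.
have n2 : (2 : C) != 0 by rewrite pnatr_eq0.
by apply: (mulIf n2); rewrite mulVf // -cxC2 -cxCM mulVf // pnatr_eq0.
Qed.

(** A consequence of analyticity that suffices for the maximum principle and is
stable under sums and products by elementary estimates. *)
Definition jet2 f z0 : Prop := exists a1 a2 : C, exists K r : R,
  [/\ 0 <= K, 0 < r & forall h, nrm h < r ->
    nrm (f (z0 + h) - (f z0 + a1 * h + a2 * h ^+ 2)) <= K * nrm h ^+ 3].

Lemma jet2_cst c z0 : jet2 (fun=> c) z0.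
Proof.
exists 0, 0, 0, 1; split=> // h _.
by rewrite !mul0r !addr0 subrr nrm0.
Qed.

Lemma jet2D f g z0 : jet2 f z0 -> jet2 g z0 -> jet2 (fun z => f z + g z) z0.
Proof.
move=> [a1 [a2 [K [r [K0 r0 H]]]]] [b1 [b2 [K' [r' [K0' r0' H']]]]].
exists (a1 + b1), (a2 + b2), (K + K'), (Num.min r r'); split.
- exact: addr_ge0.
- by rewrite lt_min r0 r0'.
- move=> h; rewrite lt_min => /andP[/H h1 /H' h2].
  rewrite [X in _ <= X]mulrDl; apply: le_trans (lerD h1 h2); apply: le_trans (nrmD _ _).
  by rewrite le_eqVlt; apply/orP; left; apply/eqP; congr nrm; ring.
Qed.

Lemma jet2M f g z0 : jet2 f z0 -> jet2 g z0 -> jet2 (fun z => f z * g z) z0.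
Proof.
move=> [a1 [a2 [K [r [K0 r0 H]]]]] [b1 [b2 [K' [r' [K0' r0' H']]]]].
set f0 := f z0 in H *; set g0 := g z0 in H' *.
pose A := nrm f0 + nrm a1 + nrm a2.
pose B := nrm g0 + nrm b1 + nrm b2.
have A0 : 0 <= A by rewrite !addr_ge0 ?nrm_ge0.
have B0 : 0 <= B by rewrite !addr_ge0 ?nrm_ge0.
pose D := nrm (a1 * b2 + a2 * b1) + nrm (a2 * b2).
have D0 : 0 <= D by rewrite addr_ge0 ?nrm_ge0.
exists (a1 * g0 + f0 * b1), (a2 * g0 + a1 * b1 + f0 * b2),
  (D + K * (B + K') + A * K'), (Num.min (Num.min r r') 1); split.
- by rewrite addr_ge0 ?mulr_ge0 // addr_ge0 ?mulr_ge0 // addr_ge0.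
- by rewrite !lt_min r0 r0' ltr01.
move=> h; rewrite !lt_min => /andP[/andP[/H h1 /H' h2] h3].
have n0 := nrm_ge0 h.
set p := f (z0 + h) in h1 *; set q := g (z0 + h) in h2 *.
pose P := f0 + a1 * h + a2 * h ^+ 2; pose Q := g0 + b1 * h + b2 * h ^+ 2.
have hh (a b c : C) : nrm (a + b * h + c * h ^+ 2) <= nrm a + nrm b + nrm c.
  apply: le_trans (nrmD _ _) _; apply: lerD.
    apply: le_trans (nrmD _ _) _; rewrite lerD2l nrmM ler_piMr ?nrm_ge0 //; exact: ltW.
  by rewrite nrmM nrmX ler_piMr ?nrm_ge0 // exprn_ile1 // ltW.
have hP : nrm P <= A := hh _ _ _.
have hQ : nrm Q <= B := hh _ _ _.
have h31 : nrm h ^+ 3 <= 1 by rewrite exprn_ile1 // ltW.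
have h30 : 0 <= nrm h ^+ 3 by rewrite exprn_ge0.
have hq : nrm q <= B + K'.
  have -> : q = Q + (q - Q) by ring.
  apply: le_trans (nrmD _ _) (lerD hQ _); apply: le_trans h2 _.
  by rewrite ler_piMr.
have -> : p * q - (f0 * g0 + (a1 * g0 + f0 * b1) * h +
     (a2 * g0 + a1 * b1 + f0 * b2) * h ^+ 2) =
   ((a1 * b2 + a2 * b1) * h ^+ 3 + a2 * b2 * h ^+ 4) + (p - P) * q + P * (q - Q).
  by rewrite /P /Q; ring.
rewrite [X in _ <= X](_ : _ = D * nrm h ^+ 3 + K * (B + K') * nrm h ^+ 3 +
  A * K' * nrm h ^+ 3); last by ring.
apply: le_trans (nrmD _ _) _; apply: lerD; last first.
  by rewrite nrmM -mulrA; apply: ler_pM; rewrite ?nrm_ge0.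
apply: le_trans (nrmD _ _) _; apply: lerD; last first.
  rewrite nrmM mulrAC; apply: ler_pM; rewrite ?nrm_ge0 //.
apply: le_trans (nrmD _ _) _; rewrite /D [X in _ <= X]mulrDl; apply: lerD.
  by rewrite nrmM nrmX.
rewrite nrmM nrmX ler_wpM2l ?nrm_ge0 // exprS ler_piMl // ltW //.
Qed.

Lemma jet2_sum (I : Type) (r : seq I) (P : pred I) (F : I -> C -> C) z0 :
  (forall i, jet2 (F i) z0) -> jet2 (fun z => \sum_(i <- r | P i) F i z) z0.
Proof.
move=> jF; elim: r => [|i r IH].
  rewrite (_ : (fun z => _) = (fun=> 0)); first exact: jet2_cst.
  by apply: funext => z; rewrite big_nil.
rewrite (_ : (fun z => _) = fun z => (if P i then F i z else 0) +
   \sum_(j <- r | P j) F j z).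
  by apply: jet2D => //; case: (P i); [exact: jF|exact: jet2_cst].
by apply: funext => z; rewrite big_cons; case: (P i); rewrite ?add0r.
Qed.

Lemma jet2X f z0 n : jet2 f z0 -> jet2 (fun z => f z ^+ n) z0.
Proof.
move=> jf; elim: n => [|n IH]; first exact: jet2_cst.
rewrite (_ : (fun z => _) = fun z => f z * f z ^+ n); first exact: jet2M.
by apply: funext => z; rewrite exprS.
Qed.

Lemma jet2_inv (c z0 : C) : z0 + c != 0 -> jet2 (fun z => (z + c)^-1) z0.
Proof.
set w := z0 + c => w0.
have nw : 0 < nrm w.
  by rewrite lt_def nrm_ge0 andbT; apply: contraNneq w0 => /nrm_eq0 ->.
exists (- w^-1 ^+ 2), (w^-1 ^+ 3), (2 * (nrm w)^-1 ^+ 4), (nrm w / 2); split.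
- by rewrite mulr_ge0 // exprn_ge0 // invr_ge0 ltW.
- by rewrite divr_gt0.
move=> h hr; rewrite addrAC -/w.
have wh : nrm w / 2 <= nrm (w + h).
  have := nrmB (w + h) h; rewrite addrK; lra.
have wh0 : w + h != 0.
  by apply: contraTneq wh => ->; rewrite nrm0 -ltNge divr_gt0.
have -> : (w + h)^-1 - (w^-1 + - w^-1 ^+ 2 * h + w^-1 ^+ 3 * h ^+ 2) =
    - ((w + h)^-1 * w^-1 ^+ 3) * h ^+ 3.
  by field; rewrite wh0 w0.
rewrite nrmM nrmN nrmX ler_wpM2r ?exprn_ge0 ?nrm_ge0 // nrmM nrmX !nrmV.
have -> : 2 * (nrm w)^-1 ^+ 4 = (nrm w / 2)^-1 * (nrm w)^-1 ^+ 3.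
  by field; rewrite lt0r_neq0.
rewrite ler_wpM2r ?exprn_ge0 ?invr_ge0 ?nrm_ge0 // lef_pV2 // posrE.
  by apply: lt_le_trans wh; rewrite divr_gt0.
by rewrite divr_gt0.
Qed.

(** The terms of the power series are bounded on the circle of half the radius;
on a disc of half that size again the remainder is dominated by a geometric
series. *)
Lemma jet2_analytic f z0 : analytic_at f z0 -> jet2 f z0.
Proof.
move=> [r [a [r0 H]]].
pose h0 : C := (r / 2)%:K.
have nh0 : nrm h0 = r / 2 by rewrite nrmC ger0_norm // divr_ge0 // ltW.
have h0r : `|z0 + h0 - z0| < r%:K.
  by rewrite addrAC subrr add0r nrmE nh0 ltcR ltr_pdivrMr // ltr_pMr // ltr1n.
have [B [B0 HB]] : exists B : R, 0 <= B /\ forall k, nrm (a k * h0 ^+ k) <= B.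
  have cv : cvgn (series (fun k => a k * h0 ^+ k)).
    have := H (z0 + h0) h0r; rewrite addrAC subrr add0r.
    exact: cvgP.
  have /cvgrPdist_lt /(_ _ ltr01) [N _ HN] := cvg_series_cvg_0 cv.
  exists (1 + \sum_(k < N) nrm (a k * h0 ^+ k)); split.
    by rewrite addr_ge0 // sumr_ge0 // => i _; exact: nrm_ge0.
  move=> k; case: (ltnP k N) => kN.
    rewrite (bigD1 (Ordinal kN)) //= addrCA lerDl addr_ge0 //.
    by rewrite sumr_ge0 // => i _; exact: nrm_ge0.
  have := HN k kN; rewrite /= sub0r normrN nrmE ltcE /= => /andP[_ /ltW h].
  by apply: le_trans h _; rewrite lerDl sumr_ge0 // => i _; exact: nrm_ge0.
have rem h : nrm h < r / 4 ->
    nrm (f (z0 + h) - (a 0%N + a 1%N * h + a 2%N * h ^+ 2)) <= 2 * B * (nrm h / (r / 2)) ^+ 3.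
  move=> hr; have hr1 : `|z0 + h - z0| < r%:K.
    by rewrite addrAC subrr add0r nrmE ltcR; lra.
  have := H _ hr1; rewrite addrAC subrr add0r => cv.
  pose t : R := nrm h / (r / 2).
  have t0 : 0 <= t by rewrite divr_ge0 ?nrm_ge0 // divr_ge0 // ltW.
  have t2 : t <= 2^-1.
    rewrite ler_pdivrMr ?divr_gt0 //; apply: ltW; apply: lt_le_trans hr _.
    by rewrite le_eqVlt; apply/orP; left; apply/eqP; field.
  have B0' : 0 <= B%:K by rewrite ler0c.
  have t0' : 0 <= t%:K by rewrite ler0c.
  have t2' : t%:K <= 2^-1 by rewrite -cxC2V lecR.
  have ub n : `|a n * h ^+ n| <= B%:K * t%:K ^+ n.
    rewrite -cxCX -cxCM nrmE lecR.
    have hE : nrm h ^+ n = nrm h0 ^+ n * t ^+ n.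
      by rewrite -exprMn nh0 /t mulrC divfK // lt0r_neq0 // divr_gt0.
    by rewrite nrmM nrmX hE mulrA -nrmX -nrmM ler_wpM2r ?exprn_ge0 //; exact: HB.
  have := series_remainder B0' t0' t2' ub cv.
  by rewrite expr0 expr1 mulr1 nrmE -cxC2 -cxCX -!cxCM lecR.
have f0 : f z0 = a 0%N.
  have := rem 0; rewrite nrm0 addr0 mul0r !(expr0n, mulr0, addr0) divr_gt0 // => /(_ isT) h.
  have : nrm (f z0 - a 0%N) = 0 by apply/eqP; rewrite eq_le h nrm_ge0.
  by move/nrm_eq0/eqP; rewrite subr_eq0 => /eqP.
exists (a 1%N), (a 2%N), (2 * B / (r / 2) ^+ 3), (r / 4); split.
- by apply: divr_ge0; [exact: mulr_ge0|apply: exprn_ge0; rewrite divr_ge0 // ltW].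
- by rewrite divr_gt0.
- move=> h /rem; rewrite f0 => le; apply: le_trans le _.
  by rewrite expr_div_n le_eqVlt; apply/orP; left; apply/eqP; ring.
Qed.

Lemma jet2_lip f z0 : jet2 f z0 -> exists A r : R, [/\ 0 <= A, 0 < r &
  forall h, nrm h < r -> nrm (f (z0 + h) - f z0) <= A * nrm h].
Proof.
move=> [a1 [a2 [K [r [K0 r0 H]]]]].
exists (nrm a1 + nrm a2 + K), (Num.min r 1); split.
- by rewrite addr_ge0 // addr_ge0 ?nrm_ge0.
- by rewrite lt_min r0 ltr01.
move=> h; rewrite lt_min => /andP[hr /ltW h1].
have n0 := nrm_ge0 h.
have -> : f (z0 + h) - f z0 = (f (z0 + h) - (f z0 + a1 * h + a2 * h ^+ 2)) +
   (a1 * h + a2 * h ^+ 2) by ring.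
apply: le_trans (nrmD _ _) _.
have e1 : K * nrm h ^+ 3 <= K * nrm h.
  by rewrite ler_wpM2l // exprS ler_piMr // exprn_ile1.
have e2 : nrm (a1 * h + a2 * h ^+ 2) <= nrm a1 * nrm h + nrm a2 * nrm h.
  apply: le_trans (nrmD _ _) _; rewrite (nrmM a1) (nrmM a2) nrmX lerD2l.
  by rewrite ler_wpM2l ?nrm_ge0 // expr2 ler_piMr.
have := H h hr; rewrite !mulrDl; lra.
Qed.

(** [t |-> x ^ (i t)] for [x > 0] and [L = ln x], continued to complex [t]. *)
Definition cexp (L : R) z : C := (expR (- (L * complex.Im z)))%:K *
  (cos (complex.Re z * L) +i* sin (complex.Re z * L))%C.

Lemma cexpD L z h : cexp L (z + h) = cexp L z * cexp L h.
Proof.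
rewrite /cexp cxReD cxImD mulrDr opprD expRD mulrDl cosD sinD cxCM.
by apply: cxeq; rewrite !(cxReM, cxImM) /=; ring.
Qed.

Lemma cexp_jet0 L : exists a1 a2 : C, exists K r : R, [/\ 0 <= K, 0 < r &
  forall h, nrm h < r ->
    nrm (cexp L h - (1 + a1 * h + a2 * h ^+ 2)) <= K * nrm h ^+ 3].
Proof.
pose k := `|L| + 1.
have k0 : 0 < k by rewrite ltr_wpDl.
pose a1 : C := (0 +i* L)%C.
exists a1, (a1 ^+ 2 / 2), (20 * k ^+ 3), (2^-1 / k); split.
- by rewrite mulr_ge0 // exprn_ge0 // ltW.
- by rewrite divr_gt0 // invr_gt0.
move=> h hr; pose m := k * nrm h.
have m2 : m <= 2^-1 by rewrite /m mulrC -ler_pdivlMr // ltW.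
have m0 : 0 <= m by rewrite mulr_ge0 ?nrm_ge0 // ltW.
have ReIm : `|complex.Re h| <= nrm h /\ `|complex.Im h| <= nrm h.
  split; rewrite -[X in X <= _]ger0_norm // -ler_sqr ?nnegrE ?nrm_ge0 //;
    rewrite normr_id real_normK ?num_real // sqr_nrm; nra.
pose u := - (L * complex.Im h); pose th := complex.Re h * L.
have Lk : `|L| <= k by rewrite lerDl.
have hu : `|u| <= m.
  by rewrite normrN normrM; apply: ler_pM => //; case: ReIm.
have ht : `|th| <= m.
  by rewrite normrM mulrC; apply: ler_pM => //; case: ReIm.
have h3 (x : R) : `|x| <= m -> 2 * `|x| ^+ 3 <= 2 * m ^+ 3.
  by move=> xm; rewrite ler_wpM2l // lerXn2r ?nnegrE.
have lx2 (x : R) : `|x| <= m -> `|x| ^+ 2 <= m ^+ 2.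
  by move=> xm; rewrite lerXn2r ?nnegrE.
have e1 := le_trans (expR_taylor2 (le_trans hu m2)) (h3 _ hu).
have e2 := le_trans (cos_taylor2 (le_trans ht m2)) (h3 _ ht).
have e3 := le_trans (sin_taylor2 (le_trans ht m2)) (h3 _ ht).
pose p := 1 + u + u ^+ 2 / 2; pose q : C := ((1 - th ^+ 2 / 2) +i* th)%C.
pose v : C := (u +i* th)%C.
have vE : v = a1 * h.
  by apply: cxeq; rewrite ?cxReM ?cxImM /= /u /th; ring.
have -> : 1 + a1 * h + a1 ^+ 2 / 2 * h ^+ 2 = 1 + v + v ^+ 2 / 2.
  by rewrite vE; field.
pose Q : C := (cos th +i* sin th)%C; pose E : R := expR u.
rewrite -[cexp L h]/(E%:K * Q).
have -> : E%:K * Q - (1 + v + v ^+ 2 / 2) = (E - p)%:K * Q + p%:K * (Q - q) +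
    (p%:K * q - (1 + v + v ^+ 2 / 2)).
  by rewrite /p; apply: cxeq; rewrite !(cxReM, cxImM, cxReD, cxImD, cxReN, cxImN) /=; ring.
have K3 : 20 * k ^+ 3 * nrm h ^+ 3 = 20 * m ^+ 3 by rewrite /m; ring.
rewrite K3.
have nQ : nrm Q = 1.
  by apply/eqP; rewrite -(eqrXn2 (n := 2)) ?nrm_ge0 // sqr_nrm /= cos2Dsin2 expr1n.
have n1 : nrm ((E - p)%:K * Q) <= 2 * m ^+ 3 by rewrite nrmM nQ mulr1 nrmC.
have pb : `|p| <= 2.
  apply: le_trans (ler_normD _ _) _; apply: (@le_trans _ _ (1 + m + m ^+ 2 / 2)).
    apply: lerD; first by apply: le_trans (ler_normD _ _) _; rewrite normr1 lerD2l.
    rewrite normrM normrX [`|2^-1|]ger0_norm ?invr_ge0 // ler_wpM2r ?invr_ge0 //.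
    by rewrite lerXn2r ?nnegrE.
  nra.
have n2 : nrm (Q - q) <= 4 * m ^+ 3.
  apply: le_trans (nrm_le _) _; rewrite cxReD cxImD cxReN cxImN /=.
  by apply: le_trans (lerD e2 e3) _; lra.
have n3 : nrm (p%:K * (Q - q)) <= 2 * (4 * m ^+ 3).
  by rewrite nrmM nrmC; apply: ler_pM; rewrite ?nrm_ge0.
have m3 : 0 <= m ^+ 3 by rewrite exprn_ge0.
have n4 : nrm (p%:K * q - (1 + v + v ^+ 2 / 2)) <= 2 * m ^+ 3.
  have -> : p%:K * q - (1 + v + v ^+ 2 / 2) =
     ((- (u * th ^+ 2 / 2) - u ^+ 2 * th ^+ 2 / 4) +i* (u ^+ 2 * th / 2))%C.
    rewrite -cxC2V expr2; apply: cxeq; rewrite !(cxReM, cxImM, cxReD, cxImD, cxReN, cxImN) /=.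
      by rewrite /p; field.
    by rewrite /p; field.
  apply: le_trans (nrm_le _) _ => /=.
  have t1 : `|u * th ^+ 2 / 2| <= m ^+ 3 / 2.
    rewrite (normrM _ 2^-1) (normrM u) normrX [`|2^-1|]ger0_norm ?invr_ge0 // ler_wpM2r ?invr_ge0 //.
    by rewrite exprS; apply: ler_pM; rewrite ?exprn_ge0 ?lx2.
  have t2 : `|u ^+ 2 * th / 2| <= m ^+ 3 / 2.
    rewrite (normrM _ 2^-1) (normrM (u ^+ 2)) normrX [`|2^-1|]ger0_norm ?invr_ge0 // ler_wpM2r ?invr_ge0 //.
    have -> : m ^+ 3 = m ^+ 2 * m by ring.
    by apply: ler_pM; rewrite ?exprn_ge0 ?lx2.
  have t3 : `|u ^+ 2 * th ^+ 2 / 4| <= m ^+ 3 / 4.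
    rewrite (normrM _ 4^-1) (normrM (u ^+ 2)) !normrX [`|4^-1|]ger0_norm ?invr_ge0 // ler_wpM2r ?invr_ge0 //.
    apply: (@le_trans _ _ (m ^+ 2 * m ^+ 2)).
      by apply: ler_pM; rewrite ?exprn_ge0 ?lx2.
    have -> : m ^+ 3 = m ^+ 2 * m by ring.
    by rewrite ler_wpM2l ?sqr_ge0 // expr2 ler_piMr //; lra.
  have := ler_normB (- (u * th ^+ 2 / 2)) (u ^+ 2 * th ^+ 2 / 4).
  rewrite normrN; lra.
apply: le_trans (nrmD _ _) _.
have := nrmD ((E - p)%:K * Q) (p%:K * (Q - q)); lra.
Qed.

Lemma cexp0 L : cexp L 0 = 1.
Proof.
by rewrite /cexp /= mulr0 oppr0 expR0 mul0r cos0 sin0 mul1r.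
Qed.

Lemma cexp_jet2 L z0 : jet2 (cexp L) z0.
Proof.
have [a1 [a2 [K [r [K0 r0 HK]]]]] := cexp_jet0 L.
pose c := cexp L z0.
exists (c * a1), (c * a2), (nrm c * K), r; split=> //.
  by rewrite mulr_ge0 ?nrm_ge0.
move=> h /HK le; rewrite cexpD -/c.
have -> : c * cexp L h - (c + c * a1 * h + c * a2 * h ^+ 2) =
   c * (cexp L h - (1 + a1 * h + a2 * h ^+ 2)) by ring.
by rewrite nrmM -mulrA ler_wpM2l ?nrm_ge0.
Qed.

End Jets.

(** * The maximum principle and uniqueness on the strip *)

Section MaximumPrinciple.
Variable R : realType.
Local Notation C := (Cx R).
Implicit Types (z h w : C) (f g : C -> C) (A : set C).

Definition cont_on A f : Prop := forall z, A z -> forall eps : R, 0 < eps ->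
  exists2 dl : R, 0 < dl & forall w, A w -> nrm (w - z) < dl -> nrm (f w - f z) < eps.

Lemma cont_on_sub A A' f : A' `<=` A -> cont_on A f -> cont_on A' f.
Proof.
move=> AA cf z /AA Az eps e0; have [dl d0 H] := cf z Az eps e0.
by exists dl => // w /AA; exact: H.
Qed.

Lemma cont_onB A f g : cont_on A f -> cont_on A g -> cont_on A (fun z => f z - g z).
Proof.
move=> cf cg z Az eps e0; have e2 : 0 < eps / 2 by rewrite divr_gt0.
have [d1 d10 H1] := cf z Az _ e2; have [d2 d20 H2] := cg z Az _ e2.
exists (Num.min d1 d2); first by rewrite lt_min d10 d20.
move=> w Aw; rewrite lt_min => /andP[/(H1 w Aw) h1 /(H2 w Aw) h2].
have -> : f w - g w - (f z - g z) = (f w - f z) - (g w - g z) by ring.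
by apply: le_lt_trans (nrmB _ _) _; lra.
Qed.

Lemma cont_onM A f g : cont_on A f -> cont_on A g -> cont_on A (fun z => f z * g z).
Proof.
move=> cf cg z Az eps e0.
pose M := nrm (f z) + nrm (g z) + 1.
have M1 : 1 <= M by rewrite lerDr addr_ge0 ?nrm_ge0.
have M0 : 0 < M by apply: lt_le_trans M1.
have e2 : 0 < Num.min (eps / (4 * M)) 1.
  by rewrite lt_min ltr01 divr_gt0 ?mulr_gt0.
have [d1 d10 H1] := cf z Az _ e2; have [d2 d20 H2] := cg z Az _ e2.
exists (Num.min d1 d2); first by rewrite lt_min d10 d20.
move=> w Aw; rewrite lt_min => /andP[/(H1 w Aw) + /(H2 w Aw)].
rewrite !lt_min => /andP[h1 _] /andP[h2 h2'].
have -> : f w * g w - f z * g z = (f w - f z) * g w + f z * (g w - g z) by ring.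
apply: le_lt_trans (nrmD _ _) _; rewrite !nrmM.
have gw : nrm (g w) <= M.
  have -> : g w = g z + (g w - g z) by ring.
  apply: le_trans (nrmD _ _) _; have := nrm_ge0 (f z); rewrite /M; lra.
have fz : nrm (f z) <= M by have := nrm_ge0 (g z); rewrite /M; lra.
have t1 : nrm (f w - f z) * nrm (g w) <= eps / (4 * M) * M.
  by apply: ler_pM; rewrite ?nrm_ge0 // ltW.
have t2 : nrm (f z) * nrm (g w - g z) <= M * (eps / (4 * M)).
  by apply: ler_pM; rewrite ?nrm_ge0 // ltW.
have E : eps / (4 * M) * M = eps / 4 by field; rewrite lt0r_neq0.
rewrite [X in _ <= X]mulrC E in t2; rewrite E in t1; lra.
Qed.

Lemma cont_on_jet A f : (forall z, A z -> jet2 f z) -> cont_on A f.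
Proof.
move=> jf z Az eps e0; have [B [r [B0 r0 H]]] := jet2_lip (jf z Az).
exists (Num.min r (eps / (B + 1))).
  by rewrite lt_min r0 divr_gt0 // ltr_wpDl.
move=> w Aw; rewrite lt_min => /andP[wr we].
have -> : w = z + (w - z) by ring.
apply: le_lt_trans (H _ wr) _.
have B1 : 0 < B + 1 by rewrite ltr_wpDl.
rewrite ltr_pdivlMr // in we.
have := nrm_ge0 (w - z); nra.
Qed.

Lemma nrm_lt_norm z (e : R) : (nrm z < e) = (`|z| < e%:K).
Proof. by rewrite nrmE ltcR. Qed.

Lemma cont_on_within A f : {within A, continuous f} -> cont_on A f.
Proof.
move=> /subspace_continuousP cf z Az eps e0.
have e0' : 0 < eps%:K :> C by rewrite ltcR.
have /cvgrPdist_lt /(_ _ e0') := cf z Az.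
rewrite /within /= => /nbhs_ballP[d /= d0 H].
have [dE d0'] := cxgt0 d0.
exists (complex.Re d) => // w Aw wz; rewrite nrm_lt_norm distrC.
apply: H => //; rewrite /ball /= dE distrC; by rewrite -nrm_lt_norm.
Qed.

Definition rect : set C := [set z | [/\ -2 <= complex.Re z, complex.Re z <= 2,
  0 <= complex.Im z & complex.Im z <= 2^-1]].

Let zz (p : R * R) : C := (p.1 +i* p.2)%C.
Let rr : set (R * R) := `[-2, 2]%classic `*` `[0, 2^-1]%classic.

Lemma rr_rect p : rr p <-> rect (zz p).
Proof.
rewrite /rr /rect /= !in_itv /=; split.
  by move=> [/andP[-> ->] /andP[-> ->]].
by move=> [-> -> -> ->].
Qed.

Lemma rect_max f (dl : R) : cont_on rect f ->
  exists2 z0, rect z0 & forall z, rect z ->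
    nrm (f z) + dl * nrm z ^+ 2 <= nrm (f z0) + dl * nrm z0 ^+ 2.
Proof.
move=> cf; pose phi p := nrm (f (zz p)) + dl * (p.1 ^+ 2 + p.2 ^+ 2).
have cq : continuous (fun q : R * R => dl * (q.1 ^+ 2 + q.2 ^+ 2)).
  move=> q; have -> : (fun q : R * R => dl * (q.1 ^+ 2 + q.2 ^+ 2)) =
    (fun q => dl * (q.1 * q.1 + q.2 * q.2)) by apply: funext => q'; rewrite !expr2.
  apply: cvgM; first exact: cvg_cst.
  apply: cvgD; apply: cvgM; by [exact: cvg_fst|exact: cvg_snd].
have [] := @compact_EVT_max _ R phi rr.
- exists (0, 0); apply/rr_rect; split => //=; rewrite ?invr_ge0 //; lra.
- by apply: compact_setX; exact: segment_compact.
- apply/subspace_continuousP => p rp; apply: cvgD; last first.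
    exact: cvg_within_filter (cq p).
  apply/cvgrPdist_lt => eps e0.
  have [eta n0 H] := cf _ ((rr_rect p).1 rp) eps e0.
  have n2 : 0 < eta / 2 by rewrite divr_gt0.
  have /cvgrPdist_lt /(_ _ n2) N1 : fst q @[q --> nbhs p] --> p.1 by exact: cvg_fst.
  have /cvgrPdist_lt /(_ _ n2) N2 : snd q @[q --> nbhs p] --> p.2 by exact: cvg_snd.
  near=> q.
  have rq : rr q by near: q; exact: withinT.
  have q1 : `|p.1 - q.1| < eta / 2 by near: q; exact: cvg_within N1.
  have q2 : `|p.2 - q.2| < eta / 2 by near: q; exact: cvg_within N2.
  have lt : nrm (f (zz q) - f (zz p)) < eps.
    apply: H; first exact/rr_rect.
    apply: le_lt_trans (nrm_le _) _; rewrite cxReD cxImD cxReN cxImN /=.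
    by rewrite distrC [`|q.2 - _|]distrC; lra.
  rewrite ltr_distlC; apply/andP; split.
    have := nrmB (f (zz q)) (f (zz q) - f (zz p)).
    by rewrite opprB addrCA subrr addr0; lra.
  have := nrmD (f (zz p)) (f (zz q) - f (zz p)).
  by rewrite addrCA subrr addr0; lra.
move=> p /set_mem rp H; exists (zz p); first exact/rr_rect.
move=> z rz; have zE : z = zz (complex.Re z, complex.Im z) by exact: cxE.
have rrz : rr (complex.Re z, complex.Im z) by apply/rr_rect; rewrite -zE.
have := H _ (mem_set rrz); rewrite /phi -zE /=.
by rewrite !sqr_nrm.
Unshelve. all: end_near. Qed.

(** At an interior maximum of [|f| + dl |z|^2], the mean over the four points
[z0 +- r], [z0 +- i r] would be too large: the Taylor terms of [f] of degree
1 and 2 cancel in this mean, so that it loses only a multiple of [r ^+ 3]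
and gains [dl * r ^+ 2]. *)
Lemma max_principle f (m : R) : cont_on rect f ->
  (forall z, -2 < complex.Re z < 2 -> 0 < complex.Im z < 2^-1 -> jet2 f z) ->
  (forall z, rect z -> [\/ complex.Re z = -2, complex.Re z = 2, complex.Im z = 0 |
     complex.Im z = 2^-1] -> nrm (f z) <= m) ->
  forall z, rect z -> nrm (f z) <= m.
Proof.
move=> cf jf bd z1 rz1; rewrite leNgt; apply/negP => lt1.
pose dl := (nrm (f z1) - m) / 10.
have dl0 : 0 < dl by rewrite divr_gt0 // subr_gt0.
have dlE : nrm (f z1) = m + 10 * dl by rewrite /dl; field.
have [z0 rz0 max0] := rect_max dl cf.
have n5 z : rect z -> nrm z ^+ 2 <= 5.
  by rewrite sqr_nrm => -[h1 h2 h3 h4]; nra.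
have big : m + 5 * dl <= nrm (f z0).
  have p1 : 0 <= dl * nrm z1 ^+ 2 by rewrite mulr_ge0 ?sqr_ge0 // ltW.
  have p2 : dl * nrm z0 ^+ 2 <= dl * 5 by rewrite ler_wpM2l ?n5 // ltW.
  by have := max0 _ rz1; rewrite dlE; lra.
have inner : (-2 < complex.Re z0 < 2) && (0 < complex.Im z0 < 2^-1).
  have nb (x : Prop) : [\/ complex.Re z0 = -2, complex.Re z0 = 2, complex.Im z0 = 0 |
     complex.Im z0 = 2^-1] -> x.
    by move=> /(bd _ rz0) le; exfalso; lra.
  case: rz0 => h1 h2 h3 h4.
  have i1 : -2 < complex.Re z0.
    by rewrite lt_def h1 andbT; apply/eqP => e; apply: nb; constructor 1.
  have i2 : complex.Re z0 < 2.
    by rewrite lt_def h2 andbT; apply/eqP => e; apply: nb; constructor 2.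
  have i3 : 0 < complex.Im z0.
    by rewrite lt_def h3 andbT; apply/eqP => e; apply: nb; constructor 3.
  have i4 : complex.Im z0 < 2^-1.
    by rewrite lt_def h4 andbT; apply/eqP => e; apply: nb; constructor 4.
  by rewrite i1 i2 i3 i4.
case/andP: inner => re0 im0.
have [a1 [a2 [K [r0 [K0 r00 HK]]]]] := jf _ re0 im0.
case/andP: re0 => x1 x2; case/andP: im0 => y1 y2.
set x := complex.Re z0 in x1 x2; set y := complex.Im z0 in y1 y2.
pose r := Num.min (Num.min (Num.min (x + 2) (2 - x)) (Num.min y (2^-1 - y)))
  (Num.min r0 (dl / (K + 1))) / 2.
have K1 : 0 < K + 1 by rewrite ltr_wpDl.
have rpos : 0 < r.
  rewrite divr_gt0 // !lt_min r00 divr_gt0 // y1.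
  by rewrite !subr_gt0 x2 y2 -ltrBlDr sub0r x1.
have rlt : r < r *+ 2 by rewrite mulr2n ltrDl.
rewrite {2}/r -mulr_natr divfK ?pnatr_eq0 // !lt_min in rlt.
case/andP: rlt => /andP[/andP[ra rb] /andP[rc rd]] /andP[re rf].
pose S (h : C) := nrm (f (z0 + h)) + dl * nrm (z0 + h) ^+ 2.
have Sle (a b : R) : `|a| <= r -> `|b| <= r -> S (a +i* b)%C <= S 0.
  move=> ar br; rewrite /S addr0; apply: max0.
  have := ler_norm a; have := ler_norm (- a); have := ler_norm b; have := ler_norm (- b).
  rewrite !normrN => b1 b2 a3 a4.
  by split; rewrite ?cxReD ?cxImD /= -/x -/y; lra.
have nr : `|r| = r by rewrite ger0_norm // ltW.
have r00' : `|(0 : R)| <= r by rewrite (@normr0 _ R) ltW.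
pose h1 : C := (r +i* 0)%C; pose h2 : C := ((- r) +i* 0)%C.
pose h3 : C := (0 +i* r)%C; pose h4 : C := (0 +i* (- r))%C.
have s1 : S h1 <= S 0 by apply: Sle; rewrite ?nr.
have s2 : S h2 <= S 0 by apply: Sle; rewrite ?normrN ?nr.
have s3 : S h3 <= S 0 by apply: Sle; rewrite ?nr.
have s4 : S h4 <= S 0 by apply: Sle; rewrite ?normrN ?nr.
have nE (h : C) : complex.Re h ^+ 2 + complex.Im h ^+ 2 = r ^+ 2 -> nrm h = r.
  move=> e; apply/eqP; rewrite -(eqrXn2 (n := 2)) ?nrm_ge0 ?(ltW rpos) //.
  by rewrite sqr_nrm e.
have n1 : nrm h1 = r by apply: nE => /=; ring.
have n2 : nrm h2 = r by apply: nE => /=; ring.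
have n3 : nrm h3 = r by apply: nE => /=; ring.
have n4 : nrm h4 = r by apply: nE => /=; ring.
pose rho h := f (z0 + h) - (f z0 + a1 * h + a2 * h ^+ 2).
have k1 : nrm (rho h1) <= K * r ^+ 3 by have := HK h1; rewrite n1; apply.
have k2 : nrm (rho h2) <= K * r ^+ 3 by have := HK h2; rewrite n2; apply.
have k3 : nrm (rho h3) <= K * r ^+ 3 by have := HK h3; rewrite n3; apply.
have k4 : nrm (rho h4) <= K * r ^+ 3 by have := HK h4; rewrite n4; apply.
have sum0 : h1 + h2 + h3 + h4 = 0 by apply: cxeq; rewrite !(cxReD, cxImD) /=; ring.
have sum2 : h1 ^+ 2 + h2 ^+ 2 + h3 ^+ 2 + h4 ^+ 2 = 0.
  by rewrite !expr2; apply: cxeq; rewrite !(cxReD, cxImD, cxReM, cxImM) /=; ring.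
have mean : f (z0 + h1) + f (z0 + h2) + f (z0 + h3) + f (z0 + h4) -
    (rho h1 + rho h2 + rho h3 + rho h4) = 4 * f z0.
  transitivity (4 * f z0 + a1 * (h1 + h2 + h3 + h4) +
     a2 * (h1 ^+ 2 + h2 ^+ 2 + h3 ^+ 2 + h4 ^+ 2)); first by rewrite /rho; ring.
  by rewrite sum0 sum2; ring.
have lower : 4 * nrm (f z0) <= nrm (f (z0 + h1)) + nrm (f (z0 + h2)) +
    nrm (f (z0 + h3)) + nrm (f (z0 + h4)) + 4 * (K * r ^+ 3).
  have -> : 4 * nrm (f z0) = nrm (4 * f z0).
    by rewrite nrmM (_ : (4 : C) = (4 : R)%:K) ?nrmC ?ger0_norm //;
      apply: cxeq => //=; ring.
  rewrite -mean; apply: le_trans (nrmB _ _) _.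
  have t1 := nrmD (f (z0 + h1) + f (z0 + h2) + f (z0 + h3)) (f (z0 + h4)).
  have t2 := nrmD (f (z0 + h1) + f (z0 + h2)) (f (z0 + h3)).
  have t3 := nrmD (f (z0 + h1)) (f (z0 + h2)).
  have t4 := nrmD (rho h1 + rho h2 + rho h3) (rho h4).
  have t5 := nrmD (rho h1 + rho h2) (rho h3).
  have t6 := nrmD (rho h1) (rho h2).
  lra.
have gain : nrm (z0 + h1) ^+ 2 + nrm (z0 + h2) ^+ 2 + nrm (z0 + h3) ^+ 2 +
    nrm (z0 + h4) ^+ 2 = 4 * nrm z0 ^+ 2 + 4 * r ^+ 2.
  by rewrite !sqr_nrm !(cxReD, cxImD) /=; ring.
have : dl * (4 * r ^+ 2) <= 4 * (K * r ^+ 3).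
  move: s1 s2 s3 s4; rewrite /S addr0 => s1 s2 s3 s4.
  have := congr1 ( *%R dl) gain; rewrite !mulrDr => e; lra.
have r2 : 0 < r ^+ 2 by rewrite exprn_gt0.
have e3 : r ^+ 3 = r * r ^+ 2 by rewrite exprS.
rewrite ltr_pdivlMr // in rf.
rewrite e3; nra.
Qed.

(** Compare [f] with the powers of [1 / (z + i)]. On the boundary of the
rectangle, apart from the lower edge where [f] vanishes, [1 / (z + i)] is
smaller than at the points [i y] with [y < 1 / 2], so that [f] vanishes at
these points; then [y] tends to [1 / 2]. *)
Lemma strip_unique f : cont_on (@strip R) f ->
  (forall z, 0 < complex.Im z < 2^-1 -> jet2 f z) ->
  (forall t : R, f t%:K = 0) -> f (0 +i* 2^-1)%C = 0.
Proof.
move=> cf jf f0.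
have rs : rect `<=` @strip R by move=> z [_ _ h1 h2].
have cfr := cont_on_sub rs cf.
have rect0 : rect 0 by split => //=; rewrite ?invr_ge0 //; lra.
have [zM rzM maxM] := rect_max 0 cfr.
pose M := nrm (f zM).
have HM z : rect z -> nrm (f z) <= M.
  by move=> /maxM; rewrite !mul0r !addr0.
have M0 : 0 <= M := nrm_ge0 _.
pose ii : C := (0 +i* 1)%C.
have ni z : rect z -> z + ii != 0.
  move=> [_ _ h1 _]; apply/eqP => /(congr1 (@complex.Im R)); rewrite cxImD /=; lra.
pose mu z := (z + ii)^-1.
have jm z : rect z -> jet2 mu z by move=> rz; apply: jet2_inv; exact: ni.
have nmu z : nrm (mu z) ^+ 2 = (complex.Re z ^+ 2 + (complex.Im z + 1) ^+ 2)^-1.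
  by rewrite nrmV exprVn sqr_nrm cxReD cxImD /= addr0.
have mu0 z : 0 <= nrm (mu z) := nrm_ge0 _.
have bound N z : rect z -> nrm (f z * mu z ^+ N) <= M * (2 / 3) ^+ N.
  move: z; apply: (@max_principle (fun z => f z * mu z ^+ N)).
  - by apply: cont_onM => //; apply: cont_on_jet => w rw; apply: jet2X; exact: jm.
  - move=> w /andP[h1 h2] /andP[h3 h4]; apply: jet2M; first by apply: jf; rewrite h3 h4.
    by apply: jet2X; apply: jm; split; apply: ltW.
  - move=> w rw bw; rewrite nrmM nrmX.
    have edge : complex.Im w = 0 \/ nrm (mu w) <= 2 / 3.
      have sq : (complex.Re w ^+ 2 + (complex.Im w + 1) ^+ 2)^-1 <= (2 / 3) ^+ 2 ->
          nrm (mu w) <= 2 / 3.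
        by rewrite -nmu => h; rewrite -ler_sqr ?nnegrE // divr_ge0.
      have low : 9 / 4 <= complex.Re w ^+ 2 + (complex.Im w + 1) ^+ 2 ->
          nrm (mu w) <= 2 / 3.
        move=> h; apply: sq.
        have -> : (2 / 3) ^+ 2 = (9 / 4)^-1 :> R by field.
        by rewrite lef_pV2 // posrE; lra.
      case: rw => h1 h2 h3 h4.
      case: bw => e; [right|right|left|right] => //; apply: low; rewrite e; nra.
    case: edge => [w0|mw].
      have -> : w = (complex.Re w)%:K by apply: cxeq.
      by rewrite f0 nrm0 mul0r mulr_ge0 // exprn_ge0 // divr_ge0.
    apply: ler_pM; rewrite ?nrm_ge0 ?exprn_ge0 //; first exact: HM.
    by rewrite lerXn2r ?nnegrE // divr_ge0.
(* At [i y] the function [mu] has modulus [1 / (1 + y) > 2 / 3], so that the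
   bound forces [f] to vanish there as [N] grows. *)
have mid y : 0 <= y -> y < 2^-1 -> f (0 +i* y)%C = 0.
  move=> y0 y1; apply: nrm_eq0; apply/eqP; rewrite eq_le nrm_ge0 andbT.
  set g := nrm _.
  pose k := (1 + y) * (2 / 3).
  have k0 : 0 <= k by rewrite mulr_ge0 ?addr_ge0 // divr_ge0.
  have k1 : k < 1 by rewrite /k; lra.
  have gN N : g <= M * k ^+ N.
    have rz : rect (0 +i* y)%C by split => //=; lra.
    have := bound N _ rz; rewrite nrmM nrmX -/g.
    have -> : nrm (mu (0 +i* y)%C) = (1 + y)^-1.
      apply/eqP; rewrite -(eqrXn2 (n := 2)) ?nrm_ge0 ?invr_ge0 ?addr_ge0 //.
      by rewrite nmu /= expr0n add0r exprVn addrC.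
    have p : 0 < (1 + y) ^+ N by rewrite exprn_gt0 // ltr_pwDl.
    by rewrite exprVn ler_pdivrMr // -mulrA -exprMn [_ * (1 + y)]mulrC.
  apply/ler_addgt0Pr => e e0; rewrite add0r.
  have ek : 0 < e / (M + 1) by rewrite divr_gt0 // ltr_wpDl.
  have ck : GRing.exp k @ \oo --> 0 by apply: cvg_expr; rewrite ger0_norm.
  have /cvgrPdist_lt /(_ _ ek) [N _ HN] := ck.
  have := HN N (leqnn N); rewrite /= sub0r normrN ger0_norm ?exprn_ge0 //.
  rewrite ltr_pdivlMr ?ltr_wpDl // => h; apply: le_trans (gN N) _.
  have := exprn_ge0 N k0; nra.
apply: nrm_eq0; apply/eqP; rewrite eq_le nrm_ge0 andbT.
apply/ler_addgt0Pr => e e0; rewrite add0r.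
have sI : @strip R (0 +i* 2^-1)%C by split => //=; rewrite invr_ge0.
have [dl d0 H] := cf _ sI _ e0.
pose y : R := Num.max 0 (2^-1 - dl / 2).
have y0 : 0 <= y by rewrite le_max lexx.
have y1 : y < 2^-1 by rewrite gt_max invr_gt0 ltr0n /= ltrBlDr ltrDl divr_gt0.
have yd : 2^-1 - dl / 2 <= y by rewrite le_max lexx orbT.
have sy : @strip R (0 +i* y)%C by split => //=; exact: ltW.
have := H _ sy; rewrite mid // sub0r nrmN => h; apply: ltW; apply: h.
apply: le_lt_trans (nrm_le _) _; rewrite cxReD cxImD cxReN cxImN /= subrr normr0 add0r.
by rewrite ler0_norm ?subr_le0 ?(ltW y1) //; lra.
Qed.

End MaximumPrinciple.

(** * The Tomita operator in finite dimension *)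

Section Tomita.
Variables (R : realType) (V : vectType (Cx R)) (form : {dot V for Num.conj}).
Local Notation C := (Cx R).
Variable H : set V.
Hypothesis hH : standard_subspace form H.
Local Notation S := (tomita H).

Lemma std_sub h h' : H h -> H h' -> H (h - h').
Proof.
move=> Hh Hh'; apply: (std_add hH) => //.
have := std_scale hH (-1) Hh'; congr H.
have -> : ((-1 : R)%:K : C) = -1 by apply: cxeq => //=; rewrite oppr0.
by rewrite scaleN1r.
Qed.

Definition Hspan (v : V) : Prop := exists h h' : V, [/\ H h, H h' & v = h + 'i *: h'].

Lemma Hspan0 : Hspan 0.
Proof.
by exists 0, 0; split; rewrite ?scaler0 ?addr0 //; exact: std_zero hH.
Qed.

Lemma HspanD u v : Hspan u -> Hspan v -> Hspan (u + v).
Proof.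
move=> [h [h' [Hh Hh' ->]]] [k [k' [Hk Hk' ->]]].
exists (h + k), (h' + k'); split; try exact: (std_add hH).
by rewrite scalerDr addrACA.
Qed.

Lemma scale_rect (a : C) (h h' : V) : a *: (h + 'i *: h') =
  ((complex.Re a)%:K *: h - (complex.Im a)%:K *: h') +
  'i *: ((complex.Im a)%:K *: h + (complex.Re a)%:K *: h').
Proof.
rewrite scalerDr [in RHS]scalerDr !scalerA addrACA [X in _ = _ + X]addrC -!addrA.
have E1 : a = (complex.Re a)%:K + 'i * (complex.Im a)%:K.
  by rewrite cx_iE; apply: cxeq; rewrite !(cxReD, cxImD, cxReM, cxImM) /=; ring.
have E2 : a * 'i = 'i * (complex.Re a)%:K - (complex.Im a)%:K.
  by rewrite {1}E1 mulrDl [_ * _ * 'i]mulrAC mulCii mulN1r mulrC.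
rewrite E2 {1}E1 !scalerDl scaleNr -!addrA; congr (_ + _).
Qed.

Lemma HspanZ a v : Hspan v -> Hspan (a *: v).
Proof.
move=> [h [h' [Hh Hh' ->]]]; rewrite scale_rect.
exists ((complex.Re a)%:K *: h - (complex.Im a)%:K *: h').
exists ((complex.Im a)%:K *: h + (complex.Re a)%:K *: h'); split=> //.
  by apply: std_sub; exact: (std_scale hH).
by apply: (std_add hH); exact: (std_scale hH).
Qed.

Lemma Hspan_comb (s : seq V) (c : V -> C) : (forall u, u \in s -> Hspan u) ->
  Hspan (\sum_(u <- s) c u *: u).
Proof.
elim: s => [|u s IH] sH; first by rewrite big_nil; exact: Hspan0.
rewrite big_cons; apply: HspanD; first by apply: HspanZ; apply: sH; rewrite mem_head.
by apply: IH => v vs; apply: sH; rewrite inE vs orbT.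
Qed.

(** An orthonormal family in [H + iH] can be completed inside [H + iH], since a
unit vector orthogonal to the family can be approximated from this dense
subspace. Hence [H + iH] is the whole space. *)
Lemma Hspan_orthonormal k : (k <= \dim {:V})%N ->
  exists2 s : seq V, size s = k /\ (forall u, u \in s -> Hspan u) & orthonormal form s.
Proof.
elim: k => [|k IH] lek; first by exists [::].
have [s [ss sH] os] := IH (ltnW lek).
have [|x ox] := dot_extend os; first by rewrite ss.
have [nx xs] : form x x = 1 /\ forall u, u \in s -> form x u = 0.
  case/orthonormalP: ox => /= /andP[xns _] oxs; split.
    by rewrite oxs ?mem_head // eqxx.
  move=> u us; rewrite oxs ?inE ?eqxx ?us ?orbT //.
  by case: eqP => // xu; rewrite xu us in xns.
have [h [h' [Hh Hh' close]]] := std_cyclic hH x (ltr01 : 0 < 1 :> R).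
set w := h + 'i *: h' in close.
have wH : Hspan w by exists h, h'.
pose y := w - \sum_(u <- s) form w u *: u.
have yH : Hspan y.
  apply: HspanD => //; rewrite -scaleN1r; apply: HspanZ.
  exact: Hspan_comb (form w) sH.
case/orthonormalP: (os) => us oss.
have yo u : u \in s -> form y u = 0.
  move=> uins; rewrite linearBl /= linear_sumlz /=.
  rewrite (bigD1_seq u) //= linearZl_LR /= (oss u u) // eqxx mulr1.
  rewrite big_seq_cond big1 ?addr0 ?subrr // => v /andP[ws wu].
  by rewrite linearZl_LR /= (oss v u) // (negPf wu) mulr0.
have y0 : y != 0.
  apply/eqP => /eqP; rewrite subr_eq0 => /eqP wE.
  have xw : ip form x w = 0.
    rewrite wE ip_sumr big_seq big1 // => u us'.
    by rewrite ipZr ip_conj /ip xs // conjC0 mulr0.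
  have : 1 <= hnorm form (x - w).
    rewrite -sqrtr1 ler_wsqrtr // -scaleN1r.
    rewrite ipDl !ipDr !ipZl !ipZr xw [ip form w x]ip_conj xw conjC0 !mulr0 addr0 add0r.
    rewrite rmorphN rmorph1 mulN1r mulN1r opprK cxReD [ip form x x]nx /= lerDl.
    by have [] := cxge0 (ip_ge0 form w).
  by rewrite leNgt close.
have ny : 0 < form y y by rewrite dnorm_gt0.
pose c := (sqrtC (form y y))^-1.
exists (c *: y :: s).
  split; first by rewrite /= ss.
  by move=> u; rewrite inE => /orP[/eqP ->|/sH //]; exact: HspanZ.
rewrite -cat1s orthonormal_cat os /= andbT.
apply/andP; split.
  rewrite /orthonormal /= !andbT linearZl_LR linearZr_LR /= mulrA.
  have cr : Num.conj c = c by apply: geC0_conj; rewrite invr_ge0 sqrtC_ge0 ltW.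
  rewrite cr -expr2 exprVn sqrtCK mulVf //; exact: lt0r_neq0.
rewrite /orthogonal /=.
by apply/allP => u /yo yu0; rewrite /= linearZl_LR /= yu0 mulr0.
Qed.

Lemma Hspan_all v : Hspan v.
Proof.
have [s [ss sH] os] := Hspan_orthonormal (leqnn _).
have bs : basis_of {:V} s.
  by rewrite basisEfree ss leqnn subvf andbT (orthonormal_free os).
have : v \in span s by rewrite (span_basis bs) memvf.
move=> /(@coord_span _ _ _ (Tuple (introT eqP ss)))/= ->.
have : forall i : 'I_(\dim {:V}), Hspan s`_i by move=> i; apply: sH; rewrite mem_nth ?ss.
elim: (index_enum _) => [|i r IH] Hs; first by rewrite big_nil; exact: Hspan0.
by rewrite big_cons; apply: HspanD; [apply: HspanZ; exact: Hs|exact: IH].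
Qed.

Lemma std_unique h h' k k' : H h -> H h' -> H k -> H k' ->
  h + 'i *: h' = k + 'i *: k' -> h = k /\ h' = k'.
Proof.
move=> Hh Hh' Hk Hk' E.
have E1 : h - k = 'i *: (k' - h').
  by rewrite scalerBr; apply/eqP; rewrite subr_eq addrAC -subr_eq opprK E addrC.
have hk : h = k.
  by apply/eqP; rewrite -subr_eq0 (std_separating hH (std_sub Hh Hk) (std_sub Hk' Hh') E1).
split=> //; move/eqP: E1; rewrite hk subrr eq_sym scaler_eq0 (negPf (neq0Ci _)) /= subr_eq0.
by move=> /eqP.
Qed.

Lemma tomitaE h h' : H h -> H h' -> S (h + 'i *: h') = h - 'i *: h'.
Proof.
move=> Hh Hh'; rewrite /tomita; set P := [set p : V * V | _].
have : P (xget (0, 0) P).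
  by apply: xgetPex; exists (h, h').
case: (xget (0, 0) P) => k k' [/= Hk Hk' E].
by have [-> ->] := std_unique Hh Hh' Hk Hk' E.
Qed.

Lemma tomita_antilinear : antilinear S.
Proof.
move=> a u v.
have [h [h' [Hh Hh' ->]]] := Hspan_all u; have [k [k' [Hk Hk' ->]]] := Hspan_all v.
rewrite scale_rect.
have A1 : H ((complex.Re a)%:K *: h - (complex.Im a)%:K *: h').
  by apply: std_sub; exact: (std_scale hH).
have A2 : H ((complex.Im a)%:K *: h + (complex.Re a)%:K *: h').
  by apply: (std_add hH); exact: (std_scale hH).
rewrite addrACA -scalerDr tomitaE ?tomitaE //; try exact: (std_add hH).
have -> : h - 'i *: h' = h + 'i *: (- h') by rewrite scalerN.
rewrite scale_rect cxRe_conj cxIm_conj.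
have n (r : R) : ((- r)%:K : C) = - r%:K by apply: cxeq => //=; rewrite oppr0.
rewrite (n (complex.Im a)) !(scaleNr, scalerN, opprK, scalerDr, opprD).
rewrite -!addrA; congr (_ + _); rewrite addrA [RHS]addrA.
rewrite -!addrA; congr (_ + _); rewrite [LHS]addrCA; congr (_ + _).
by rewrite [LHS]addrCA.
Qed.

Lemma tomita_involutive : involutive S.
Proof.
move=> v; have [h [h' [Hh Hh' ->]]] := Hspan_all v.
rewrite tomitaE //; have -> : h - 'i *: h' = h + 'i *: (- h') by rewrite scalerN.
rewrite tomitaE ?scalerN ?opprK //.
by have := std_sub (std_zero hH) Hh'; rewrite sub0r.
Qed.

End Tomita.

(** * Functional calculus of the modular operator *)

Section ModularCalculus.
Variables (R : realType) (V : vectType (Cx R)) (form : {dot V for Num.conj}).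
Local Notation C := (Cx R).
Local Notation d := (\dim {:V}).
Local Notation e := (tnth (onb form)).
Local Notation coord := (Defs.coord form).
Local Notation ip := (Defs.ip form).
Variable H : set V.
Local Notation S := (tomita H).
Hypothesis lS : antilinear S.
Hypothesis iS : involutive S.
Local Notation Delta := (modular form H).

Definition modular_mx : 'M[C]_d := \matrix_(i, j) coord i (Delta (e j)).
Local Notation M := modular_mx.
Local Notation P := (spectralmx M).
Local Notation sp := (spectral_diag M).

Lemma modular_mxE i j : M i j = ip (S (e j)) (S (e i)).
Proof. by rewrite mxE /Defs.coord /modular /= ip_antiadjoint. Qed.

Lemma modular_mx_herm : M \is hermsymmx.
Proof.
apply/is_hermitianmxP; rewrite expr0 scale1r; apply/matrixP => i j.
rewrite [RHS]mxE [X in _ = _ X]mxE !modular_mxE.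
exact: ip_conj.
Qed.

Lemma modular_spectral : M = invmx P *m diag_mx sp *m P.
Proof. exact/orthomx_spectralP/hermitian_normalmx/modular_mx_herm. Qed.

Lemma spectralP_unit : P \in unitmx. Proof. exact: spectral_unit. Qed.

Lemma invmx_spectralE i a : invmx P i a = Num.conj (P a i).
Proof. by rewrite invmx_unitary ?spectral_unitarymx // !mxE. Qed.

(** For a unit eigenvector [v] the eigenvalue is [<S v, S v>], and [S] is
injective. *)
Lemma modular_eigen_gt0 a : 0 < sp 0 a.
Proof.
have E : diag_mx sp = P *m M *m invmx P.
  have := congr1 (fun X => P *m X *m invmx P) modular_spectral => /= ->.
  by rewrite !mulmxA mulmxV ?spectralP_unit // mul1mx mulmxK ?spectralP_unit.
(* The eigenvector for the [a]-th eigenvalue. *)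
pose v := \sum_j Num.conj (P a j) *: e j.
have -> : sp 0 a = ip (S v) (S v).
  have -> : sp 0 a = diag_mx sp a a by rewrite !mxE eqxx mulr1n.
  rewrite E !mxE /v antilinear_sum // ip_suml; apply: eq_bigr => j _.
  rewrite mxE invmx_spectralE antilinearZ // conjCK ipZl ip_sumr mulr_suml mulr_sumr.
  apply: eq_bigr => i _.
  by rewrite antilinearZ // conjCK ipZr modular_mxE; ring.
apply: ip_gt0; apply/eqP => Sv0.
have v0 : v = 0 by rewrite -[v]iS Sv0 antilinear0.
have /matrixP/(_ a a) := mulmxV spectralP_unit; rewrite !mxE eqxx.
rewrite big1 => [/eqP|i _]; first by rewrite eq_sym oner_eq0.
rewrite invmx_spectralE -(coord_sum form (fun j => Num.conj (P a j))) -/v v0.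
by rewrite /Defs.coord /ip linear0l mulr0.
Qed.

Definition calc_mx (g : R -> C) : 'M[C]_d :=
  invmx P *m diag_mx (map_mx (fun z : C => g (complex.Re z)) sp) *m P.

Lemma coord_funcalc g v i :
  coord i (funcalc form g Delta v) = \sum_j calc_mx g i j * coord j v.
Proof. by rewrite /funcalc coord_sum. Qed.

Lemma calc_mxE g i j : calc_mx g i j =
  \sum_a Num.conj (P a i) * g (complex.Re (sp 0 a)) * P a j.
Proof.
rewrite mxE; apply: eq_bigr => a _; congr (_ * _).
by rewrite mul_mx_diag mxE invmx_spectralE mxE.
Qed.

Lemma calc_mxM g h : calc_mx g *m calc_mx h = calc_mx (fun x => g x * h x).
Proof.
rewrite /calc_mx !mulmxA mulmxK ?spectralP_unit // -[_ *m diag_mx _ *m diag_mx _]mulmxA.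
congr (_ *m _ *m _); apply/matrixP => i j; rewrite mul_diag_mx !mxE.
by case: eqP => [->|]; rewrite ?mulr1n // !mulr0n mulr0.
Qed.

Lemma calc_mx_eq g h : (forall x, 0 < x -> g x = h x) -> calc_mx g = calc_mx h.
Proof.
move=> gh; apply/matrixP => i j; rewrite !calc_mxE; apply: eq_bigr => a _.
by rewrite gh //; have [] := cxgt0 (modular_eigen_gt0 a).
Qed.

Lemma calc_mx1 : calc_mx (fun=> 1) = 1%:M.
Proof.
rewrite /calc_mx (_ : diag_mx _ = 1%:M) ?mulmx1 ?mulVmx ?spectralP_unit //.
by apply/matrixP => i j; rewrite !mxE.
Qed.

Lemma calc_mx_id : calc_mx (fun x => x%:K) = M.
Proof.
rewrite [RHS]modular_spectral /calc_mx; congr (_ *m diag_mx _ *m _).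
apply/rowP => a; rewrite mxE; have [<- _] := cxgt0 (modular_eigen_gt0 a).
by [].
Qed.

Lemma funcalc_eq g h v : (forall x, 0 < x -> g x = h x) ->
  funcalc form g Delta v = funcalc form h Delta v.
Proof.
move=> gh; apply: (coordP (form := form)) => i.
have E1 := coord_funcalc g v i.
have E2 := coord_funcalc h v i.
have E := calc_mx_eq gh.
exact: (etrans E1 (etrans (f_equal (fun X : 'M[C]_d => \sum_j X i j * coord j v) E) (esym E2))).
Qed.

Lemma funcalc_comp g h v : funcalc form g Delta (funcalc form h Delta v) =
  funcalc form (fun x => g x * h x) Delta v.
Proof.
apply: (coordP (form := form)) => i.
rewrite (coord_funcalc g _ i) (coord_funcalc (fun x => g x * h x) v i) -calc_mxM.
under eq_bigr => j _ do rewrite (coord_funcalc h v j) mulr_sumr.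
rewrite exchange_big; apply: eq_bigr => j _ /=.
by rewrite mxE mulr_suml; apply: eq_bigr => k _; rewrite mulrA.
Qed.

Lemma funcalc1 v : funcalc form (fun=> 1) Delta v = v.
Proof.
apply: (coordP (form := form)) => i; rewrite (coord_funcalc (fun=> 1) v i) calc_mx1.
rewrite (bigD1 i) //= !mxE eqxx mul1r big1 ?addr0 // => j ji.
by rewrite mxE eq_sym (negPf ji) mul0r.
Qed.

Lemma modular_linear (a : C) u v : Delta (a *: u + v) = a *: Delta u + Delta v.
Proof.
have lSd := antiadjoint_antilinear form lS.
by rewrite /modular /= lS lSd conjCK.
Qed.

Lemma funcalc_id v : funcalc form (fun x => x%:K) Delta v = Delta v.
Proof.
apply: (coordP (form := form)) => i.
rewrite (coord_funcalc (fun x => x%:K) v i) calc_mx_id.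
rewrite [in RHS](onb_expand form v) /Defs.coord.
have -> : forall c : 'I_d -> C, Delta (\sum_j c j *: e j) = \sum_j c j *: Delta (e j).
  move=> c; elim: (index_enum _) => [|j r IH].
    by rewrite !big_nil; have := modular_linear (-1) 0 0;
      rewrite scaler0 addr0 scaleN1r => E; rewrite {1}E addNr.
  by rewrite !big_cons modular_linear IH.
by rewrite ip_sumr; apply: eq_bigr => j _; rewrite mxE ipZr mulrC.
Qed.

Lemma funcalc_selfadjoint (g : R -> R) u v :
  ip (funcalc form (fun x => (g x)%:K) Delta u) v =
  ip u (funcalc form (fun x => (g x)%:K) Delta v).
Proof.
rewrite !ip_coord.
under eq_bigr => i _ do rewrite (coord_funcalc (fun x => (g x)%:K) u i) rmorph_sum mulr_suml.
under [RHS]eq_bigr => i _ do rewrite (coord_funcalc (fun x => (g x)%:K) v i) mulr_sumr.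
rewrite exchange_big; apply: eq_bigr => j _; apply: eq_bigr => i _ /=.
rewrite rmorphM /= !calc_mxE rmorph_sum.
rewrite [_ * Num.conj (coord j u)]mulrC -mulrA; congr (_ * (_ * _)).
apply: eq_bigr => a _ /=; rewrite !rmorphM /= conjCK cxconj_real; ring.
Qed.

Lemma funcalc_linear g (a : C) u v :
  funcalc form g Delta (a *: u + v) = a *: funcalc form g Delta u + funcalc form g Delta v.
Proof.
apply: (coordP (form := form)) => i.
rewrite [RHS]ip_linear -!/(Defs.coord form i _).
rewrite (coord_funcalc g (a *: u + v) i) (coord_funcalc g u i) (coord_funcalc g v i).
rewrite mulr_sumr -big_split /=.
by apply: eq_bigr => j _; rewrite /Defs.coord ip_linear; ring.
Qed.

End ModularCalculus.

(** * Crossing symmetry as an identity of matrices *)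

Section CrossingKernel.
Variables (R : realType) (V : vectType (Cx R)) (form : {dot V for Num.conj}).
Local Notation C := (Cx R).
Local Notation d := (\dim {:V}).
Local Notation e := (tnth (onb form)).
Local Notation coord := (Defs.coord form).
Local Notation ip := (Defs.ip form).
Local Notation tensor := (tensor form).
Variables (H : set V) (T : square_op V).
Local Notation S := (tomita H).
Hypothesis lS : antilinear S.
Hypothesis iS : involutive S.
Local Notation Delta := (modular form H).
Local Notation fc g := (funcalc form g (modular form H)).

Lemma tip2E f g : tip 2 f g =
  \sum_(x : 'I_d) \sum_(y : 'I_d) Num.conj (f [:: x; y]) * g [:: x; y].
Proof.
by rewrite tipE wsumS; apply: eq_bigr => x _; rewrite wsumS; apply: eq_bigr => y _; rewrite wsum0.
Qed.

Lemma opT0_2E f x y :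
  opT T 0 f [:: x; y] = \sum_(p : 'I_d * 'I_d) T (x, y) p * f [:: p.1; p.2].
Proof. by []. Qed.

Lemma otimes2E A B f x y : otimes2 form A B f [:: x; y] = \sum_(p : 'I_d * 'I_d)
  coord x (A (e p.1)) * coord y (B (e p.2)) * f [:: p.1; p.2].
Proof. by []. Qed.

Lemma tensor2E u v x y : tensor [:: u; v] [:: x; y] = coord x u * coord y v.
Proof. by rewrite /= mulr1. Qed.

(** The matrix element of the crossing relation, the imaginary power of the
modular operator being continued to [z]. *)
Definition cross_fun psi1 psi2 psi3 psi4 (z : C) : C :=
  tip 2 (tensor [:: psi2; psi1])
    (otimes2 form (fc (fun x => cexp (ln x) z)) id
      (opT T 0 (otimes2 form id (fc (fun x => cexp (- ln x) z))
        (tensor [:: psi3; psi4])))).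

Lemma jet2_funcalc (l : R -> R) v i z0 :
  jet2 (fun z => coord i (fc (fun x => cexp (l x) z) v)) z0.
Proof.
rewrite (_ : (fun z => _) = fun z => \sum_j (\sum_a
   (Num.conj (spectralmx (modular_mx form H) a i) *
    cexp (l (complex.Re (spectral_diag (modular_mx form H) 0 a))) z *
    spectralmx (modular_mx form H) a j)) * coord j v).
  apply: jet2_sum => j; apply: jet2M; last exact: jet2_cst.
  apply: jet2_sum => a; apply: jet2M; last exact: jet2_cst.
  by apply: jet2M; [exact: jet2_cst|exact: cexp_jet2].
apply: funext => z; rewrite coord_funcalc; apply: eq_bigr => j _.
by rewrite calc_mxE.
Qed.

Lemma jet2_cross psi1 psi2 psi3 psi4 z0 : jet2 (cross_fun psi1 psi2 psi3 psi4) z0.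
Proof.
rewrite (_ : cross_fun _ _ _ _ = fun z => \sum_(x : 'I_d) \sum_(y : 'I_d)
  Num.conj (tensor [:: psi2; psi1] [:: x; y]) * \sum_(p : 'I_d * 'I_d)
   (coord x (fc (fun x => cexp (ln x) z) (e p.1)) * coord y (e p.2) *
    \sum_(q : 'I_d * 'I_d) T (p.1, p.2) q * \sum_(r : 'I_d * 'I_d)
      (coord q.1 (e r.1) * coord q.2 (fc (fun x => cexp (- ln x) z) (e r.2)) *
       tensor [:: psi3; psi4] [:: r.1; r.2]))).
  apply: jet2_sum => x; apply: jet2_sum => y; apply: jet2M; first exact: jet2_cst.
  apply: jet2_sum => p; apply: jet2M.
    by apply: jet2M; [exact: jet2_funcalc|exact: jet2_cst].
  apply: jet2_sum => q; apply: jet2M; first exact: jet2_cst.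
  apply: jet2_sum => r; apply: jet2M; last exact: jet2_cst.
  by apply: jet2M; [exact: jet2_cst|exact: jet2_funcalc].
by apply: funext => z; rewrite /cross_fun tip2E.
Qed.

Lemma modular_itE t : modular_it form H t = fc (fun x => cexp (ln x) t%:K).
Proof.
apply: (f_equal (fun g => funcalc form g Delta)); apply: funext => x.
by rewrite /cexp /= mulr0 oppr0 expR0 mul1r.
Qed.

Lemma modular_itNE t : modular_it form H (- t) = fc (fun x => cexp (- ln x) t%:K).
Proof.
apply: (f_equal (fun g => funcalc form g Delta)); apply: funext => x.
by rewrite /cexp /= mulr0 oppr0 expR0 mul1r mulNr mulrN.
Qed.

Lemma modular_it0 v : modular_it form H 0 v = v.
Proof.
rewrite modular_itE; apply: etrans (funcalc1 form H v).
apply: (f_equal (fun g => funcalc form g Delta v)).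
by apply: funext => x; rewrite cexp0.
Qed.

Local Notation isqrt := (fc (fun x => ((Num.sqrt x)^-1)%:K)).
Local Notation dsqrt := (fc (fun x => (Num.sqrt x)%:K)).

Lemma sqrt_expR (x : R) : 0 < x -> Num.sqrt x = expR (ln x / 2).
Proof.
move=> x0; apply/eqP; rewrite -(eqrXn2 (n := 2)) ?sqrtr_ge0 ?expR_ge0 //.
rewrite sqr_sqrtr ?(ltW x0) // -expRM_natl.
by rewrite mulrC divfK ?pnatr_eq0 // lnK.
Qed.

Lemma cexp_half (L : R) : cexp L (0 +i* 2^-1)%C = (expR (- (L / 2)))%:K.
Proof.
by rewrite /cexp /= mul0r cos0 sin0 mulr1.
Qed.

Lemma isqrt_half v : fc (fun x => cexp (ln x) (0 +i* 2^-1)%C) v = isqrt v.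
Proof.
apply: (funcalc_eq form lS iS (g := fun x => cexp (ln x) (0 +i* 2^-1)%C)
  (h := fun x => ((Num.sqrt x)^-1)%:K)) => x x0; rewrite cexp_half; congr (_%:K).
by rewrite expRN sqrt_expR.
Qed.

Lemma dsqrt_half v : fc (fun x => cexp (- ln x) (0 +i* 2^-1)%C) v = dsqrt v.
Proof.
apply: (funcalc_eq form lS iS (g := fun x => cexp (- ln x) (0 +i* 2^-1)%C)
  (h := fun x => (Num.sqrt x)%:K)) => x x0; rewrite cexp_half; congr (_%:K).
by rewrite mulNr opprK sqrt_expR.
Qed.

Lemma isqrt_dsqrt v : isqrt (dsqrt v) = v.
Proof.
rewrite funcalc_comp; apply: etrans (funcalc1 form H v).
apply: (funcalc_eq form lS iS (h := fun=> 1)) => x x0.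
by rewrite -cxCM mulVf // lt0r_neq0 // sqrtr_gt0.
Qed.

Lemma dsqrt_isqrt v : dsqrt (isqrt v) = v.
Proof.
rewrite funcalc_comp; apply: etrans (funcalc1 form H v).
apply: (funcalc_eq form lS iS (h := fun=> 1)) => x x0.
by rewrite -cxCM mulfV // lt0r_neq0 // sqrtr_gt0.
Qed.

Lemma modular_isqrt v : Delta (isqrt (isqrt v)) = v.
Proof.
rewrite -(funcalc_id form lS iS) !funcalc_comp; apply: etrans (funcalc1 form H v).
apply: (funcalc_eq form lS iS (h := fun=> 1)) => x x0; rewrite -!cxCM.
have s0 : Num.sqrt x != 0 by rewrite lt0r_neq0 // sqrtr_gt0.
have -> : x * (Num.sqrt x)^-1 * (Num.sqrt x)^-1 = 1 :> R.
  by rewrite -{1}(sqr_sqrtr (ltW x0)); field.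
by [].
Qed.

Lemma otimes2_idid f x y : otimes2 form id id f [:: x; y] = f [:: x; y].
Proof.
rewrite otimes2E (bigD1 (x, y)) //= !coord_onb !eqxx !mul1r big1 ?addr0 //.
move=> [a b] /=; rewrite xpair_eqE negb_and !coord_onb => /orP[] ab.
  by rewrite eq_sym (negPf ab) !mul0r.
by rewrite [y == b]eq_sym (negPf ab) mulr0 mul0r.
Qed.

Lemma otimes2_right (g : R -> C) u v x y :
  otimes2 form id (fc g) (tensor [:: u; v]) [:: x; y] = tensor [:: u; fc g v] [:: x; y].
Proof.
rewrite otimes2E tensor2E.
rewrite -(pair_bigA _ (fun a b => coord x (id (e a)) * coord y (fc g (e b)) *
   tensor [:: u; v] [:: a; b])) /=.
rewrite (bigD1 x) //= [X in _ + X]big1 ?addr0; last first.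
  by move=> a ax; rewrite big1 // => b _; rewrite coord_onb eq_sym (negPf ax) !mul0r.
have -> : fc g v = \sum_b coord b v *: fc g (e b).
  rewrite {1}(onb_expand form v).
  elim: (index_enum _) => [|b r IH].
    rewrite !big_nil; have := funcalc_linear form H g (-1) 0 0.
    by rewrite scaler0 addr0 scaleN1r => E; rewrite {1}E addNr.
  by rewrite !big_cons funcalc_linear IH.
rewrite /Defs.coord ip_sumr mulr_sumr; apply: eq_bigr => b _.
by rewrite ip_onb eqxx ipZr mulr1n; ring.
Qed.

Lemma tip_otimes2_left (g : R -> R) u v f :
  tip 2 (tensor [:: u; v]) (otimes2 form (fc (fun x => (g x)%:K)) id f) =
  tip 2 (tensor [:: fc (fun x => (g x)%:K) u; v]) f.
Proof.
rewrite !tip2E exchange_big [RHS]exchange_big; apply: eq_bigr => y _.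
transitivity (\sum_x \sum_a Num.conj (coord x u) * coord x (fc (fun x => (g x)%:K) (e a)) *
    Num.conj (coord y v) * f [:: a; y]).
  apply: eq_bigr => x _; rewrite otimes2E tensor2E.
  rewrite -(pair_bigA _ (fun a b => coord x (fc (fun x => (g x)%:K) (e a)) *
     coord y (id (e b)) * f [:: a; b])) /= mulr_sumr; apply: eq_bigr => a _.
  rewrite (bigD1 y) //= coord_onb eqxx big1 ?addr0 => [|b bn]; last first.
    by rewrite coord_onb eq_sym (negPf bn) mulr0 mul0r.
  by rewrite rmorphM /=; ring.
rewrite exchange_big; apply: eq_bigr => a _ /=.
rewrite mulr1 rmorphM /= -!mulr_suml; congr (_ * _ * _).
by rewrite -ip_coord -funcalc_selfadjoint // ip_conj.
Qed.

Lemma tip_tensor_onbr u v f :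
  tip 2 (tensor [:: u; e v]) f = \sum_x ip u (e x) * f [:: x; v].
Proof.
rewrite tip2E; apply: eq_bigr => x _; rewrite (bigD1 v) // big1 => [|y yv].
  by rewrite tensor2E coord_onb eqxx mulr1 ip_conj; exact: addr0.
by rewrite tensor2E coord_onb (negPf yv) mulr0 rmorph0 mul0r.
Qed.

Lemma tip_tensor_onbl u v f :
  tip 2 (tensor [:: e v; u]) f = \sum_y ip u (e y) * f [:: v; y].
Proof.
rewrite tip2E (big_only1 v) // => [|x xv _].
  apply: eq_bigr => y _.
  by rewrite tensor2E coord_onb eqxx mul1r ip_conj.
by apply: big1 => y _; rewrite tensor2E coord_onb (negPf xv) mul0r rmorph0 mul0r.
Qed.

Lemma opT_onb2 b c x y : opT T 0 (tensor [:: e b; e c]) [:: x; y] = T (x, y) (b, c).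
Proof.
rewrite opT0_2E (bigD1 (b, c)) // big1 => [|[p q]].
  by rewrite tensor2E !coord_onb !eqxx !mulr1; exact: addr0.
rewrite xpair_eqE negb_and tensor2E !coord_onb => /orP[] /negPf ->.
  by rewrite mul0r mulr0.
by rewrite !mulr0.
Qed.

(** The function given by crossing symmetry and [cross_fun] agree on the real
line, hence at [i / 2] by [strip_unique]. There the imaginary powers of the
modular operator become [Delta^(-1/2)] and [Delta^(1/2)], and the vectors
[psi2 = Delta^(1/2) S e_a] and [psi4 = Delta^(-1/2) e_c] are chosen so that
all roots cancel. *)
Lemma crossing_kernel : crossing_symmetric form T H -> kernel_crossing form H T.
Proof.
move=> cs a b c v.
pose psi2 := dsqrt (S (e a)); pose psi4 := isqrt (e c).
have [F [cF _ anF Fr Fi]] := cs (e v) psi2 (e b) psi4.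
pose E := cross_fun (e v) psi2 (e b) psi4.
have FE : F (0 +i* 2^-1)%C = E (0 +i* 2^-1)%C.
  apply/eqP; rewrite -subr_eq0; apply/eqP.
  apply: (@strip_unique R (fun z => F z - E z)).
  - apply: cont_onB; first exact: cont_on_within.
    by apply: cont_on_jet => z _; exact: jet2_cross.
  - move=> z /andP[z0 z1]; rewrite (_ : (fun z => F z - E z) = fun z => F z + (-1) * E z).
      apply: jet2D; first by apply: jet2_analytic; exact: anF.
      by apply: jet2M; [exact: jet2_cst|exact: jet2_cross].
    by apply: funext => w; rewrite mulN1r.
  - by move=> t; rewrite Fr /E /cross_fun modular_itE modular_itNE subrr.
have := Fi 0; rewrite FE /E /cross_fun.
have -> : fc (fun x => cexp (ln x) (0 +i* 2^-1)%C) = isqrt.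
  by apply: funext => u; exact: isqrt_half.
have -> : fc (fun x => cexp (- ln x) (0 +i* 2^-1)%C) = dsqrt.
  by apply: funext => u; exact: dsqrt_half.
have -> : modular_it form H 0 = id by apply: funext => u; exact: modular_it0.
have -> : modular_it form H (- 0) = id.
  by apply: funext => u; rewrite oppr0; exact: modular_it0.
rewrite tip_otimes2_left isqrt_dsqrt.
have e1 : modular_conj form H psi2 = e a.
  by rewrite /modular_conj /= isqrt_dsqrt iS.
rewrite e1; move=> eq1.
transitivity (tip 2 (tensor [:: S (e a); e v]) (opT T 0 (tensor [:: e b; e c]))).
  rewrite tip_tensor_onbr; apply: eq_bigr => x _.
  by rewrite opT_onb2.
transitivity (tip 2 (tensor [:: e v; modular_conj form H psi4]) (opT T 0 (tensor [:: e a; e b]))).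
  apply: etrans _ (etrans eq1 _).
    rewrite !tip2E; apply: eq_bigr => x _; apply: eq_bigr => y _; congr (_ * _).
    rewrite !opT0_2E; apply: eq_bigr => p _; congr (_ * _).
    by rewrite otimes2_right dsqrt_isqrt.
  rewrite !tip2E; apply: eq_bigr => x _; apply: eq_bigr => y _; congr (_ * _).
  rewrite otimes2_idid !opT0_2E; apply: eq_bigr => p _; congr (_ * _).
  exact: otimes2_idid.
rewrite tip_tensor_onbl; apply: eq_bigr => y _; rewrite opT_onb2 mulrC.
congr (_ * _).
rewrite /modular_conj /= /psi4; set u := isqrt (isqrt (e c)).
have uE : Delta u = e c by exact: modular_isqrt.
rewrite /tomita_kernel -uE /modular /=.
by rewrite ip_antiadjoint // iS.
Qed.

End CrossingKernel.

(** * The Wick formula *)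

Lemma tensor_homog (R : realType) (V : vectType (Cx R))
  (form : {dot V for Num.conj}) (xs : seq V) : homog (size xs) (tensor form xs).
Proof.
elim: xs => [|x xs IH] [|i w] //= sw; rewrite IH ?mulr0 //.
Qed.

Theorem theorem3p13 (R : realType) (V : vectType (Cx R))
  (form : {dot V for Num.conj}) (H : set V) (T : square_op V)
  (hH : standard_subspace form H)
  (hstrict : strict_twist T) (hcompat : compatible form T H)
  (hbraided : braided T) (hcrossing : crossing_symmetric form T H)
  (hT : square_op_norm T < 1)
  (n : nat) (hn : (1 <= n)%N) (xi : n.-tuple V)
  (phi : {set {set 'I_n}} -> seq ('I_n * 'I_n))
  (hphi : forall P, P \in partitions12 n -> admissible P (phi P)) :
  forall f : tens V, fock T f ->
    wick form T H (tensor form xi) f =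
    field_map form T H
      (fun w => \sum_(P in partitions12 n) (-1) ^+ #|pairings P| *
         WT form T H (val_pairs (phi P)) (tensor form xi) w) f.
Proof.
move=> f cf.
have lS := tomita_antilinear hH.
have iS := tomita_involutive hH.
have cr := crossing_kernel lS iS hcrossing.
have ht : homog n (tensor form xi) by rewrite -[n in homog n](size_tuple xi); exact: tensor_homog.
have := wick_Qop hstrict hT lS (Hspan_all hH) hbraided iS cr ht cf.
move=> ->; congr (field_map form T H _ f); apply: funext => w.
by rewrite (WT_sum hbraided cr w ht hphi).
Qed.
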